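(* Let $X$ be a hyperelliptic surface of genus $g$ with a defining polynomial whose coefficients are real and not all of whose roots are real. Assume $X$ has a symmetry $\tau$ induced by complex conjugation. Then $\tau$ fixes $2^{g+k-1}$ $2$-spin structures on $X$, where $2k$ is the number of real branch points. In particular, the Klein surface $X/\langle\tau\rangle$ has only (that is, exactly) $2^{g+k-1}$ $2$-spin structures.
   Context: A hyperelliptic surface $X$ of genus $g$ is the compact Riemann surface defined by $y^2=\prod_{i=1}^{N}(x-e_i)$ with distinct $e_i\in\mathbb{C}$ and $N=2g+2$ or $N=2g+1$; the map $\pi:(x,y)\mapsto x$ is a double covering of the Riemann sphere with $2g+2$ ramification points, lying over the $e_i$ and, when $N=2g+1$, also over $\infty$. Branch points are identified with the ramification points above them; by convention the point at $\infty$, if it is a branch point, is counted as real. A symmetry is an anti-holomorphic involution $\tau:X\to X$; it is induced by complex conjugation if $\pi(\tau(q))=\overline{\pi(q)}$ for all $q\in X$. A $2$-spin structure on $X$ is a linear equivalence class of divisors $D$ with $2D\sim K_X$, $K_X$ a canonical divisor. $\tau$ acts on divisors by $\tau(\sum a_i x_i)=\sum a_i\tau(x_i)$, and ''fixes'' means $\tau(D)\sim D$. In terms of divisors, the $2$-spin structures on the Klein surface $X/\langle\tau\rangle$ are the $\tau$-invariant $2$-spin structures on $X$.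
   Formalization: It is assumed that there is at least one real branch point (k > 0). For k = 0 the claim is false: the number of fixed 2-spin structures is then 2^g for g even and 2^(g+1) for g odd (e.g. 4 instead of 2 for a real sextic with no real roots, g = 2). *)

(* Defs.v *)
(* The field of complex numbers is R[i], with R any realType. *)
From mathcomp Require Import all_boot all_order all_algebra.
From mathcomp Require Import complex.
From mathcomp Require Import all_classical all_reals all_analysis.
From mathcomp Require Import freeg.

Set Implicit Arguments.
Unset Strict Implicit.
Unset Printing Implicit Defensive.

Import Order.TTheory GRing.Theory Num.Theory.
Import numFieldNormedType.Exports.

Local Open Scope classical_set_scope.
Local Open Scope ring_scope.

Definition defining_poly (R : realType) (e : seq R[i]) : {poly R[i]} :=
  \prod_(a <- e) ('X - a%:P).

(* With N = size e equal to 2g+1 or 2g+2, the compact Riemann surface is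
   obtained by gluing the smooth affine curves
     y ^ 2 = f(x)   and   v ^ 2 = w ^ (2g+2) f(1/w)
   along w = 1/x, v = y / x ^ (g+1).  A point is either inl (x, y), or a point
   inr v of the second curve with w = 0, where v ^ 2 is the coefficient of
   x ^ (2g+2) in f: this gives two points (v = 1, -1) when N = 2g+2 and one
   (v = 0) when N = 2g+1. *)
Definition on_surface (R : realType) (g : nat) (e : seq R[i])
    (q : (R[i] * R[i]) + R[i]) : bool :=
  match q with
  | inl (x, y) => y ^+ 2 == (defining_poly e).[x]
  | inr v => v ^+ 2 == (defining_poly e)`_(g.*2.+2)
  end.

Definition surface (R : realType) (g : nat) (e : seq R[i]) :=
  {q : (R[i] * R[i]) + R[i] | on_surface g e q}.

Section Surface.
Variables (R : realType) (g : nat) (e : seq R[i]).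

Notation X := (surface g e).
Implicit Types (p q : X) (F : X -> R[i]) (n m : int).

(* The Riemann sphere is option R[i], with None the point at infinity. *)
Definition proj q : option R[i] :=
  match val q with inl (x, _) => Some x | inr _ => None end.

(* The function x; its value at the points at infinity is irrelevant. *)
Definition xfun q : R[i] :=
  match val q with inl (x, _) => x | inr _ => 0 end.

Definition surface_ball p (r : R[i]) : set X := [set q |
  match val p, val q with
  | inl (a, b), inl (x, y) => `|x - a| < r /\ `|y - b| < r
  | inl _, inr _ => False
  | inr c, inl (x, y) =>
      [/\ x != 0, `|x^-1| < r & `|y / x ^+ g.+1 - c| < r]
  | inr c, inr v => `|v - c| < r
  end].

Definition surface_nbhs p : set_system X :=
  [set A | exists2 r : R[i], 0 < r & surface_ball p r `<=` A].

(* The charts given by the implicit function theorem on each affine curve: x - a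
   (resp. w) where y (resp. v) does not vanish, and y (resp. v) elsewhere. *)
Definition local_coord p q : R[i] :=
  match val p with
  | inl (a, b) =>
      match val q with
      | inl (x, y) => if b != 0 then x - a else y
      | inr _ => 0
      end
  | inr c =>
      match val q with
      | inl (x, y) => if c != 0 then x^-1 else y / x ^+ g.+1
      | inr v => if c != 0 then 0 else v
      end
  end.

Definition pseries_sum (K : numFieldType) (a : nat -> K) (z s : K) : Prop :=
  [series a j * z ^+ j]_j @ \oo --> s.

(* F(q) = z ^ n * sum_j a_j z ^ j in a punctured neighborhood of p, with z the
   local coordinate at p. *)
Definition laurent p F n (a : nat -> R[i]) : Prop :=
  \forall q \near surface_nbhs p, q != p ->
    pseries_sum a (local_coord p q) (F q / local_coord p q ^ n).

Definition has_order p F n : Prop :=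
  exists2 a, a 0%N != 0 & laurent p F n a.

(* The order of dF at p, read off from the derivative with respect to z of the
   Laurent expansion of F, whose coefficients are (n + j) a_j z ^ (n + j - 1). *)
Definition has_order_d p F m : Prop :=
  exists n a j,
    [/\ laurent p F n a,
        m = n + j%:Z - 1,
        (n + j%:Z)%:~R * a j != 0
      & forall i, (i < j)%N -> (n + i%:Z)%:~R * a i = 0].

Definition divisor := {freeg X / int}.
Implicit Types (D K : divisor).

(* A meromorphic function is represented by a map to R[i] whose values at its
   poles are irrelevant. *)
Definition principal D : Prop :=
  exists F, forall p, has_order p F (coeff p D).

Definition lin_equiv D D' : Prop := principal (D - D').

(* Divisors of the nonzero meromorphic differentials, all of the form F dx. *)
Definition canonical K : Prop :=
  exists F, forall p, exists n m,
    [/\ has_order p F n, has_order_d p xfun m & coeff p K = n + m].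

Definition div_class D : set divisor := [set D' | lin_equiv D D'].

Definition spin_structures : set (set divisor) :=
  [set S | exists D, S = div_class D /\
     exists2 K, canonical K & lin_equiv (D *+ 2) K].

(* In the charts at p and tau p, the complex conjugate of tau is the sum of a
   convergent power series. *)
Definition antiholomorphic (tau : X -> X) : Prop :=
  forall p,
    tau @ surface_nbhs p --> surface_nbhs (tau p) /\
    exists a, \forall q \near surface_nbhs p,
      pseries_sum a (local_coord p q) (local_coord (tau p) (tau q))^*%C.

Definition symmetry (tau : X -> X) : Prop :=
  antiholomorphic tau /\ involutive tau.

Definition induced_by_conj (tau : X -> X) : Prop :=
  forall q, proj (tau q) = omap (@conjc R) (proj q).

Definition act_div (tau : X -> X) D : divisor :=
  \sum_(p <- dom D) << coeff p D *g tau p >>.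

Definition fixes (tau : X -> X) (S : set divisor) : Prop :=
  forall D, S D -> lin_equiv (act_div tau D) D.

Definition klein_spin_structures (tau : X -> X) : set (set divisor) :=
  [set S | spin_structures S /\ act_div tau @` S = S].

End Surface.

Definition branch_points (R : realType) (e : seq R[i]) : seq (option R[i]) :=
  map Some e ++ (if odd (size e) then [:: None] else [::]).

(* The point at infinity, when it is a branch point, counts as real. *)
Definition num_real_branch_points (R : realType) (e : seq R[i]) : nat :=
  count (oapp (fun a => a \is Num.real) true) (branch_points e).

(* Main.v *)
(* Let iota be the hyperelliptic involution and W the set of its 2g+2 fixed points.
   Since k > 0, two of them, r0 and r1, are fixed by the symmetry tau.  All fibres
   of the projection are linearly equivalent to 2 r0, and (g-1) times a fibre is a
   canonical divisor (the class of the divisor of dx / y), so D is a spin structure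
   iff 2 (D - (g-1) r0) ~ 0.

   Two-torsion.  If 2E ~ 0 then E - iota E = div h, and h * (h o iota) is constant
   because functions without poles are; by Hilbert 90 E is equivalent to an
   iota-invariant divisor, hence to the sum of the r - r0 over a subset P of W.
   The function y gives P ~ W \ P, so P may be chosen to avoid r1, and then it is
   unique up to r0: an invariant divisor div F has F o iota = +-F, so its
   multiplicities at the points of W all have the same parity.

   The symmetry maps the class of P to that of tau P, so the invariant spin
   structures correspond to the tau-stable subsets of W \ {r0, r1}; this set has 2g
   elements, of which 2k - 2 are fixed by tau, hence 2 ^ (g + k - 1) such subsets.

   On the analytic side, local expansions come from the analytic implicit function
   theorem (Picard iteration), and the constancy of functions without poles from
   the maximum principle and the compactness and connectedness of the surface. *)
Require Import Defs.
From mathcomp Require Import all_boot all_order all_algebra.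
From mathcomp Require Import complex.
From mathcomp Require Import all_classical all_reals all_analysis.
From mathcomp Require Import freeg separable.
From mathcomp Require Import ring lra zify.

Import Order.TTheory GRing.Theory Num.Theory.
Import numFieldNormedType.Exports.
Import ComplexField.Normc.

Set Implicit Arguments.
Unset Strict Implicit.
Unset Printing Implicit Defensive.

(** The degree of a divisor is never introduced. Its part is played by the fact that n r0 is
    principal only for n = 0, which follows from the constancy of functions without poles. A
    relation is obtained up to an unknown multiple of r0; since twice each r - r0 is principal,
    doubling the relation isolates that multiple and shows that it is zero.

    Both r0 and r1 have to be fixed by the symmetry: r0 so that the sum of the r - r0 over P goes to
    the sum over tau P with the same base point, r1 so that the normalization of P is preserved.

    A function on the surface is an arbitrary map whose values at isolated points carry no
    information. Hence expansions and identities hold on punctured neighborhoods, and the meaningful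
    value at the center is the constant coefficient of an expansion. *)

(** * Subsets stable under an involution *)

Definition invariant_sets (T : finType) (s : T -> T) : {set {set T}} :=
  [set A : {set T} | [forall x, (s x \in A) == (x \in A)]].

Section InvolutionCount.
Variables (T : finType) (s : T -> T).
Hypothesis sK : involutive s.

Let rank_le x := (enum_rank x <= enum_rank (s x))%N.

(** A stable set is a union of orbits, and the number of orbits is half of [#|T|] plus the number of
    fixed points; squaring avoids the halving. [rank_le] marks an element of smallest rank in each
    orbit, and a stable set is determined by its marked elements. *)
Lemma card_invariant_sets :
  (#|invariant_sets s| ^ 2 =
   2 ^ (#|T| + #|[pred x | s x == x]|))%N.
Proof.
pose Rp := [set x | rank_le x].
have s_inj : injective s := inv_inj sK.
have -> : #|invariant_sets s| = #|powerset Rp|.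
  set I := invariant_sets s.
  have -> : powerset Rp = [set A :&: Rp | A in I].
    apply/setP => B; rewrite inE; apply/idP/imsetP => [BR|[A _ ->]]; last exact: subsetIr.
    (* The union of the orbits that meet [B]. *)
    exists (B :|: s @^-1: B).
      rewrite inE; apply/forallP => x; rewrite !inE sK orbC; exact: eqxx.
    apply/setP => x; rewrite !inE; apply/idP/idP => [xB|].
      by rewrite xB /=; have := fintype.subsetP BR x xB; rewrite inE.
    move=> /andP[/orP[//|sxB] hx].
    have := fintype.subsetP BR _ sxB; rewrite inE /rank_le sK => h.
    have /enum_rank_inj <- // : enum_rank (s x) = enum_rank x.
    by apply/val_inj/anti_leq/andP; split.
  rewrite card_in_imset // => A B; rewrite !inE => /forallP hA /forallP hB hAB.
  apply/setP => x; have hx y : y \in Rp -> (y \in A) = (y \in B).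
    move=> yR; have := congr1 (fun D : {set T} => y \in D) hAB.
    by rewrite /= !finset.in_setI yR !andbT.
  have [xR|xR] := boolP (x \in Rp); first exact: hx.
  rewrite -(eqP (hA x)) -(eqP (hB x)); apply: hx.
  by move: xR; rewrite !inE /rank_le sK -ltnNge; exact: ltnW.
rewrite card_powerset -expnM; congr (2 ^ _)%N.
have e1 : #|T| = (#|Rp| + #|~: Rp|)%N by rewrite cardsC.
(* [s] exchanges the marked elements that are not fixed with the unmarked ones. *)
have e2 : #|Rp| = (#|[pred x | s x == x]| + #|~: Rp|)%N.
  rewrite -(cardsID [set x | s x == x] Rp); congr (_ + _)%N.
    rewrite -[RHS]cardsE; apply: eq_card => x; rewrite !inE /rank_le.
    by case: eqP => [->|]; rewrite ?andbF // leqnn.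
  rewrite -[RHS](card_imset _ s_inj); apply: eq_card => x.
  rewrite -{2}[x]sK mem_imset // !inE /rank_le sK -ltnNge ltn_neqAle.
  rewrite (inj_eq val_inj) (inj_eq enum_rank_inj) eq_sym.
  by rewrite eq_sym.
by rewrite e1 e2; lia.
Qed.

End InvolutionCount.

Lemma mem_invariant_sets (T : finType) (s : T -> T) (A : {set T}) :
  reflect (forall x, (s x \in A) = (x \in A)) (A \in invariant_sets s).
Proof.
rewrite inE; apply: (iffP forallP) => [h x|h x]; first exact/eqP.
by apply/eqP.
Qed.

Local Open Scope classical_set_scope.
Local Open Scope card_scope.
Local Open Scope ring_scope.

(** * Limits of sequences *)

Section SequenceLimits.
Variable K : numFieldType.
Implicit Types (u v : nat -> K) (l m : K).

(* Stated over an abstract [numFieldType], where the topology is inferred; it is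
   not found on [R[i]] itself. *)
Definition tends u l : Prop := u @ \oo --> l.

Lemma tendsP u l : tends u l <->
  forall e, 0 < e -> exists n0, forall n, (n0 <= n)%N -> `|l - u n| < e.
Proof.
split=> [/cvgrPdist_lt h e e0|h].
  by case: (h e e0) => n0 _ hn; exists n0 => n nn; apply: hn.
by apply/cvgrPdist_lt => e /h[n0 hn]; exists n0 => // n /= /hn.
Qed.

Lemma tendsD u v l m : tends u l -> tends v m -> tends (fun n => u n + v n) (l + m).
Proof. exact: cvgD. Qed.

Lemma tendsB u v l m : tends u l -> tends v m -> tends (fun n => u n - v n) (l - m).
Proof. exact: cvgB. Qed.

Lemma tendsM u v l m : tends u l -> tends v m -> tends (fun n => u n * v n) (l * m).
Proof. exact: cvgM. Qed.

Lemma tendsV u l : l != 0 -> tends u l -> tends (fun n => (u n)^-1) l^-1.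
Proof. exact: cvgV. Qed.

Lemma tends_cst l : tends (fun _ => l) l.
Proof. exact: cvg_cst. Qed.

Lemma tends_eventually u v l n0 :
  (forall n, (n0 <= n)%N -> u n = v n) -> tends u l -> tends v l.
Proof.
move=> h /tendsP hu; apply/tendsP => e /hu[n1 hn].
exists (maxn n0 n1) => n; rewrite geq_max => /andP[/h <- /hn //].
Qed.

Lemma tends_unique u l m : tends u l -> tends u m -> l = m.
Proof. exact: cvg_unique. Qed.

Lemma tendsS u l : tends (fun n => u n.+1) l <-> tends u l.
Proof.
split=> /tendsP h; apply/tendsP => e /h[n0 hn].
  by exists n0.+1 => -[//|n] /hn.
by exists n0 => n nn; apply: hn; exact: leqW.
Qed.

Lemma pseries_sumE (a : nat -> K) z s :
  pseries_sum a z s = tends (fun n => \sum_(j < n) a j * z ^+ j) s.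
Proof.
rewrite /pseries_sum /tends /series /=.
congr (fun u : nat -> K => u @ \oo --> s).
by apply/funext => n; rewrite big_mkord.
Qed.

End SequenceLimits.
Arguments tends_cst {K} l.

(** * The real-valued modulus on the complex numbers *)

Section ComplexModulus.
Variable R : realType.
Notation C := R[i].
Implicit Types (z w : C).

Lemma normc_ge0 z : 0 <= normc z.
Proof. by case: z => a b /=; exact: sqrtr_ge0. Qed.

Lemma normrE z : `|z| = (normc z)%:C%C.
Proof. by rewrite normc_def; case: z. Qed.

Lemma normr_lt z (r : C) : 0 < r -> (`|z| < r) = (normc z < complex.Re r).
Proof.
case: r => a b; rewrite ltcE /= => /andP[/eqP -> _].
by rewrite normrE ltcR.
Qed.

Lemma normr_ltR z (r : R) : (`|z| < r%:C%C) = (normc z < r).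
Proof. by rewrite normrE ltcR. Qed.

Lemma normc_eq0 z : (normc z == 0) = (z == 0).
Proof. by apply/eqP/eqP => [/eq0_normc //|->]; rewrite normc0. Qed.

Lemma normc_gt0 z : (0 < normc z) = (z != 0).
Proof. by rewrite lt_def normc_ge0 andbT normc_eq0. Qed.

Lemma normcX z n : normc (z ^+ n) = normc z ^+ n.
Proof. by elim: n => [|n IH]; rewrite ?expr0 ?normc1 // !exprS normcM IH. Qed.

Lemma normcB z w : normc (z - w) = normc (w - z).
Proof. by rewrite -normcN opprB. Qed.

Lemma normcR (r : R) : normc (r%:C%C : C) = `|r|.
Proof. by rewrite /= expr0n addr0 sqrtr_sqr. Qed.

Lemma normc_triangle z w u : normc (z - w) <= normc (z - u) + normc (u - w).
Proof. by have := le_normcD (z - u) (u - w); rewrite addrA subrK. Qed.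

Lemma le_normcB z w : normc (z - w) <= normc z + normc w.
Proof. by rewrite -(normcN w); apply: le_normcD. Qed.

Lemma normc_sum (I : Type) (s : seq I) (P : pred I) (F : I -> C) :
  normc (\sum_(i <- s | P i) F i) <= \sum_(i <- s | P i) normc (F i).
Proof.
elim/big_rec2 : _ => [|i y1 y2 _ h]; first by rewrite normc0.
exact: le_trans (le_normcD _ _) (lerD _ _).
Qed.

Lemma normc_conj z : normc z^*%C = normc z.
Proof. by case: z => a b /=; rewrite sqrrN. Qed.

Lemma cvgcP (u : nat -> C) (l : C) : tends u l <->
  forall e : R, 0 < e -> exists n0, forall n, (n0 <= n)%N -> normc (l - u n) < e.
Proof.
split=> [/tendsP h e e0|h].
  have /h : 0 < e%:C%C :> C by rewrite ltcR.
  case=> n0 hn; exists n0 => n nn; have := hn n nn.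
  by rewrite /= normr_ltR.
apply/tendsP => e e0.
have e0' : 0 < complex.Re e by move: e0; rewrite ltcE /= => /andP[].
have [n0 hn] := h _ e0'; exists n0 => // n /= /hn.
by rewrite normr_lt.
Qed.

Lemma cvgc0 (u : nat -> C) (K : R) :
  (forall n, normc (u n) <= K / 2 ^+ n) -> tends u 0.
Proof.
move=> h; apply/cvgcP => e e0.
(* Here K / e < n0 <= n < 2 ^ n. *)
pose n0 := (Num.truncn (K / e)).+1; exists n0 => n nn.
rewrite sub0r normcN; apply: le_lt_trans (h n) _.
rewrite ltr_pdivrMr ?exprn_gt0 // -ltr_pdivrMl // mulrC.
apply: (@lt_le_trans _ _ n0%:R); first exact: truncnS_gt.
apply: (@le_trans _ _ n%:R); first by rewrite ler_nat.
by rewrite -natrX ler_nat ltnW // ltn_expl.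
Qed.

Lemma cvgc_le (u : nat -> C) (l c : C) (B : R) :
  tends u l -> (forall n, normc (u n - c) <= B) -> normc (l - c) <= B.
Proof.
move=> /cvgcP h hB; apply/ler_addgt0Pl => e /h[n0 /(_ _ (leqnn n0)) hn].
have := normc_triangle l c (u n0); have := hB n0; lra.
Qed.

End ComplexModulus.

(** * Convergence, products and Lipschitz estimates of power series *)

Section PowerSeries.
Variable R : realType.
Notation C := R[i].
Implicit Types (z w s t : C) (a b : nat -> C) (r M : R).

(** Cauchy's estimates on the disc of radius [r]; the bounds on sums below are drawn from them on a
    smaller disc. *)
Definition bounded_at r M a := forall j, normc (a j) * r ^+ j <= M.

(* Convergence at a single nonzero point forces this. *)
Definition regular a := exists r M, 0 < r /\ bounded_at r M a.

Definition cauchy_prod a b n := \sum_(i < n.+1) a i * b (n - i)%N.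

Lemma bounded_at_ge0 r M a : bounded_at r M a -> 0 <= M.
Proof.
by move=> /(_ 0%N); rewrite expr0 mulr1; apply: le_trans; exact: normc_ge0.
Qed.

Lemma bounded_at_le r r' M a : 0 <= r' <= r -> bounded_at r M a ->
  bounded_at r' M a.
Proof.
move=> /andP[r0 rr] h j; apply: le_trans (h j).
by rewrite ler_wpM2l ?normc_ge0 // lerXn2r // nnegrE // (le_trans r0).
Qed.

Lemma bounded_at_term r M a z j : 0 < r -> bounded_at r M a ->
  normc (a j * z ^+ j) <= M * (normc z / r) ^+ j.
Proof.
move=> r0 h; rewrite normcM normcX expr_div_n [leRHS]mulrA [leRHS]mulrAC.
rewrite ler_wpM2r ?exprn_ge0 ?normc_ge0 //.
by rewrite ler_pdivlMr ?exprn_gt0.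
Qed.

Lemma geometric_tail (q : R) m n : 0 <= q <= 1 / 2 ->
  \sum_(m <= j < n) q ^+ j <= 2 * q ^+ m.
Proof.
move=> /andP[q0 q1].
have [nm|mn] := leqP n m; first by rewrite big_geq // mulr_ge0 ?exprn_ge0.
suff h k : \sum_(m <= j < m + k) q ^+ j <= 2 * q ^+ m - 2 * q ^+ (m + k).
  rewrite -(subnKC (ltnW mn)); apply: le_trans (h _) _.
  by rewrite gerBl mulr_ge0 ?exprn_ge0.
elim: k => [|k IH]; first by rewrite addn0 big_geq // subrr.
rewrite addnS big_nat_recr ?leq_addr //=.
have : 0 <= q ^+ (m + k) by rewrite exprn_ge0.
rewrite exprS; nra.
Qed.

Lemma tail_bound r M a z m n : 0 < r -> bounded_at r M a ->
  normc z <= r / 2 ->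
  normc (\sum_(m <= j < n) a j * z ^+ j) <= 2 * M * (normc z / r) ^+ m.
Proof.
move=> r0 h hz; apply: le_trans (normc_sum _ _ _) _.
apply: (@le_trans _ _ (\sum_(m <= j < n) M * (normc z / r) ^+ j)).
  by apply: ler_sum => j _; apply: bounded_at_term.
rewrite -mulr_sumr [2 * M]mulrC -mulrA ler_wpM2l ?(bounded_at_ge0 h) //.
apply: geometric_tail; apply/andP; split.
  by rewrite divr_ge0 ?normc_ge0 // ltW.
by rewrite ler_pdivrMr //; move: hz; lra.
Qed.

Lemma sum_terms_bounded (u : nat -> R) n : (forall j, 0 <= u j) ->
  forall j, (j < n)%N -> u j <= \sum_(i < n) u i.
Proof.
move=> h j jn; rewrite (bigD1 (Ordinal jn)) //= lerDl.
by apply: sumr_ge0.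
Qed.

Lemma pseries_bounded a z s : pseries_sum a z s ->
  exists M, bounded_at (normc z) M a.
Proof.
rewrite pseries_sumE => /cvgcP /(_ 1 ltr01)[n0 h].
pose u j := normc (a j) * normc z ^+ j.
have u0 j : 0 <= u j by rewrite mulr_ge0 ?exprn_ge0 ?normc_ge0.
(* From [n0] on, a term is the difference of two partial sums within 1 of the limit; the finite sum
   bounds the earlier terms. *)
exists (2 + \sum_(i < n0) u i) => j; rewrite -/(u j).
have S0 : 0 <= \sum_(i < n0) u i by apply: sumr_ge0.
have [jn|nj] := ltnP j n0.
  by have := sum_terms_bounded u0 jn; lra.
have h1 := h _ nj; have h2 := h _ (leqW nj).
have : normc (a j * z ^+ j) <= 2.
  have -> : a j * z ^+ j =
     (s - \sum_(i < j) a i * z ^+ i) - (s - \sum_(i < j.+1) a i * z ^+ i).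
    by rewrite big_ord_recr /=; ring.
  by apply: le_trans (le_normcB _ _) _; lra.
rewrite normcM normcX -/(u j); lra.
Qed.

Lemma pseries_regular a z s : z != 0 -> pseries_sum a z s -> regular a.
Proof.
by move=> z0 /pseries_bounded[M h]; exists (normc z), M; rewrite normc_gt0.
Qed.

(** Each of the n + 1 summands is at most M M' / r ^ n, and halving the radius absorbs the factor n
    + 1 <= 2 ^ n. *)
Lemma cauchy_prod_bounded r M M' a b : 0 < r ->
  bounded_at r M a -> bounded_at r M' b ->
  bounded_at (r / 2) (M * M') (cauchy_prod a b).
Proof.
move=> r0 ha hb n.
have -> : (r / 2) ^+ n = r ^+ n / 2 ^+ n by rewrite expr_div_n.
rewrite mulrA ler_pdivrMr ?exprn_gt0 //.
apply: (@le_trans _ _ (\sum_(i < n.+1) M * M')).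
  apply: (@le_trans _ _ (\sum_(i < n.+1) normc (a i * b (n - i)%N) * r ^+ n)).
    by rewrite -mulr_suml ler_wpM2r ?exprn_ge0 ?normc_sum // ltW.
  apply: ler_sum => i _.
  rewrite (_ : r ^+ n = r ^+ i * r ^+ (n - i)); last first.
    by rewrite -exprD subnKC // -ltnS.
  rewrite normcM mulrACA.
  apply: ler_pM; [| |exact: ha|exact: hb];
    by rewrite mulr_ge0 ?exprn_ge0 ?normc_ge0 // ltW.
rewrite sumr_const card_ord -[_ *+ _]mulr_natr ler_wpM2l //.
  by rewrite mulr_ge0 ?(bounded_at_ge0 ha) ?(bounded_at_ge0 hb).
by rewrite -natrX ler_nat ltn_expl.
Qed.

(** The product of the truncations of order [n] agrees with the Cauchy product below degree [n]; the
    excess is a tail, and truncations satisfy the same estimates for all [n]. The statement bears on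
    partial sums because for a reciprocal series convergence will be a conclusion. *)
Lemma cauchy_prod_defect r M M' a b z : 0 < r ->
  bounded_at r M a -> bounded_at r M' b -> normc z <= r / 4 ->
  tends (fun n => (\sum_(j < n) a j * z ^+ j) * (\sum_(j < n) b j * z ^+ j) -
    \sum_(j < n) cauchy_prod a b j * z ^+ j) 0.
Proof.
move=> r0 ha hb hz.
pose A n := \poly_(i < n) a i; pose B n := \poly_(i < n) b i.
have hA n : (A n).[z] = \sum_(j < n) a j * z ^+ j by rewrite horner_poly.
have hB n : (B n).[z] = \sum_(j < n) b j * z ^+ j by rewrite horner_poly.
have bA n : bounded_at r M (fun i => (A n)`_i).
  move=> j; rewrite coef_poly; case: ifP => // _.
  by rewrite normc0 mul0r (bounded_at_ge0 ha).
have bB n : bounded_at r M' (fun i => (B n)`_i).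
  move=> j; rewrite coef_poly; case: ifP => // _.
  by rewrite normc0 mul0r (bounded_at_ge0 hb).
have hprod n : (A n * B n).[z] = \sum_(j < n) cauchy_prod a b j * z ^+ j +
    \sum_(n <= j < n.*2) (A n * B n)`_j * z ^+ j.
  have sz : (size (A n * B n)%R <= n.*2)%N.
    apply: leq_trans (size_polyMleq _ _) _; apply: leq_trans (leq_pred _) _.
    by rewrite -addnn leq_add ?size_poly.
  rewrite (horner_coef_wide _ sz) -(big_mkord xpredT (fun j => (A n * B n)`_j * z ^+ j)).
  rewrite (big_cat_nat (n := n)) //=; last by rewrite -addnn leq_addr.
  congr (_ + _); rewrite big_mkord; apply: eq_bigr => j _; congr (_ * _).
  rewrite coefM; apply: eq_bigr => i _; rewrite !coef_poly.
  rewrite (leq_ltn_trans (leq_ord i) (ltn_ord j)).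
  by rewrite (leq_ltn_trans (leq_subr _ _) (ltn_ord j)).
have D0 : tends (fun n => \sum_(n <= j < n.*2) (A n * B n)`_j * z ^+ j) 0.
  apply: (@cvgc0 _ _ (2 * (M * M'))) => n.
  have bAB : bounded_at (r / 2) (M * M') (fun i => (A n * B n)`_i).
    move=> j; rewrite coefM.
    exact: (cauchy_prod_bounded r0 (bA n) (bB n)).
  have r20 : 0 < r / 2 by rewrite divr_gt0.
  apply: le_trans (tail_bound _ _ r20 bAB _) _; first by move: hz; lra.
  have := mulr_ge0 (bounded_at_ge0 ha) (bounded_at_ge0 hb).
  move=> MM; rewrite -exprVn; apply: ler_wpM2l; first lra.
  apply: lerXn2r; rewrite ?nnegrE ?divr_ge0 ?normc_ge0 ?invr_ge0 //; first exact: ltW.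
  by rewrite ler_pdivrMr //; move: hz; lra.
apply: (tends_eventually (n0 := 0)) D0 => n _.
by rewrite -hA -hB -hornerM hprod addrAC subrr add0r.
Qed.

Lemma pseries_prod r M M' a b z s t : 0 < r ->
  bounded_at r M a -> bounded_at r M' b -> normc z <= r / 4 ->
  pseries_sum a z s -> pseries_sum b z t ->
  pseries_sum (cauchy_prod a b) z (s * t).
Proof.
move=> r0 ha hb hz; rewrite !pseries_sumE => hs ht.
have := tendsB (tendsM hs ht) (cauchy_prod_defect r0 ha hb hz).
rewrite subr0; apply: (tends_eventually (n0 := 0)) => n _.
by rewrite subKr.
Qed.

Lemma pseries_add a b z s t : pseries_sum a z s -> pseries_sum b z t ->
  pseries_sum (fun n => a n + b n) z (s + t).
Proof.
rewrite !pseries_sumE => hs ht; have := tendsD hs ht.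
apply: (tends_eventually (n0 := 0)) => n _.
by rewrite -big_split /=; apply: eq_bigr => i _; rewrite mulrDl.
Qed.

Lemma pseries_scale (c : C) a z s : pseries_sum a z s ->
  pseries_sum (fun n => c * a n) z (c * s).
Proof.
rewrite !pseries_sumE => hs; have := tendsM (tends_cst c) hs.
apply: (tends_eventually (n0 := 0)) => n _.
by rewrite mulr_sumr; apply: eq_bigr => i _; rewrite mulrA.
Qed.

Lemma pseries_tail a z s : z != 0 ->
  pseries_sum a z s <-> pseries_sum (fun n => a n.+1) z ((s - a 0%N) / z).
Proof.
move=> z0; rewrite !pseries_sumE.
have hS n : \sum_(j < n.+1) a j * z ^+ j =
    a 0%N + z * \sum_(j < n) a j.+1 * z ^+ j.
  rewrite big_ord_recl expr0 mulr1; congr (_ + _).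
  by rewrite mulr_sumr; apply: eq_bigr => i _; rewrite exprS mulrCA.
split=> [/(proj2 (tendsS _ _)) h|h].
  have := tendsM (tendsB h (tends_cst (a 0%N))) (tends_cst z^-1).
  apply: (tends_eventually (n0 := 0)) => n _.
  by rewrite /= hS [a 0%N + _]addrC addrK mulrC mulKf.
apply: (proj1 (tendsS _ _)).
have := tendsD (tends_cst (a 0%N)) (tendsM (tends_cst z) h).
have -> : a 0%N + z * ((s - a 0%N) / z) = s by field.
by apply: (tends_eventually (n0 := 0)) => n _; rewrite hS.
Qed.

Lemma bounded_tail r M a : 0 < r -> bounded_at r M a ->
  bounded_at r (M / r) (fun n => a n.+1).
Proof.
move=> r0 h j; rewrite ler_pdivlMr // -mulrA -exprSr; exact: h.
Qed.

Lemma pseries0 a : pseries_sum a 0 (a 0%N).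
Proof.
rewrite pseries_sumE; apply: (proj1 (tendsS _ _)).
apply: (tends_eventually (n0 := 0)) (tends_cst _) => n _.
rewrite big_ord_recl expr0 mulr1 big1 ?addr0 // => i _.
by rewrite exprS mul0r mulr0.
Qed.

Lemma pseries_unique a z s t : pseries_sum a z s -> pseries_sum a z t -> s = t.
Proof. by rewrite !pseries_sumE; apply: tends_unique. Qed.

Lemma pow_lipschitz z w (r : R) n : normc z <= r -> normc w <= r ->
  normc (z ^+ n - w ^+ n) <= n%:R * r ^+ n.-1 * normc (z - w).
Proof.
move=> hz hw; have r0 : 0 <= r := le_trans (normc_ge0 z) hz.
rewrite subrXX normcM mulrC ler_wpM2r ?normc_ge0 //.
apply: le_trans (normc_sum _ _ _) _.
apply: (@le_trans _ _ (\sum_(i < n) r ^+ n.-1)); last first.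
  by rewrite sumr_const card_ord mulr_natl.
apply: ler_sum => i _; rewrite normcM !normcX.
have -> : r ^+ n.-1 = r ^+ (n - i.+1) * r ^+ i.
  by rewrite -exprD; congr (_ ^+ _); have := ltn_ord i; lia.
rewrite (_ : (n.-1 - i)%N = (n - i.+1)%N); last by rewrite subnS; lia.
apply: ler_pM; rewrite ?exprn_ge0 ?normc_ge0 //;
  by rewrite lerXn2r // nnegrE ?normc_ge0.
Qed.

(** On the disc of radius r / 4 the monomial of degree j + 1 has Lipschitz constant (j + 1) (r / 4)
    ^ j, and j + 1 <= 2 ^ j leaves a geometric series of ratio 1 / 2. *)
Lemma pseries_lipschitz r M a z w s t : 0 < r -> bounded_at r M a ->
  normc z <= r / 4 -> normc w <= r / 4 ->
  pseries_sum a z s -> pseries_sum a w t ->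
  normc (s - t) <= 8 * M / r * normc (z - w).
Proof.
move=> r0 h hz hw; rewrite !pseries_sumE => hs ht.
have M0 := bounded_at_ge0 h.
rewrite -[s - t]subr0; apply: (cvgc_le (tendsB hs ht)) => n; rewrite subr0.
rewrite -sumrB; apply: le_trans (normc_sum _ _ _) _.
apply: (@le_trans _ _ (\sum_(i < n) (4 * M / r * normc (z - w)) * (1 / 2) ^+ i)).
  apply: ler_sum => i _; rewrite -mulrBr normcM.
  apply: le_trans (ler_wpM2l (normc_ge0 _) (pow_lipschitz i hz hw)) _.
  rewrite mulrA [leRHS]mulrAC ler_wpM2r ?normc_ge0 //.
  case: i => -[|j] /= _.
    by rewrite mul0r mulr0 expr0 mulr1 divr_ge0 ?mulr_ge0 // ltW.
  have /(ler_wpM2r (ltW r0)) := bounded_tail r0 h j; rewrite divfK ?gt_eqF //.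
  set A := normc _ => hA.
  rewrite expr_div_n.
  have hj : j.+1%:R <= 2 ^+ j :> R by rewrite -natrX ler_nat ltn_expl.
  have h4 : 4 ^+ j = 2 ^+ j * 2 ^+ j :> R by rewrite -exprMn; congr (_ ^+ _); ring.
  have p2 : 0 < 2 ^+ j :> R by rewrite exprn_gt0.
  have -> : A * (j.+1%:R * (r ^+ j / 4 ^+ j)) =
     (A * r ^+ j * r) * (j.+1%:R / 2 ^+ j) / r * (1 / 2) ^+ j.
    rewrite h4 expr_div_n expr1n; field.
    by rewrite gt_eqF //= gt_eqF.
  have -> : 4 * M / r * (1 / 2) ^+ j.+1 = M * 2 / r * (1 / 2) ^+ j.
    by rewrite exprS; field; exact/lt0r_neq0.
  have r0' := ltW r0.
  rewrite ler_wpM2r ?exprn_ge0 // ler_wpM2r ?invr_ge0 //.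
  apply: ler_pM => //; first by rewrite !mulr_ge0 ?exprn_ge0 ?normc_ge0.
  by rewrite ler_pdivrMr //; lra.
rewrite -mulr_sumr -(big_mkord xpredT (fun i => (1 / 2) ^+ i)).
have := @geometric_tail (1 / 2) 0 n; rewrite expr0 mulr1 => hg.
have {hg} : \sum_(0 <= j < n) (1 / 2) ^+ j <= 2 :> R.
  by apply: hg; apply/andP; split; lra.
have P0 : 0 <= M / r * normc (z - w).
  by rewrite mulr_ge0 ?divr_ge0 ?normc_ge0 // ltW.
have -> : 4 * M / r * normc (z - w) = 4 * (M / r * normc (z - w)) by ring.
have -> : 8 * M / r * normc (z - w) = 4 * (M / r * normc (z - w)) * 2 by ring.
by move=> hg; apply: ler_wpM2l => //; apply: mulr_ge0.
Qed.

Lemma pseries_near0 r M a z s : 0 < r -> bounded_at r M a ->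
  normc z <= r / 4 -> pseries_sum a z s ->
  normc (s - a 0%N) <= 8 * M / r * normc z.
Proof.
move=> r0 h hz hs; have h0 : normc (0 : R[i]) <= r / 4 by rewrite normc0 divr_ge0 // ltW.
by have := pseries_lipschitz r0 h hz h0 hs (@pseries0 a); rewrite subr0.
Qed.

End PowerSeries.

(** * Reciprocals, zeros and the local maximum principle for power series *)

Section StrongRecursion.
Variables (T : Type) (x0 : T) (F : seq T -> T).

(** Course-of-values recursion: the values already computed are kept in a list, so that the
    recursion is structural. *)
Fixpoint rec_seq n : seq T := if n is m.+1 then rcons (rec_seq m) (F (rec_seq m)) else [::].

Lemma size_rec_seq n : size (rec_seq n) = n.
Proof. by elim: n => //= n IH; rewrite size_rcons IH. Qed.

Lemma nth_rec_seq n i : (i < n)%N -> nth x0 (rec_seq n) i = F (rec_seq i).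
Proof.
elim: n => //= n IH; rewrite ltnS leq_eqVlt nth_rcons size_rec_seq.
by case/orP => [/eqP ->|h]; [rewrite ltnn eqxx|rewrite h IH].
Qed.

End StrongRecursion.

Section PowerSeriesInverse.
Variable R : realType.
Notation C := R[i].
Implicit Types (z w s t : C) (a b : nat -> C) (r M : R).

(** Solves a_0 b_n = [n = 0] - sum of a_(n-i) b_i over i < n; the size of the list of earlier
    coefficients serves as the index n. *)
Definition series_inv a n : C :=
  let F (s : seq C) := (a 0%N)^-1 * ((size s == 0%N)%:R -
    \sum_(i < size s) a (size s - i)%N * nth 0 s i) in
  F (rec_seq F n).

Lemma series_invE a n : series_inv a n = (a 0%N)^-1 *
  ((n == 0%N)%:R - \sum_(i < n) a (n - i)%N * series_inv a i).
Proof.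
rewrite {1}/series_inv; set F := (fun s : seq C => _).
rewrite {1}/F size_rec_seq; congr (_ * (_ - _)).
by apply: eq_bigr => i _; rewrite nth_rec_seq.
Qed.

Lemma cauchy_prod_inv a n : a 0%N != 0 ->
  cauchy_prod a (series_inv a) n = (n == 0%N)%:R.
Proof.
move=> a0; rewrite /cauchy_prod big_ord_recl subn0 series_invE mulVKf //.
set S := \sum_(i < n) a (n - i)%N * _; set S' := \sum_(i < n) _.
suff -> : S' = S by rewrite subrK.
rewrite /S' (reindex_inj rev_ord_inj) /=; apply: eq_bigr => i _.
have h : bump 0 (n - i.+1) = (n - i)%N.
  by rewrite /bump /= add1n; have := ltn_ord i; lia.
by rewrite h subKn // ltnW.
Qed.

Lemma series_inv_regular a : a 0%N != 0 -> regular a -> regular (series_inv a).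
Proof.
move=> a0 [r [M [r0 h]]]; have M0 := bounded_at_ge0 h.
have na0 : 0 < normc (a 0%N) by rewrite normc_gt0.
pose A := normc (a 0%N).
have AM : A <= M by have := h 0%N; rewrite expr0 mulr1.
have Mp : 0 < M := lt_le_trans na0 AM.
(* Chosen so that (M / A) (q + q ^ 2 + ...) <= (M / A) 2 q = 1, which closes the induction on |b_n|
   (r q) ^ n <= 1 / A. *)
pose q := A / (2 * M).
have q0 : 0 < q by rewrite divr_gt0 // mulr_gt0.
have q1 : q <= 1 / 2 by rewrite /q ler_pdivrMr ?mulr_gt0 //; lra.
exists (r * q), A^-1; split; first exact: mulr_gt0.
elim/ltn_ind => n IH; rewrite series_invE normcM normcV -/A.
have [->|n0] := eqVneq n 0%N.
  by rewrite big_ord0 subr0 normc1 expr0 !mulr1.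
rewrite -mulrA ler_piMr ?invr_ge0 ?normc_ge0 // sub0r normcN.
apply: (@le_trans _ _ (\sum_(i < n) (M * A^-1) * q ^+ (n - i))).
  have rq0 : 0 <= r * q by rewrite mulr_ge0 // ltW.
  have [q0' r0'] := (ltW q0, ltW r0).
  apply: (@le_trans _ _ (\sum_(i < n)
     normc (a (n - i)%N * series_inv a i) * (r * q) ^+ n)).
    by rewrite -mulr_suml ler_wpM2r ?normc_sum ?exprn_ge0.
  apply: ler_sum => i _; rewrite normcM.
  have -> : (r * q) ^+ n = (r * q) ^+ (n - i) * (r * q) ^+ i.
    by rewrite -exprD subnK // ltnW.
  rewrite mulrACA [(r * q) ^+ (n - i)]exprMn mulrA.
  have -> : M * A^-1 * q ^+ (n - i) = M * q ^+ (n - i) * A^-1 by rewrite mulrAC.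
  rewrite -[leLHS]mulrA.
  have h1 := h (n - i)%N; have h2 := IH i (ltn_ord i).
  apply: ler_pM => //.
  - by rewrite !mulr_ge0 ?exprn_ge0 ?normc_ge0.
  - by rewrite mulr_ge0 ?exprn_ge0 ?normc_ge0.
  - by rewrite mulrA ler_wpM2r ?exprn_ge0.
rewrite -mulr_sumr (reindex_inj rev_ord_inj) /=.
have -> : \sum_(j < n) q ^+ (n - (n - j.+1)) = \sum_(1 <= j < n.+1) q ^+ j.
  rewrite big_add1 /= big_mkord; apply: eq_bigr => j _.
  by rewrite subKn.
have hq : 0 <= q <= 1 / 2 by rewrite (ltW q0).
have /(ler_wpM2l _) := geometric_tail 1 n.+1 hq.
move=> /(_ (M * A^-1)) hh; apply: le_trans (hh _) _.
  by rewrite mulr_ge0 ?invr_ge0 ?(ltW na0).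
by rewrite expr1 /q le_eqVlt; apply/orP; left; apply/eqP; field; rewrite ?gt_eqF.
Qed.

Lemma regular_common a b : regular a -> regular b ->
  exists r M M', [/\ 0 < r, bounded_at r M a & bounded_at r M' b].
Proof.
move=> [r [M [r0 h]]] [r' [M' [r0' h']]].
exists (Num.min r r'), M, M'; split; first by rewrite lt_min r0.
- by apply: bounded_at_le h; rewrite ge_min lexx /= le_min !ltW.
- by apply: bounded_at_le h'; rewrite ge_min lexx orbT le_min !ltW.
Qed.

Lemma pseries_nonzero a : regular a -> a 0%N != 0 ->
  exists d : R, 0 < d /\ forall z s, normc z < d -> pseries_sum a z s -> s != 0.
Proof.
move=> [r [M [r0 h]]] a0; have M0 := bounded_at_ge0 h.
have na0 : 0 < normc (a 0%N) by rewrite normc_gt0.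
pose K := 8 * M / r.
have K0 : 0 <= K by rewrite divr_ge0 ?mulr_ge0 // ltW.
exists (Num.min (r / 4) (normc (a 0%N) / (K + 1))); split.
  by rewrite lt_min !divr_gt0 //; lra.
move=> z s; rewrite lt_min => /andP[/ltW hz hz'] hs.
have := pseries_near0 r0 h hz hs; rewrite -/K.
apply: contraTneq => ->; rewrite sub0r normcN -ltNge.
move: hz'; rewrite ltr_pdivlMr; last lra.
have := normc_ge0 z; nra.
Qed.

(** The partial sums of the Cauchy product are 1 from the first term on, so the products of partial
    sums tend to 1. Dividing by the partial sums of [a], eventually nonzero, gives both the
    convergence of the reciprocal series and its sum. *)
Lemma pseries_inv a : regular a -> a 0%N != 0 ->
  exists d : R, 0 < d /\ forall z s, normc z < d -> pseries_sum a z s ->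
    pseries_sum (series_inv a) z s^-1.
Proof.
move=> ra a0; have [d [d0 hd]] := pseries_nonzero ra a0.
have [r [M [M' [r0 h h']]]] := regular_common ra (series_inv_regular a0 ra).
exists (Num.min d (r / 4)); split; first by rewrite lt_min d0 divr_gt0.
move=> z s; rewrite lt_min => /andP[/hd hd' /ltW hz] hs; have s0 := hd' _ hs.
have := cauchy_prod_defect r0 h h' hz.
move: hs; rewrite !pseries_sumE.
set A := fun n => _; set B := fun n => \sum_(_ < _) series_inv a _ * _.
move=> hA hD.
have hAB : tends (fun n => A n * B n) 1.
  have := tendsD hD (tends_cst (1 : C)); rewrite add0r.
  apply: (tends_eventually (n0 := 1)) => -[//|n] _.
  suff -> : \sum_(j < n.+1) cauchy_prod a (series_inv a) j * z ^+ j = 1.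
    by rewrite subrK.
  rewrite big_ord_recl cauchy_prod_inv // mul1r expr0 big1 ?addr0 // => i _.
  by rewrite cauchy_prod_inv // mul0r.
have := tendsM hAB (tendsV s0 hA); rewrite mul1r.
have /cvgcP /(_ (normc s)) := hA; rewrite normc_gt0 => /(_ s0) [n0 hn].
apply: (tends_eventually (n0 := n0)) => n /hn.
have [->|An0] := eqVneq (A n) 0; first by rewrite subr0 ltxx.
by rewrite mulrC mulKf.
Qed.

Lemma pseries_shift m a z s : z != 0 -> (forall j, (0 < j < m)%N -> a j = 0) ->
  (0 < m)%N -> pseries_sum a z s ->
  pseries_sum (fun n => a (m + n)%N) z ((s - a 0%N) / z ^+ m).
Proof.
move=> z0; elim: m => [_ h0|m IH hm _ hs];
  first exact: (False_ind _ (notF h0)).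
have [->|m0] := posnP m; first by rewrite expr1; exact: (proj1 (pseries_tail _ _ z0)).
have hm' j : (0 < j < m)%N -> a j = 0.
  by move=> /andP[j0 jm]; apply: hm; rewrite j0 leqW.
have /(proj1 (pseries_tail _ _ z0)) := IH hm' m0 hs.
have -> : ((s - a 0%N) / z ^+ m - a (m + 0)%N) / z = (s - a 0%N) / z ^+ m.+1.
  have -> : a (m + 0)%N = 0 by rewrite addn0; apply: hm; rewrite m0 ltnSn.
  by rewrite subr0 exprS invfM mulrA mulrAC.
have -> : (fun n => a (m + n.+1)%N) = (fun n => a (m.+1 + n)%N).
  by apply/funext => n; rewrite addSnnS.
exact.
Qed.

Lemma regular_shift m a : regular a -> regular (fun n => a (m + n)%N).
Proof.
move=> ra; elim: m => [|m [r [M [r0 h]]]]; first by [].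
exists r, (M / r); split=> //.
have := bounded_tail r0 h.
by under [in X in bounded_at _ _ X -> _]eq_fun do rewrite addnS.
Qed.

Lemma first_nonzero a (k : nat) : (exists2 j, (k <= j)%N & a j != 0) ->
  exists m, [/\ (k <= m)%N, a m != 0 & forall j, (k <= j < m)%N -> a j = 0].
Proof.
move=> ex; have {}ex : exists j, (k <= j)%N && (a j != 0).
  by case: ex => j h1 h2; exists j; rewrite h1.
case: (ex_minnP ex) => m /andP[km am] hmin.
exists m; split=> // j /andP[kj jm]; apply/eqP/negbNE.
by apply/negP => aj; have := hmin j; rewrite kj aj => /(_ isT); rewrite leqNgt jm.
Qed.

Lemma pseries_isolated_zero a : regular a -> (exists j, a j != 0) ->
  exists d : R, 0 < d /\ forall z s, z != 0 -> normc z < d ->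
    pseries_sum a z s -> s != 0.
Proof.
move=> ra [j aj]; have [|m [_ am hm]] := @first_nonzero a 0; first by exists j.
have [m0|m0] := posnP m.
  rewrite m0 in am; have [d [d0 hd]] := pseries_nonzero ra am.
  by exists d; split=> // z s _; exact: hd.
have am' : a (m + 0)%N != 0 by rewrite addn0.
have [d [d0 hd]] := pseries_nonzero (regular_shift m ra) am'.
exists d; split=> // z s z0 hz hs.
have a00 : a 0%N = 0 by apply: hm.
have /(hd z _ hz) := pseries_shift z0 (fun j h => hm j (proj2 (andP h))) m0 hs.
by rewrite a00 subr0 mulf_eq0 negb_or => /andP[].
Qed.

Lemma closed_root (c : C) m : (0 < m)%N -> exists w, w ^+ m = c.
Proof.
move=> m0; have [x hx] := @solve_monicpoly C m (fun i => if i == 0%N then c else 0) m0.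
exists x; rewrite hx (bigD1 (Ordinal m0)) //= expr0 mulr1 big1 ?addr0 // => i.
by rewrite -val_eqE /= => /negbTE ->; rewrite mul0r.
Qed.

(** Let a_m be the first nonzero coefficient of positive degree. Along a direction w with a_m w ^ m
    = c, where c is aligned with a_0, the modulus of a_0 + t ^ m c is |a_0| + t ^ m |c|, and for
    small t the remainder of order t ^ (m+1) cannot compensate the growth. *)
Lemma pseries_local_max a : regular a -> (exists2 j, (0 < j)%N & a j != 0) ->
  forall d : R, 0 < d -> exists z, [/\ z != 0, normc z < d &
    forall s, pseries_sum a z s -> normc (a 0%N) < normc s].
Proof.
move=> ra /first_nonzero[m [m0 am hm]] d d0.
have [r [M [r0 h]]] := regular_shift m ra; have M0 := bounded_at_ge0 h.
pose c := if a 0%N == 0 then 1 else a 0%N.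
have c0 : c != 0 by rewrite /c; case: ifP => [_|/negbT //]; exact: oner_neq0.
have [w hw] := closed_root (c / a m) m0.
have w0 : w != 0.
  apply: contraTneq (_ : c / a m != 0); last by rewrite mulf_neq0 ?invr_neq0.
  by rewrite -hw => ->; rewrite expr0n gtn_eqF // negbK.
have nw0 : 0 < normc w by rewrite normc_gt0.
have nc0 : 0 < normc c by rewrite normc_gt0.
pose K := 8 * M / r * normc w ^+ m.+1.
have K0 : 0 <= K by rewrite mulr_ge0 ?exprn_ge0 ?normc_ge0 // divr_ge0 ?mulr_ge0 // ltW.
(* The three bounds keep z in the disc of radius [d], keep it where the estimate of the remainder is
   valid, and make K t smaller than |c|. *)
pose t := Num.min (Num.min (d / (2 * normc w)) (r / (4 * normc w))) (normc c / (2 * (K + 1))).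
have t0 : 0 < t by rewrite !lt_min !divr_gt0 ?mulr_gt0 //; lra.
have td : t <= d / (2 * normc w) by rewrite !ge_min lexx.
have tr : t <= r / (4 * normc w) by rewrite !ge_min lexx orbT.
have tc : t <= normc c / (2 * (K + 1)) by rewrite ge_min lexx orbT.
pose z := t%:C%C * w.
have nz : normc z = t * normc w by rewrite normcM normcR gtr0_norm.
have z0 : z != 0 by rewrite -normc_gt0 nz mulr_gt0.
exists z; split=> //.
  move: td; rewrite nz ler_pdivlMr ?mulr_gt0 //; nra.
move=> s hs.
have hz : normc z <= r / 4.
  rewrite nz; move: tr; rewrite ler_pdivlMr ?mulr_gt0 //; lra.
have := pseries_near0 r0 h hz (pseries_shift z0 hm m0 hs); rewrite addn0.
move=> h1.
have zm : z ^+ m = (t ^+ m)%:C%C * (c / a m) by rewrite exprMn hw rmorphXn.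
have h2 : normc (s - a 0%N - (t ^+ m)%:C%C * c) <= K * t ^+ m.+1.
  have -> : s - a 0%N - (t ^+ m)%:C%C * c = ((s - a 0%N) / z ^+ m - a m) * z ^+ m.
    by rewrite mulrBl divfK ?expf_neq0 // zm mulrCA mulrA mulrC; field.
  rewrite normcM normcX; apply: le_trans (ler_wpM2r _ h1) _.
    by rewrite exprn_ge0 ?normc_ge0.
  rewrite nz (_ : _ * (t * normc w) ^+ m = K * t ^+ m.+1) //.
  by rewrite /K !exprS !exprMn; ring.
have h3 : normc (a 0%N + (t ^+ m)%:C%C * c) = normc (a 0%N) + t ^+ m * normc c.
  rewrite /c; case: eqP => [->|_].
    by rewrite add0r normcM normcR normc0 add0r ger0_norm ?exprn_ge0 // ltW.
  have -> : a 0%N + (t ^+ m)%:C%C * a 0%N = (1 + t ^+ m)%:C%C * a 0%N.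
    by rewrite rmorphD rmorph1 mulrDl mul1r.
  rewrite normcM normcR.
  rewrite ger0_norm; last by rewrite addr_ge0 ?exprn_ge0 // ltW.
  by rewrite mulrDl mul1r.
have h4 : normc (a 0%N + (t ^+ m)%:C%C * c) <= normc s + K * t ^+ m.+1.
  have := normc_triangle (a 0%N + (t ^+ m)%:C%C * c) 0 s; rewrite !subr0.
  move=> h4; apply: le_trans h4 _; rewrite addrC lerD2l.
  by rewrite normcB opprD addrA.
have tm0 : 0 < t ^+ m by rewrite exprn_gt0.
have : K * t ^+ m.+1 < t ^+ m * normc c.
  rewrite exprSr mulrCA ltr_pM2l //.
  move: tc; rewrite ler_pdivlMr; [nra|lra].
rewrite h3 in h4; lra.
Qed.

End PowerSeriesInverse.

(** * The analytic implicit function theorem *)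

Section AnalyticImplicitFunction.
Variable R : realType.
Notation C := R[i].
Implicit Types (z w : C) (p q : {poly C}) (P Q : {poly R}).

(** Cauchy's method of majorants, for polynomials. *)
Definition dominated p P := forall i, normc p`_i <= P`_i.

Lemma dominatedD p q P Q : dominated p P -> dominated q Q ->
  dominated (p + q) (P + Q).
Proof.
by move=> hp hq i; rewrite !coefD; apply: le_trans (le_normcD _ _) (lerD _ _).
Qed.

Lemma dominatedM p q P Q : dominated p P -> dominated q Q ->
  dominated (p * q) (P * Q).
Proof.
move=> hp hq i; rewrite !coefM; apply: le_trans (normc_sum _ _ _) _.
apply: ler_sum => j _; rewrite normcM; apply: ler_pM; rewrite ?normc_ge0 //.
Qed.

Lemma dominatedC (c : C) : dominated c%:P (normc c)%:P.
Proof. by move=> i; rewrite !coefC; case: ifP; rewrite ?normc0. Qed.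

Lemma dominatedX p P n : dominated p P -> dominated (p ^+ n) (P ^+ n).
Proof.
move=> h; elim: n => [|n IH]; last by rewrite !exprS; apply: dominatedM.
by have := dominatedC 1; rewrite normc1.
Qed.

Lemma dominated_sum n (p : 'I_n -> {poly C}) (P : 'I_n -> {poly R}) :
  (forall i, dominated (p i) (P i)) ->
  dominated (\sum_(i < n) p i) (\sum_(i < n) P i).
Proof.
move=> h; elim/big_rec2 : _ => [|i y1 y2 _ hy]; last exact: dominatedD.
by move=> i; rewrite !coef0 normc0.
Qed.

Lemma dominated_bounded p P (r B : R) : 0 <= r -> dominated p P -> P.[r] <= B ->
  bounded_at r B (fun i => p`_i).
Proof.
move=> r0 h hB j; apply: le_trans (ler_wpM2r _ (h j)) _; first exact: exprn_ge0.
have P0 i : 0 <= P`_i := le_trans (normc_ge0 _) (h i).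
apply: le_trans hB; rewrite horner_coef.
have [jn|nj] := ltnP j (size P); last first.
  by rewrite nth_default // mul0r sumr_ge0 // => i _; rewrite mulr_ge0 ?exprn_ge0.
rewrite (bigD1 (Ordinal jn)) //= lerDl sumr_ge0 // => i _.
by rewrite mulr_ge0 ?exprn_ge0.
Qed.

(* Picard iteration for w = G(z) + F(w) *)
Definition picard (F G : {poly C}) (k : nat) : {poly C} :=
  iter k (fun u => G + \sum_(i < size F) (F`_i)%:P * u ^+ i) 0.

Definition abs_poly p : {poly R} := \poly_(i < size p) normc p`_i.

Lemma dominated_abs p : dominated p (abs_poly p).
Proof.
move=> i; rewrite coef_poly; case: ltnP => // h.
by rewrite nth_default // normc0.
Qed.

Lemma picardS F G k :
  picard F G k.+1 = G + \sum_(i < size F) (F`_i)%:P * (picard F G k) ^+ i.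
Proof. by []. Qed.

Lemma picard_horner F G k z :
  (picard F G k.+1).[z] = G.[z] + F.[(picard F G k).[z]].
Proof.
rewrite picardS hornerD horner_sum; congr (_ + _).
rewrite [RHS]horner_coef; apply: eq_bigr => i _.
by rewrite hornerM hornerC horner_exp.
Qed.

Lemma horner_small p (r : R) : p`_0 = 0 -> 0 <= r <= 1 ->
  (abs_poly p).[r] <= r * \sum_(i < size p) normc p`_i.
Proof.
move=> p0 /andP[r0 r1]; rewrite horner_poly mulr_sumr; apply: ler_sum => -[[|i] /= hi] _.
  by rewrite p0 normc0 mul0r mulr0.
rewrite mulrC ler_wpM2r ?normc_ge0 // exprS ler_piMr // exprn_ile1 //.
Qed.

(** The iteration with all coefficients replaced by their moduli majorizes the iterates, and the
    hypothesis keeps its values at [r] in [0, b]. The bound is therefore uniform in [k]. *)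
Lemma picard_bounded F G (r b : R) k : 0 <= r -> 0 <= b ->
  (abs_poly G).[r] + (abs_poly F).[b] <= b ->
  bounded_at r b (fun i => (picard F G k)`_i).
Proof.
move=> r0 b0 hb.
suff [P [hP h0 h]] : exists P, [/\ dominated (picard F G k) P, 0 <= P.[r] & P.[r] <= b].
  exact: dominated_bounded hP h.
elim: k => [|k [P [hP h0 h]]].
  exists 0; rewrite horner0; split=> // i.
  by rewrite !coef0 normc0.
pose P' := abs_poly G + \sum_(i < size F) (normc F`_i)%:P * P ^+ i.
have e : P'.[r] = (abs_poly G).[r] + \sum_(i < size F) normc F`_i * P.[r] ^+ i.
  rewrite hornerD horner_sum; congr (_ + _); apply: eq_bigr => i _.
  by rewrite hornerM hornerC horner_exp.
exists P'; split.
- rewrite picardS; apply: dominatedD (@dominated_abs _) _.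
  by apply: dominated_sum => i; apply: dominatedM (@dominatedC _) (dominatedX _ hP).
- rewrite e horner_poly addr_ge0 ?sumr_ge0 // => i _;
  by rewrite mulr_ge0 ?normc_ge0 ?exprn_ge0.
- apply: le_trans hb; rewrite e lerD2l horner_poly; apply: ler_sum => i _.
  by rewrite ler_wpM2l ?normc_ge0 // lerXn2r // nnegrE.
Qed.

Lemma dvdpX_coef0 p : ('X %| p) = (p`_0 == 0).
Proof. by rewrite -['X]subr0 dvdp_XsubCl /root horner_coef0. Qed.

(** All iterates are divisible by X and F starts in degree two. In v ^ i - u ^ i = (v - u) (...)
    with i >= 2 the cofactor is divisible by X, so each iteration gains one power of X. *)
Lemma picard_dvd (F G : {poly C}) k : G`_0 = 0 -> F`_0 = 0 -> F`_1 = 0 ->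
  'X ^+ k.+1 %| picard F G k.+1 - picard F G k.
Proof.
move=> G0 F0 F1.
have dw j : 'X %| picard F G j.
  elim: j => [|j IH]; first exact: dvdp0.
  move: IH; rewrite !dvdpX_coef0 -!horner_coef0 picard_horner => /eqP ->.
  by rewrite !horner_coef0 G0 F0 addr0.
elim: k => [|k IH]; first by rewrite expr1 dvdp_sub.
set u := picard F G k in IH *; set v := picard F G k.+1 in IH *.
have -> : picard F G k.+2 - v =
    \sum_(i < size F) ((F`_i)%:P * v ^+ i - (F`_i)%:P * u ^+ i).
  rewrite sumrB; transitivity ((G + \sum_(i < size F) (F`_i)%:P * v ^+ i) -
    (G + \sum_(i < size F) (F`_i)%:P * u ^+ i)); first by [].
  by rewrite opprD addrACA subrr add0r.
apply: (big_ind (fun q : {poly C} => 'X ^+ k.+2 %| q)) => [|x y hx hy|[[|[|i]] /= hi] _]; first exact: dvdp0.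
- exact: dvdp_add.
- by rewrite F0 !mul0r subrr dvdp0.
- by rewrite F1 !mul0r subrr dvdp0.
rewrite -mulrBr dvdp_mull // subrXX exprSr dvdp_mul //.
apply: (big_ind (fun q : {poly C} => 'X %| q)) => [|x y hx hy|[[|j] /= hj] _]; first exact: dvdp0.
- exact: dvdp_add.
- by rewrite subn0 exprS -mulrA dvdp_mulr // dw.
- by rewrite [_ ^+ j.+1]exprSr mulrA dvdp_mull // dw.
Qed.

Lemma picard_coef (F G : {poly C}) i k : G`_0 = 0 -> F`_0 = 0 -> F`_1 = 0 ->
  (i <= k)%N -> (picard F G k)`_i = (picard F G i)`_i.
Proof.
move=> G0 F0 F1; elim: k => [|k IH]; first by rewrite leqn0 => /eqP ->.
rewrite leq_eqVlt => /orP[/eqP -> //|ik]; rewrite -IH //.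
have /dvdpP[q hq] := picard_dvd k G0 F0 F1.
have := congr1 (fun p : {poly C} => p`_i) hq.
by rewrite /= coefB coefMXn ik => /eqP; rewrite subr_eq0 => /eqP.
Qed.

Lemma normc_horner p z (r : R) : normc z <= r -> normc p.[z] <= (abs_poly p).[r].
Proof.
move=> hz; rewrite horner_coef horner_poly; apply: le_trans (normc_sum _ _ _) _.
apply: ler_sum => i _; rewrite normcM normcX ler_wpM2l ?normc_ge0 //.
by rewrite lerXn2r // nnegrE ?normc_ge0 // (le_trans (normc_ge0 z)).
Qed.

Lemma horner_contraction (F : {poly C}) : F`_0 = 0 -> F`_1 = 0 ->
  exists b : R, [/\ 0 < b, (abs_poly F).[b] <= b / 2 &
    forall s t, normc s <= b -> normc t <= b ->
      normc (F.[s] - F.[t]) <= normc (s - t) / 2].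
Proof.
move=> F0 F1; pose S := \sum_(i < size F) i%:R * normc F`_i.
have S0 : 0 <= S by rewrite sumr_ge0 // => i _; rewrite mulr_ge0 ?normc_ge0.
(* On the disc of radius b <= 1 the Lipschitz constant of [F] is at most b S, because its terms
   start in degree two; this choice makes it at most 1 / 2. *)
pose b := Num.min 1 (1 / (2 * (S + 1))).
have b0 : 0 < b by rewrite lt_min ltr01 divr_gt0 ?mulr_gt0 //; lra.
have b1 : b <= 1 by rewrite ge_min lexx.
have bS : b * S <= 1 / 2.
  have : b <= 1 / (2 * (S + 1)) by rewrite ge_min lexx orbT.
  by rewrite ler_pdivlMr; [nra|lra].
have key i : i%:R * b ^+ i.-1 * normc F`_i <= b * (i%:R * normc F`_i).
  case: i => [|[|i]]; rewrite ?mul0r ?mulr0 ?F1 ?normc0 ?mulr0 //=.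
  rewrite exprS; set N := normc _; set A := _%:R.
  have -> : A * (b * b ^+ i) * N = b * (A * N) * b ^+ i by ring.
  by rewrite ler_piMr ?exprn_ile1 ?mulr_ge0 ?normc_ge0 ?(ltW b0).
exists b; split=> //.
- apply: (@le_trans _ _ (b * (b * S))); last by rewrite ler_wpM2l ?(ltW b0) //; lra.
  rewrite horner_poly mulr_sumr mulr_sumr; apply: ler_sum => -[[|i] hi] _ /=.
    by rewrite F0 normc0 !mul0r !mulr0.
  apply: le_trans (_ : b * ((i.+1)%:R * b ^+ i * normc F`_i.+1) <= _).
    rewrite exprS mulrCA ler_wpM2l ?(ltW b0) // mulrC ler_wpM2r ?normc_ge0 //.
    by rewrite ler_peMl ?exprn_ge0 ?(ltW b0) // ler1n.
  by rewrite ler_wpM2l ?(ltW b0) // key.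
- move=> s t hs ht; rewrite !horner_coef -sumrB.
  apply: le_trans (normc_sum _ _ _) _.
  apply: (@le_trans _ _ (\sum_(i < size F) b * (i%:R * normc F`_i) * normc (s - t))).
    apply: ler_sum => i _; rewrite -mulrBr normcM.
    apply: le_trans (ler_wpM2l (normc_ge0 _) (pow_lipschitz i hs ht)) _.
    by rewrite [leLHS]mulrA ler_wpM2r ?normc_ge0 // mulrC key.
  rewrite -mulr_suml -mulr_sumr -/S mulrC ler_wpM2l ?normc_ge0 //; lra.
Qed.

(* The coefficients of the solution are read off the Picard iterates, which
   stabilize degree by degree and converge to the solution by contraction. *)
Lemma analytic_implicit (F G : {poly C}) : G`_0 = 0 -> F`_0 = 0 -> F`_1 = 0 ->
  exists a (d : R), 0 < d /\ forall z w, normc z < d -> normc w < d ->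
    w = G.[z] + F.[w] -> pseries_sum a z w.
Proof.
move=> G0 F0 F1; have [b [b0 hb hF]] := horner_contraction F0 F1.
pose S := \sum_(i < size G) normc G`_i.
have S0 : 0 <= S by rewrite sumr_ge0 // => i _; rewrite normc_ge0.
(* Makes the majorant of [G] at [r] at most b / 2, the other half of [b] being taken by [F]. *)
pose r := Num.min 1 (b / (2 * (S + 1))).
have r0 : 0 < r by rewrite lt_min ltr01 divr_gt0 ?mulr_gt0 //; lra.
have hG : (abs_poly G).[r] <= b / 2.
  apply: le_trans (horner_small G0 _) _; first by rewrite (ltW r0) ge_min lexx.
  have : r <= b / (2 * (S + 1)) by rewrite ge_min lexx orbT.
  by rewrite -/S ler_pdivlMr; [nra|lra].
exists (fun i => (picard F G i)`_i), (Num.min (r / 2) b).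
split; first by rewrite lt_min b0 divr_gt0.
move=> z w; rewrite !lt_min => /andP[/ltW zr /ltW zb] /andP[_ /ltW wb] hw.
pose W k := (picard F G k).[z].
have bW k : bounded_at r b (fun i => (picard F G k)`_i).
  by apply: picard_bounded; rewrite ?(ltW r0) ?(ltW b0) //; lra.
have F00 : F.[0] = 0 by rewrite horner_coef0.
have hW k : normc (W k) <= b.
  elim: k => [|k IH]; first by rewrite /W horner0 normc0 ltW.
  rewrite /W picard_horner; apply: le_trans (le_normcD _ _) _.
  have /(normc_horner G) : normc z <= r by lra.
  have := hF _ 0 IH; rewrite normc0 F00 !subr0 => /(_ (ltW b0)); lra.
have Ww k : normc (W k - w) <= b / 2 ^+ k.
  elim: k => [|k IH].
    by rewrite /W horner0 sub0r normcN expr0 divr1.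
  rewrite {1}hw /W picard_horner -/(W k) opprD addrACA subrr add0r.
  apply: le_trans (hF _ _ (hW k) wb) _.
  by rewrite exprSr invfM mulrA ler_wpM2r ?invr_ge0.
(* The coefficients below degree [k] have stabilized, so only the terms of degree at least [k] of
   the k-th iterate remain. *)
have tailW k : normc (W k - \sum_(j < k) (picard F G j)`_j * z ^+ j) <= 2 * b / 2 ^+ k.
  set p := picard F G k.
  have -> : W k = \sum_(0 <= j < maxn k (size p)) p`_j * z ^+ j.
    by rewrite big_mkord -horner_coef_wide // leq_maxr.
  rewrite (big_cat_nat (n := k)) ?leq_maxl //= big_mkord.
  rewrite (eq_bigr (fun j : 'I_k => (picard F G j)`_j * z ^+ j)); last first.
    by move=> j _; rewrite /p picard_coef // ltnW.
  rewrite addrAC subrr add0r; apply: le_trans (tail_bound _ _ r0 (bW k) zr) _.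
  rewrite -exprVn ler_wpM2l //; first lra.
  rewrite lerXn2r ?nnegrE ?divr_ge0 ?normc_ge0 ?(ltW r0) //.
  by rewrite ler_pdivrMr //; lra.
rewrite pseries_sumE.
have h0 : tends (fun k => \sum_(j < k) (picard F G j)`_j * z ^+ j - w) 0.
  apply: (@cvgc0 _ _ (3 * b)) => k.
  apply: le_trans (normc_triangle _ _ (W k)) _.
  have -> : 3 * b / 2 ^+ k = 2 * b / 2 ^+ k + b / 2 ^+ k by rewrite -mulrDl; congr (_ / _); ring.
  by apply: lerD; rewrite // normcB.
have := tendsD h0 (tends_cst w); rewrite add0r.
by apply: (tends_eventually (n0 := 0)) => n _; rewrite subrK.
Qed.

End AnalyticImplicitFunction.

(** * Connectedness and compactness in the plane *)

Section Plane.
Variable R : realType.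
Notation C := R[i].
Implicit Types (z w u v : C) (p q : {poly C}) (a b t s d : R).

(** Connectedness of a segment, by way of the supremum of the t such that [Q] holds on [a, t]. *)
Lemma locally_constant_segment (Q : R -> Prop) a b : a <= b ->
  (forall t, a <= t <= b -> exists2 d, 0 < d & forall s s',
     a <= s <= b -> a <= s' <= b -> `|s - t| < d -> `|s' - t| < d -> Q s -> Q s') ->
  Q a -> Q b.
Proof.
move=> ab hQ Qa.
pose S := [set t | a <= t <= b /\ forall s, a <= s <= t -> Q s].
have Sa : S a.
  split; first by rewrite lexx.
  by move=> s /andP[h1 h2]; have -> : s = a by apply/eqP; rewrite eq_le h2.
have Sb : ubound S b by move=> t [/andP[]].
have hS : has_sup S by split; [exists a|exists b].
pose c := sup S.
have ac : a <= c by apply: sup_upper_bound.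
have cb : c <= b by apply: ge_sup => //; exists a.
have [|d d0 hd] := hQ c; first by rewrite ac.
have [t [/andP[at_ tb] ht] tc] := sup_adherent d0 hS; rewrite -/c in tc.
have tc' : t <= c by apply: sup_upper_bound => //; split; rewrite ?at_.
have Qt : Q t by apply: ht; rewrite at_ lexx.
have hnear s : a <= s <= b -> `|s - c| < d -> Q s.
  move=> hs hsc; apply: (hd t) => //; rewrite ?at_ //.
  by rewrite ltr_norml; apply/andP; split; lra.
apply: (hnear b); first by rewrite ab lexx.
suff /eqP -> : b == c by rewrite subrr normr0.
rewrite eq_le cb andbT leNgt; apply/negP => cb'.
pose t' := Num.min b (c + d / 2).
have t'b : t' <= b by rewrite ge_min lexx.
have t'c : t' <= c + d / 2 by rewrite ge_min lexx orbT.
have ct' : c < t' by rewrite lt_min cb' /=; lra.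
suff /(sup_upper_bound hS) : S t' by rewrite leNgt ct'.
split; first by apply/andP; split=> //; lra.
move=> s /andP[as_ st']; have [sc|cs] := leP s t; first by apply: ht; rewrite as_.
have hsb : a <= s <= b by apply/andP; split; lra.
apply: (hnear s hsb).
by rewrite ltr_norml; apply/andP; split; lra.
Qed.

(** Compactness of a segment as an induction principle on sets. It follows from connectedness: that
    [P] holds of [a, t] is a locally constant property of t. *)
Lemma segment_cover (P : set R -> Prop) a b : a <= b ->
  (forall A B, A `<=` B -> P B -> P A) ->
  (forall A B, P A -> P B -> P (A `|` B)) ->
  (forall t, a <= t <= b -> exists2 d, 0 < d & P [set s | `|s - t| < d]) ->
  P [set s | a <= s <= b].
Proof.
move=> ab hsub hU hloc.
apply: (@locally_constant_segment (fun t => P [set s | a <= s <= t]) a b) => //.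
  move=> t /hloc[d d0 hd]; exists d => // s s' hs hs' st s't Ps.
  apply: hsub (hU _ _ Ps hd) => x /= /andP[ax xs'].
  have [xs|sx] := leP x s; [left; rewrite ax|right].
    by [].
  move: st s't; rewrite !ltr_norml => /andP[h1 h2] /andP[h3 h4].
  by apply/andP; split; lra.
have [|d d0 hd] := hloc a; first by rewrite lexx.
apply: hsub hd => x /= /andP[h1 h2].
by have -> : x = a; [lra|rewrite subrr normr0].
Qed.

Lemma normr_Re z : `|complex.Re z| <= normc z.
Proof.
case: z => x y /=; rewrite -sqrtr_sqr ler_sqrt; first by rewrite lerDl sqr_ge0.
by rewrite addr_ge0 ?sqr_ge0.
Qed.

Lemma normr_Im z : `|complex.Im z| <= normc z.
Proof.
case: z => x y /=; rewrite -sqrtr_sqr ler_sqrt; first by rewrite lerDr sqr_ge0.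
by rewrite addr_ge0 ?sqr_ge0.
Qed.

Lemma normc_le_ReIm z : normc z <= `|complex.Re z| + `|complex.Im z|.
Proof.
case: z => x y /=; rewrite -[leRHS]ger0_norm ?addr_ge0 //.
rewrite -sqrtr_sqr ler_sqrt ?sqr_ge0 // sqrrD !real_normK ?num_real //.
have : 0 <= `|x| * `|y| by rewrite mulr_ge0.
lra.
Qed.

(** Compactness of a segment serves twice: along the real parts it yields a horizontal strip around
    each height t, and along the imaginary parts it joins the strips into a square containing the
    disc. *)
Lemma disc_cover (P : set C -> Prop) (M : R) :
  (forall A B, A `<=` B -> P B -> P A) ->
  (forall A B, P A -> P B -> P (A `|` B)) ->
  (forall z, exists2 d, 0 < d & P [set w | normc (w - z) < d]) ->
  P [set w | normc w <= M].
Proof.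
move=> hsub hU hloc.
have P0 : P set0.
  by have [d _] := hloc 0; apply: hsub.
have [M0|M0] := ltP M 0.
  apply: hsub P0 => w /= h; have := normc_ge0 w; lra.
have MM : - M <= M by lra.
suff : P [set w | complex.Re w \in `[-M, M] /\ complex.Im w \in `[-M, M]].
  apply: hsub => w /= h; rewrite !in_itv /= -!ler_norml; split.
    exact: le_trans (normr_Re w) h.
  exact: le_trans (normr_Im w) h.
pose P1 (A : set R) := P [set w | complex.Re w \in `[-M, M] /\ A (complex.Im w)].
suff : P1 [set s | - M <= s <= M].
  by apply: hsub => w [h1 h2]; split.
apply: (segment_cover MM).
- by move=> A B AB; apply: hsub => w [h1 h2]; split=> //; apply: AB.
- move=> A B hA hB; apply: hsub (hU _ _ hA hB) => w [h1 [h2|h2]]; [left|right]; by split.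
move=> t _.
pose P2 (A : set R) := exists2 d, 0 < d &
  P [set w | A (complex.Re w) /\ `|complex.Im w - t| < d].
suff [d d0 hd] : P2 [set s | - M <= s <= M].
  exists d => //; apply: hsub hd => w [h1 h2]; split.
apply: (segment_cover MM).
- by move=> A B AB [d d0 hd]; exists d => //; apply: hsub hd => w [h1 h2]; split=> //; apply: AB.
- move=> A B [d d0 hd] [d' d0' hd']; exists (Num.min d d'); first by rewrite lt_min d0.
  apply: hsub (hU _ _ hd hd') => w []; rewrite lt_min.
  by case=> h /andP[h1 h2]; [left|right].
move=> s _; have [d d0 hd] := hloc (s +i* t)%C.
exists (d / 2); rewrite ?divr_gt0 //; exists (d / 2); rewrite ?divr_gt0 //.
apply: hsub hd => w [/= h1 h2].
apply: le_lt_trans (normc_le_ReIm _) _.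
by case: w h1 h2 => x y /=; lra.
Qed.

Lemma locally_constant_plane (Q : C -> Prop) :
  (forall z, exists2 d, 0 < d & forall w w',
     normc (w - z) < d -> normc (w' - z) < d -> Q w -> Q w') ->
  forall z w, Q z -> Q w.
Proof.
move=> hQ z w Qz; pose f t := z + t%:C%C * (w - z).
have f1 : f 1 = w by rewrite /f mul1r addrC subrK.
rewrite -f1; apply: (@locally_constant_segment (fun t => Q (f t)) 0 1) => //; last first.
  by rewrite /f mul0r addr0.
move=> t _; have [d d0 hd] := hQ (f t).
pose K := normc (w - z) + 1; have K0 : 0 < K by rewrite ltr_wpDl ?normc_ge0.
exists (d / K); first by rewrite divr_gt0.
have hf s : `|s - t| < d / K -> normc (f s - f t) < d.
  move=> h; rewrite /f opprD addrACA subrr add0r -mulrBl normcM -rmorphB normcR.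
  move: h; rewrite ltr_pdivlMr // => h; apply: le_lt_trans h.
  by rewrite ler_wpM2l // /K lerDl.
by move=> s s' _ _ h1 h2; apply: hd; apply: hf.
Qed.

End Plane.

(** * Local study of the plane curve v ^ 2 = P(u) *)

Section PlaneCurve.
Variable R : realType.
Notation C := R[i].
Implicit Types (z w u v : C) (P Q : {poly C}) (r d : R).

Lemma poly_factor_sub P (c : C) : exists Q, P = ('X - c%:P) * Q + (P.[c])%:P.
Proof.
have /factor_theorem[Q hQ] : root (P - (P.[c])%:P) c.
  by rewrite /root hornerD hornerN hornerC subrr.
by exists Q; rewrite mulrC -hQ subrK.
Qed.

Lemma horner_sub_bound P (c : C) : exists2 K : R, 0 < K &
  forall u, normc (u - c) <= 1 -> normc (P.[u] - P.[c]) <= K * normc (u - c).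
Proof.
have [Q hQ] := poly_factor_sub P c.
pose K := (abs_poly Q).[normc c + 1] + 1.
have K0 : 0 < K.
  rewrite ltr_wpDl // horner_poly sumr_ge0 // => i _.
  by rewrite mulr_ge0 ?exprn_ge0 ?addr_ge0 ?normc_ge0.
exists K => // u hu.
have -> : P.[u] - P.[c] = (u - c) * Q.[u].
  by rewrite {1}hQ hornerD hornerM hornerXsubC hornerC addrK.
rewrite normcM mulrC ler_wpM2r ?normc_ge0 //.
have : normc u <= normc c + 1.
  by have := normc_triangle u 0 c; rewrite !subr0; lra.
by move=> /(normc_horner Q); rewrite /K; lra.
Qed.

Lemma horner_cont P (c : C) r : 0 < r ->
  exists2 d : R, 0 < d & forall u, normc (u - c) < d -> normc (P.[u] - P.[c]) < r.
Proof.
move=> r0; have [K K0 hK] := horner_sub_bound P c.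
exists (Num.min 1 (r / K)); first by rewrite lt_min ltr01 divr_gt0.
move=> u; rewrite lt_min ltr_pdivlMr // => /andP[/ltW h1 h2].
by apply: le_lt_trans (hK _ h1) _; rewrite mulrC.
Qed.

Lemma horner_nonzero P (c : C) : P.[c] != 0 ->
  exists2 d : R, 0 < d & forall u, normc (u - c) < d -> P.[u] != 0.
Proof.
rewrite -normc_gt0 => h; have [d d0 hd] := horner_cont P c h; exists d => // u /hd.
by apply: contraTneq => ->; rewrite sub0r normcN ltxx.
Qed.

Variable P : {poly C}.

(** The product (v - v0) (v + v0) = P(u) - P(u0) is small, hence so is one of its factors. *)
Lemma curve_fibre u0 v0 r : v0 ^+ 2 = P.[u0] -> 0 < r ->
  exists2 d, 0 < d & forall u v, normc (u - u0) < d -> v ^+ 2 = P.[u] ->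
    normc (v - v0) < r \/ normc (v + v0) < r.
Proof.
move=> h0 r0; have [d d0 hd] := horner_cont P u0 (exprn_gt0 2 r0).
exists d => // u v /hd; rewrite -h0 => h1 h2; move: h1; rewrite -h2 subr_sqr normcM.
have [h|h] := ltP (normc (v - v0)) r; first by left.
have [h'|h'] := ltP (normc (v + v0)) r; first by right.
by move=> h1; have := ler_pM (ltW r0) (ltW r0) h h'; rewrite -expr2 leNgt h1.
Qed.

Lemma curve_lift u0 v0 r : v0 ^+ 2 = P.[u0] -> 0 < r ->
  exists2 d, 0 < d & forall u, normc (u - u0) < d ->
    exists2 v, v ^+ 2 = P.[u] & normc (v - v0) < r.
Proof.
move=> h0 r0; have [d d0 hd] := curve_fibre h0 r0; exists d => // u hu.
have [v hv] := @closed_root R P.[u] 2 isT.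
have [h|h] := hd u v hu hv; first by exists v.
by exists (- v); rewrite ?sqrrN // -opprD normcN.
Qed.

(* [P.[u0] - v ^ 2] is, up to the leading coefficient, the product of the
   differences of [u0] and the roots of [P - v ^ 2], so one of them is small. *)
Lemma curve_branch_lift u0 r : (1 < size P)%N -> P.[u0] = 0 -> 0 < r ->
  exists2 d, 0 < d & forall v, normc v < d ->
    exists2 u, P.[u] = v ^+ 2 & normc (u - u0) < r.
Proof.
move=> sP h0 r0; pose l := normc (lead_coef P) * r ^+ (size P).-1.
have P0 : P != 0 by rewrite -size_poly_gt0 ltnW.
have l0 : 0 < l by rewrite mulr_gt0 ?exprn_gt0 // normc_gt0 lead_coef_eq0.
exists (Num.min 1 l); first by rewrite lt_min ltr01.
move=> v; rewrite lt_min => /andP[v1 vl].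
pose p := P - (v ^+ 2)%:P.
have sC : (size (- (v ^+ 2)%:P)%R < size P)%N.
  by rewrite size_polyN (leq_ltn_trans (size_polyC_leq1 _)).
have sp : size p = size P by rewrite size_polyDl.
have lp : lead_coef p = lead_coef P by rewrite lead_coefDl.
have [s hs] := closed_field_poly_normal p.
have ss : size s = (size P).-1.
  have := sp; rewrite hs size_scale ?lp ?lead_coef_eq0 // size_prod_XsubC => <- //.
have pu0 : normc p.[u0] < l.
  rewrite hornerD h0 add0r hornerN hornerC normcN normcX.
  by apply: le_lt_trans vl; rewrite expr2 ler_piMr ?normc_ge0 // ltW.
have [/hasP[u us hu]|/hasPn hn] := boolP (has (fun u => normc (u - u0) < r) s).
  exists u => //; have : p.[u] = 0.
    apply/rootP; rewrite hs rootZ ?lp ?lead_coef_eq0 //.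
    by rewrite root_prod_XsubC.
  by rewrite hornerD hornerN hornerC => /eqP; rewrite subr_eq0 => /eqP.
exfalso; move: pu0; rewrite ltNge => /negP; apply.
rewrite hs hornerZ normcM lp /l ler_wpM2l ?normc_ge0 // -ss.
elim: s hn {hs ss} => [|x s IH] hn; first by rewrite big_nil hornerC normc1.
rewrite big_cons hornerM hornerXsubC normcM exprS.
apply: ler_pM; rewrite ?exprn_ge0 ?(ltW r0) //.
  by rewrite normcB leNgt hn // mem_head.
by apply: IH => y ys; apply: hn; rewrite inE ys orbT.
Qed.

Definition curve_coord u0 v0 u v := if v0 != 0 then u - u0 else v.

(** Where v0 is nonzero, closeness to v0 excludes the other square root - v0; where v0 = 0, the
    point u0 is a simple root of [P], hence its only root nearby. *)
Lemma curve_coord_isolated u0 v0 : v0 ^+ 2 = P.[u0] ->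
  (v0 = 0 -> P^`().[u0] != 0) ->
  exists2 d, 0 < d & forall u v, normc (u - u0) < d -> normc (v - v0) < d ->
    v ^+ 2 = P.[u] -> curve_coord u0 v0 u v = 0 -> u = u0 /\ v = v0.
Proof.
move=> h0 hs; rewrite /curve_coord; have [v00|v00] := eqVneq v0 0; last first.
  exists (normc v0); first by rewrite normc_gt0.
  move=> u v _ hv hc /eqP; rewrite subr_eq0 => /eqP uu; split=> //.
  move: hc; rewrite uu -h0 => /eqP; rewrite eqf_sqr => /orP[/eqP//|/eqP vv].
  move: hv; rewrite vv -opprD normcN -mulr2n normcMn.
  move=> hv; exfalso; have := normc_ge0 v0; move: hv; rewrite -mulr_natl; lra.
have [Q hQ] := poly_factor_sub P u0.
move: (hQ); rewrite -h0 v00 expr0n /= addr0 => {}hQ.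
have Q0 : Q.[u0] != 0.
  by have := hs v00; rewrite hQ derivM derivXsubC mul1r hornerD hornerM hornerXsubC subrr mul0r addr0.
have [d d0 hd] := horner_nonzero Q0.
exists d => // u v hu _ hc vz; split; last by rewrite vz.
move: hc; rewrite vz expr0n hQ hornerM hornerXsubC /= => /esym/eqP.
by rewrite mulf_eq0 (negbTE (hd u hu)) orbF subr_eq0 => /eqP.
Qed.

Lemma coef_shift0 (p : {poly C}) u0 : (p \Po ('X + u0%:P))`_0 = p.[u0].
Proof. by rewrite -horner_coef0 horner_comp hornerD hornerX hornerC add0r. Qed.

Lemma coef_shift1 (p : {poly C}) u0 : (p \Po ('X + u0%:P))`_1 = p^`().[u0].
Proof.
have -> : (p \Po ('X + u0%:P))`_1 = (p \Po ('X + u0%:P))^`()`_0.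
  by rewrite coef_deriv mulr1n.
by rewrite deriv_comp derivD derivX derivC addr0 mulr1 coef_shift0.
Qed.

Lemma horner_shift (p : {poly C}) u0 u : (p \Po ('X + u0%:P)).[u - u0] = p.[u].
Proof. by rewrite horner_comp hornerD hornerX hornerC subrK. Qed.

Lemma pseries_poly (p : {poly C}) z : pseries_sum (fun j => p`_j) z p.[z].
Proof.
rewrite pseries_sumE; apply: (tends_eventually (n0 := size p)) (tends_cst _).
by move=> n hn; rewrite (horner_coef_wide _ hn).
Qed.

Arguments pseries_poly : clear implicits.

Lemma curve_expansion u0 v0 : v0 ^+ 2 = P.[u0] ->
  (v0 = 0 -> P^`().[u0] != 0) ->
  exists a b d, 0 < d /\ forall u v, normc (u - u0) < d -> normc (v - v0) < d ->
    v ^+ 2 = P.[u] ->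
    pseries_sum a (curve_coord u0 v0 u v) u /\ pseries_sum b (curve_coord u0 v0 u v) v.
Proof.
move=> h0 hs; rewrite /curve_coord; have [v00|v00] := eqVneq v0 0; last first.
  (* With this c the equation of the curve reads v - v0 = c (P(u) - P(u0)) - c (v - v0) ^ 2, a
     fixed-point equation for v - v0 with parameter u - u0. *)
  pose c := (2 * v0)^-1.
  have cv : c * (2 * v0) = 1.
    by rewrite mulVf // mulf_neq0 // (_ : 2 = 2%:R) // pnatr_eq0.
  pose F : {poly C} := (- c) *: 'X^2.
  pose G : {poly C} := c *: (P \Po ('X + u0%:P) - (P.[u0])%:P).
  have [||| a [d [d0 hd]]] := @analytic_implicit R F G.
  - by rewrite coefZ coefB coef_shift0 coefC subrr mulr0.
  - by rewrite coefZ coefXn mulr0.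
  - by rewrite coefZ coefXn mulr0.
  exists (fun j => ('X + u0%:P : {poly C})`_j).
  exists (fun j => (v0%:P : {poly C})`_j + a j), d; split=> // u v hu hv hc.
  split.
    have := pseries_poly ('X + u0%:P) (u - u0).
    by rewrite hornerD hornerX hornerC subrK.
  have := pseries_add (pseries_poly v0%:P (u - u0)) (hd _ _ hu hv _).
  rewrite hornerC [v0 + _]addrC subrK; apply.
  rewrite !hornerZ hornerXn hornerD hornerN hornerC horner_shift -hc -h0.
  have -> : c * (v ^+ 2 - v0 ^+ 2) + - c * (v - v0) ^+ 2 =
    c * (2 * v0) * (v - v0) by ring.
  by rewrite cv mul1r.
(* With this c the equation of the curve reads u - u0 = c v ^ 2 + ((u - u0) - c P(u)), where the
   bracket vanishes to order two at u0; now v is the parameter. *)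
pose c := (P^`().[u0])^-1.
have c1 : c * P^`().[u0] = 1 by rewrite mulVf // hs.
pose F : {poly C} := 'X - c *: (P \Po ('X + u0%:P)).
pose G : {poly C} := c *: 'X^2.
have [||| a [d [d0 hd]]] := @analytic_implicit R F G.
- by rewrite coefZ coefXn mulr0.
- by rewrite coefB coefZ coef_shift0 coefX sub0r -h0 v00 expr0n mulr0 oppr0.
- by rewrite coefB coefZ coef_shift1 coefX c1 subrr.
exists (fun j => (u0%:P : {poly C})`_j + a j).
exists (fun j => ('X : {poly C})`_j), d; split=> // u v hu hv hc; split; last first.
  by have := pseries_poly 'X v; rewrite hornerX.
rewrite v00 subr0 in hv.
have := pseries_add (pseries_poly u0%:P v) (hd _ _ hv hu _).
rewrite hornerC [u0 + _]addrC subrK; apply.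
rewrite hornerD hornerN !hornerZ hornerXn hornerX horner_shift -hc.
by rewrite addrCA subrr addr0.
Qed.

End PlaneCurve.
Arguments pseries_poly {R} p z.

(* A class, so that the hypotheses on the roots are passed implicitly. *)
Class hyperelliptic (R : realType) (g : nat) (e : seq R[i]) : Prop := {
  roots_uniq : uniq e;
  roots_size : size e = g.*2.+2 \/ size e = g.*2.+1 }.

(** * Charts and neighborhoods on the surface *)

Section Charts.
Variables (R : realType) (g : nat) (e : seq R[i]).
Notation C := R[i].
Notation X := (surface g e).
Implicit Types (p q : X) (u v : C).
Context {hyp : hyperelliptic g e}.
Let uniq_e : uniq e := roots_uniq.
Let size_e : size e = g.*2.+2 \/ size e = g.*2.+1 := roots_size.

Local Notation f := (defining_poly e).

(* In the chart at [p] the surface is the plane curve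
   [chart_v ^ 2 = chart_poly.[chart_u]], and [chart_dom p q] says that [q] is in it. *)
Definition inf_poly : {poly C} := \poly_(i < g.*2.+3) f`_(g.*2.+2 - i).

Definition chart_poly p := if val p is inl _ then f else inf_poly.

Definition chart_dom p q : bool :=
  match val p, val q with
  | inl _, inr _ => false
  | inr _, inl (x, _) => x != 0
  | _, _ => true
  end.

Definition chart_u p q : C :=
  match val p, val q with
  | inl _, inl (x, _) => x
  | inr _, inl (x, _) => x^-1
  | _, inr _ => 0
  end.

Definition chart_v p q : C :=
  match val p, val q with
  | inl _, inl (_, y) => y
  | inr _, inl (x, y) => y / x ^+ g.+1
  | inl _, inr _ => 0
  | inr _, inr v => v
  end.

Lemma size_defining_poly : size f = (size e).+1.
Proof. exact: size_prod_XsubC. Qed.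

Lemma size_defining_poly_le : (size f <= g.*2.+3)%N.
Proof. by rewrite size_defining_poly; case: size_e => ->. Qed.

Lemma monic_defining_poly : f \is monic.
Proof. exact: monic_prod_XsubC. Qed.

Lemma inf_poly_coef i : (i <= g.*2.+2)%N -> inf_poly`_i = f`_(g.*2.+2 - i).
Proof. by move=> h; rewrite coef_poly ltnS h. Qed.

Lemma inf_poly0 : inf_poly.[0] = f`_(g.*2.+2).
Proof. by rewrite horner_coef0 inf_poly_coef // subn0. Qed.

Lemma horner_inf_poly u : u != 0 -> inf_poly.[u] = u ^+ g.*2.+2 * f.[u^-1].
Proof.
move=> u0; rewrite horner_poly (horner_coef_wide _ size_defining_poly_le) mulr_sumr.
rewrite (reindex_inj rev_ord_inj) /=; apply: eq_bigr => i _.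
rewrite subSS subKn -1?ltnS // mulrCA exprVn; congr (_ * _).
by rewrite exprB ?unitfE // -ltnS.
Qed.

Lemma defining_poly_simple u : f.[u] = 0 -> f^`().[u] != 0.
Proof.
have : separable_poly f by rewrite separable_prod_XsubC.
rewrite separable_poly.unlock => hc.
by move=> /rootP /(coprimep_root hc).
Qed.

(** The coefficients of degrees 0 and 1 are those of x ^ (2g+2) and x ^ (2g+1) in the defining
    polynomial. If the former vanishes, N = 2g+1 and the latter is the leading coefficient 1. *)
Lemma inf_poly_simple : inf_poly.[0] = 0 -> inf_poly^`().[0] != 0.
Proof.
rewrite inf_poly0 horner_coef0 coef_deriv mulr1n inf_poly_coef // subSS subn0.
have := monicP monic_defining_poly; rewrite lead_coefE size_defining_poly.
by case: size_e => -> /= ->; rewrite ?oner_neq0 // => /eqP; rewrite oner_eq0.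
Qed.

Lemma chart_domxx p : chart_dom p p.
Proof. by rewrite /chart_dom; case: (val p) => [[]|]. Qed.

Lemma chart_curve p q : chart_dom p q ->
  chart_v p q ^+ 2 = (chart_poly p).[chart_u p q].
Proof.
rewrite /chart_dom /chart_v /chart_u /chart_poly.
case: p => [[[a b]|c] hp]; case: q => [[[x y]|v] hq] //=.
- by move=> _; apply/eqP.
- move=> x0; rewrite horner_inf_poly ?invr_neq0 // invrK.
  by rewrite expr_div_n (eqP hq) exprVn -exprM muln2 doubleS mulrC.
- by move=> _; rewrite inf_poly0; apply/eqP.
Qed.

Lemma chart_simple p : chart_v p p = 0 -> (chart_poly p)^`().[chart_u p p] != 0.
Proof.
move=> v0; have := chart_curve (chart_domxx p); rewrite v0 expr0n /=.
rewrite /chart_v /chart_u /chart_poly.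
by case: p v0 => [[[a b]|c] hp] //= _ /esym; [apply: defining_poly_simple|apply: inf_poly_simple].
Qed.

Lemma chart_inj p q q' : chart_dom p q -> chart_dom p q' ->
  chart_u p q = chart_u p q' -> chart_v p q = chart_v p q' -> q = q'.
Proof.
rewrite /chart_dom /chart_u /chart_v; move=> h1 h2 h3 h4; apply: val_inj.
move: h1 h2 h3 h4; case: (val p) => [_|_];
  case: (val q) => [[x y]|v]; case: (val q') => [[x' y']|v'] //=.
- by move=> _ _ -> ->.
- move=> x0 x0' /invr_inj <- h; congr (inl (_, _)).
  by apply: (mulIf _ h); rewrite invr_neq0 // expf_neq0.
- by move=> x0 _ /eqP; rewrite invr_eq0 (negbTE x0).
- by move=> _ x0 /esym/eqP; rewrite invr_eq0 (negbTE x0).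
- by move=> _ _ _ ->.
Qed.

Lemma chart_surj p u v : v ^+ 2 = (chart_poly p).[u] ->
  exists q, [/\ chart_dom p q, chart_u p q = u & chart_v p q = v].
Proof.
rewrite /chart_dom /chart_u /chart_v /chart_poly; case: (val p) => [_|_] h.
  have hq : on_surface g e (inl (u, v)) by apply/eqP.
  by exists (exist (on_surface g e) _ hq).
have [u0|u0] := eqVneq u 0.
  have hq : on_surface g e (inr v) by rewrite /= h u0 inf_poly0.
  by exists (exist (on_surface g e) _ hq); rewrite /= u0.
have hq : on_surface g e (inl (u^-1, v / u ^+ g.+1)).
  rewrite /= expr_div_n h horner_inf_poly // -exprM mulnC mul2n doubleS.
  by rewrite mulrAC divff ?mul1r // expf_neq0.
exists (exist (on_surface g e) _ hq); rewrite /= invr_neq0 // invrK; split=> //.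
by rewrite exprVn invrK divfK // expf_neq0.
Qed.

(** Neighborhoods in terms of chart coordinates and real radii, uniform for affine points and points
    at infinity; [nearpP] identifies them with [surface_nbhs]. *)
Definition nearp p (A : X -> Prop) : Prop := exists2 r : R, 0 < r &
  forall q, chart_dom p q -> normc (chart_u p q - chart_u p p) < r ->
    normc (chart_v p q - chart_v p p) < r -> A q.

Lemma surface_ballE p (r : R) q : 0 < r -> surface_ball p r%:C%C q <->
  [/\ chart_dom p q, normc (chart_u p q - chart_u p p) < r &
    normc (chart_v p q - chart_v p p) < r].
Proof.
move=> r0; rewrite /surface_ball /chart_dom /chart_u /chart_v /=.
case: (val p) => [[a b]|c]; case: (val q) => [[x y]|v] /=.
- by rewrite !normr_ltR; split=> [[]|[]].
- by split=> // -[].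
- by rewrite !normr_ltR subr0; split=> -[].
- by rewrite normr_ltR !subr0 expr0n addr0 sqrtr0; split=> [|[]].
Qed.

Lemma nearpP p (A : X -> Prop) : (\forall q \near surface_nbhs p, A q) <-> nearp p A.
Proof.
split=> [[r r0 h]|[r r0 h]].
  have r0' : 0 < complex.Re r by move: r0; rewrite ltcE => /andP[].
  have e_r : r = (complex.Re r)%:C%C.
    by case: r r0 {h r0'} => a b; rewrite ltcE /= => /andP[/eqP -> _].
  exists (complex.Re r) => // q h1 h2 h3; apply: h.
  by rewrite e_r; apply/surface_ballE.
exists r%:C%C; first by rewrite ltcR.
by move=> q /(surface_ballE _ _ r0)[]; exact: h.
Qed.

Lemma nearp_imp p (A B : X -> Prop) : (forall q, A q -> B q) -> nearp p A -> nearp p B.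
Proof. by move=> AB [r r0 h]; exists r => // q *; apply/AB/h. Qed.

Lemma nearp_and p (A B : X -> Prop) : nearp p A -> nearp p B ->
  nearp p (fun q => A q /\ B q).
Proof.
move=> [r r0 h] [r' r0' h']; exists (Num.min r r'); first by rewrite lt_min r0.
move=> q hq; rewrite !lt_min => /andP[h1 h1'] /andP[h2 h2'].
by split; [apply: h|apply: h'].
Qed.

Lemma nearp_self p (A : X -> Prop) : nearp p A -> A p.
Proof. by move=> [r r0]; apply; rewrite ?chart_domxx // subrr normc0. Qed.

Lemma nearp_all p (A : X -> Prop) : (forall q, A q) -> nearp p A.
Proof. by move=> h; exists 1. Qed.

Lemma nearp_dom p : nearp p (chart_dom p).
Proof. by exists 1. Qed.

Lemma local_coordE p q : chart_dom p q -> local_coord p q =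
  curve_coord (chart_u p p) (chart_v p p) (chart_u p q) (chart_v p q).
Proof.
rewrite /chart_dom /local_coord /curve_coord /chart_u /chart_v.
by case: (val p) => [[a b]|c]; case: (val q) => [[x y]|v] //=; rewrite subr0.
Qed.

Lemma local_coordxx p : local_coord p p = 0.
Proof.
rewrite local_coordE ?chart_domxx // /curve_coord.
by case: ifP => [_|/negbFE/eqP//]; rewrite subrr.
Qed.

Lemma local_coord_neq0 p : nearp p (fun q => q != p -> local_coord p q != 0).
Proof.
have [d d0 hd] := curve_coord_isolated (chart_curve (chart_domxx p)) (@chart_simple p).
exists d => // q hq h1 h2; apply: contra => /eqP; rewrite local_coordE // => h.
have [hu hv] := hd _ _ h1 h2 (chart_curve hq) h.
by apply/eqP; apply: (chart_inj hq) => //; exact: chart_domxx.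
Qed.

Lemma local_coord_small p (r : R) : 0 < r -> nearp p (fun q => normc (local_coord p q) < r).
Proof.
move=> r0; exists r => // q hq h1 h2; rewrite local_coordE // /curve_coord.
by case: ifP => // /negbFE/eqP v0; move: h2; rewrite v0 subr0.
Qed.

(** The local coordinate takes all small values. This is what allows the maximum principle for power
    series in z to be transported to the surface. *)
Lemma chart_lift p (r : R) : 0 < r -> exists2 d : R, 0 < d & forall z, normc z < d ->
  exists q, [/\ chart_dom p q, normc (chart_u p q - chart_u p p) < r,
    normc (chart_v p q - chart_v p p) < r & local_coord p q = z].
Proof.
move=> r0; have h0 := chart_curve (chart_domxx p).
have [v0|v0] := eqVneq (chart_v p p) 0; last first.
  have [d d0 hd] := curve_lift h0 r0.
  exists (Num.min d r); first by rewrite lt_min d0.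
  move=> z; rewrite lt_min => /andP[zd zr].
  have [|v hv vr] := hd (chart_u p p + z); first by rewrite addrAC subrr add0r.
  have [q [hq hqu hqv]] := chart_surj hv; exists q; split=> //.
  - by rewrite hqu addrAC subrr add0r.
  - by rewrite hqv.
  - by rewrite local_coordE // /curve_coord v0 hqu addrAC subrr add0r.
have P0 : (chart_poly p).[chart_u p p] = 0 by rewrite -h0 v0 expr0n.
have sP : (1 < size (chart_poly p))%N.
  rewrite ltnNge; apply/negP => /size1_polyC hP.
  by have := chart_simple v0; rewrite hP derivC horner0 eqxx.
have [d d0 hd] := curve_branch_lift sP P0 r0.
exists (Num.min d r); first by rewrite lt_min d0.
move=> z; rewrite lt_min => /andP[zd zr]; have [u hu ur] := hd z zd.
have [q [hq hqu hqv]] := chart_surj (esym hu); exists q; split=> //.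
- by rewrite hqu.
- by rewrite hqv v0 subr0.
- by rewrite local_coordE // /curve_coord v0 eqxx /= hqv.
Qed.

Lemma nearp_lift p (A : X -> Prop) : nearp p A -> exists2 d : R, 0 < d &
  forall z, z != 0 -> normc z < d -> exists q, [/\ A q, q != p & local_coord p q = z].
Proof.
move=> [r r0 h]; have [d d0 hd] := chart_lift p r0; exists d => // z z0 /hd.
move=> [q [h1 h2 h3 h4]]; exists q; split=> //; first exact: h.
by apply: contraNneq z0 => qp; rewrite -h4 qp local_coordxx.
Qed.

(** No point is isolated, so that properties holding on punctured neighborhoods can be confronted at
    a common point. *)
Lemma nearp_nontrivial p (A : X -> Prop) : nearp p (fun q => q != p -> A q) ->
  exists2 q, q != p & A q.
Proof.
move=> /nearp_lift[d d0 hd].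
have [||q [h1 h2 _]] := hd (d / 2)%:C%C.
- by rewrite -normc_gt0 normcR gtr0_norm divr_gt0.
- by rewrite normcR gtr0_norm ?divr_gt0 //; lra.
by exists q => //; apply: h1.
Qed.

Lemma nearp_nontrivial2 p (A B : X -> Prop) : nearp p (fun q => q != p -> A q) ->
  nearp p (fun q => q != p -> B q) -> exists q, [/\ q != p, A q & B q].
Proof.
move=> hA hB; have [|q qp [h1 h2]] := @nearp_nontrivial p (fun q => A q /\ B q).
  by apply: nearp_imp (nearp_and hA hB) => q [h1 h2] qp; split; [apply: h1|apply: h2].
by exists q.
Qed.

End Charts.

(** * Continuity, compactness and connectedness of the surface; the hyperelliptic involution *)

Section Topology.
Variables (R : realType) (g : nat) (e : seq R[i]).
Context {hyp : hyperelliptic g e}.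
Notation C := R[i].
Notation X := (surface g e).
Implicit Types (p q : X) (u v : C) (F G : X -> C).

Definition cont p F := forall r : R, 0 < r -> nearp p (fun q => normc (F q - F p) < r).

Lemma cont_cst p (c : C) : cont p (fun _ => c).
Proof. by move=> r r0; apply: nearp_all => q; rewrite subrr normc0. Qed.

Lemma contM p F G : cont p F -> cont p G -> cont p (fun q => F q * G q).
Proof.
move=> hF hG r r0.
pose K := normc (F p) + normc (G p) + 1.
have K0 : 0 < K by rewrite ltr_wpDl // addr_ge0 ?normc_ge0.
pose d := Num.min 1 (r / (2 * K)).
have d0 : 0 < d by rewrite lt_min ltr01 divr_gt0 ?mulr_gt0.
apply: nearp_imp (nearp_and (hF _ d0) (hG _ d0)) => q [h1 h2].
have -> : F q * G q - F p * G p = (F q - F p) * (G q - G p) +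
  F p * (G q - G p) + (F q - F p) * G p by ring.
apply: le_lt_trans (le_normcD _ _) _.
apply: le_lt_trans (lerD (le_normcD _ _) (lexx _)) _; rewrite !normcM.
set x := normc (F q - F p) in h1 *; set y := normc (G q - G p) in h2 *.
have x0 : 0 <= x by exact: normc_ge0.
have y0 : 0 <= y by exact: normc_ge0.
have a0 := normc_ge0 (F p); have b0 := normc_ge0 (G p).
have d1 : d <= 1 by rewrite ge_min lexx.
have dr : d * (2 * K) <= r.
  by rewrite -ler_pdivlMr ?mulr_gt0 // ge_min lexx orbT.
have xy : x * y <= d.
  by have := ler_pM x0 y0 (ltW h1) (ltW h2); nra.
have ay : normc (F p) * y <= normc (F p) * d by rewrite ler_wpM2l // ltW.
have bx : x * normc (G p) <= d * normc (G p) by rewrite ler_wpM2r // ltW.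
rewrite /K in dr K0; nra.
Qed.

Lemma contX p F n : cont p F -> cont p (fun q => F q ^+ n).
Proof.
move=> hF; elim: n => [|n IH]; first exact: cont_cst.
by under [X in cont p X]eq_fun do rewrite exprS; exact: contM.
Qed.

Lemma contV p F : F p != 0 -> cont p F -> cont p (fun q => (F q)^-1).
Proof.
rewrite -normc_gt0 => F0 hF r r0.
set a := normc (F p) in F0.
pose d := Num.min (a / 2) (r * (a * a) / 2).
have d0 : 0 < d by rewrite lt_min !divr_gt0 ?mulr_gt0.
have da : d <= a / 2 by rewrite ge_min lexx.
have dr : d <= r * (a * a) / 2 by rewrite ge_min lexx orbT.
apply: nearp_imp (hF _ d0) => q h.
have Fp : F p != 0 by rewrite -normc_gt0.
have hq : a / 2 < normc (F q).
  have := normc_triangle (F p) 0 (F q); rewrite !subr0 -/a normcB; lra.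
have Fq : F q != 0 by rewrite -normc_gt0; lra.
have -> : (F q)^-1 - (F p)^-1 = (F p - F q) / (F q * F p).
  by field; rewrite Fp Fq.
rewrite normcM normcV normcM -/a normcB ltr_pdivrMr; last first.
  by rewrite mulr_gt0 //; lra.
apply: lt_le_trans h _; apply: le_trans dr _.
have -> : r * (a * a) / 2 = r * (a / 2 * a) by ring.
by rewrite ler_pM2l // ler_wpM2r // ltW.
Qed.

(** Charts change only for an affine [q] in the chart of a point at infinity, where the transition
    is (x, y) -> (1/x, y / x ^ (g+1)). *)
Lemma cont_chart p q : chart_dom p q -> cont q (chart_u p) /\ cont q (chart_v p).
Proof.
have cu p0 : cont p0 (chart_u p0).
  by move=> r r0; exists r.
have cv p0 : cont p0 (chart_v p0).
  by move=> r r0; exists r.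
case hp : (val p) => [[a b]|c]; case hq : (val q) => [[x y]|v];
  rewrite /chart_dom hp hq // => x0.
- have -> : chart_u p = chart_u q by apply/funext => z; rewrite /chart_u hp hq.
  by have -> : chart_v p = chart_v q by apply/funext => z; rewrite /chart_v hp hq.
- have domq : nearp q (chart_dom q) := nearp_dom q.
  have hu z : chart_dom q z -> chart_u p z = (chart_u q z)^-1.
    by rewrite /chart_dom /chart_u hp hq; case: (val z) => [[]|].
  have hv z : chart_dom q z -> chart_v p z = chart_v q z * ((chart_u q z)^-1) ^+ g.+1.
    by rewrite /chart_dom /chart_u /chart_v hp hq; case: (val z) => [[? ?]|] //; rewrite exprVn.
  have q0 : chart_u q q != 0 by rewrite /chart_u hq.
  split=> r r0.
    have := contV q0 (cu q) r0 => h.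
    apply: nearp_imp (nearp_and domq h) => z [h1 h2].
    by rewrite !hu // chart_domxx.
  have := contM (cv q) (contX g.+1 (contV q0 (cu q))) r0 => h.
  apply: nearp_imp (nearp_and domq h) => z [h1 h2].
  by rewrite !hv // chart_domxx.
- have -> : chart_u p = chart_u q by apply/funext => z; rewrite /chart_u hp hq.
  by have -> : chart_v p = chart_v q by apply/funext => z; rewrite /chart_v hp hq.
Qed.

Lemma nearp_chart_dom p q : chart_dom p q -> nearp q (chart_dom p).
Proof.
case hp : (val p) => [[a b]|c]; case hq : (val q) => [[x y]|v];
  rewrite {1}/chart_dom hp hq // => x0.
- by apply: nearp_imp (nearp_dom q) => z; rewrite /chart_dom hp hq.
- have [|h _] := @cont_chart q q; first exact: chart_domxx.
  have := h (normc x); rewrite normc_gt0 => /(_ x0).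
  apply: (fun h1 => nearp_imp h1) => z; rewrite /chart_u /chart_dom hq hp.
  case: (val z) => [[x' y']|w] //.
  by apply: contraTneq => ->; rewrite sub0r normcN ltxx.
- by apply: nearp_imp (nearp_dom q) => z; rewrite /chart_dom hp hq.
Qed.

Lemma nearp_nearp p (A : X -> Prop) : nearp p A -> nearp p (fun q => nearp q A).
Proof.
move=> [r r0 h]; exists r => // q hq h1 h2.
have [cu cv] := cont_chart hq.
have h1' : 0 < r - normc (chart_u p q - chart_u p p) by rewrite subr_gt0.
have h2' : 0 < r - normc (chart_v p q - chart_v p p) by rewrite subr_gt0.
apply: nearp_imp (nearp_and (nearp_chart_dom hq) (nearp_and (cu _ h1') (cv _ h2'))).
move=> z [hz [k1 k2]]; apply: h => //.
  by have := normc_triangle (chart_u p z) (chart_u p p) (chart_u p q); lra.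
by have := normc_triangle (chart_v p z) (chart_v p p) (chart_v p q); lra.
Qed.

Lemma cont_local_coord p : nearp p (fun q => cont q (local_coord p)).
Proof.
apply: nearp_imp (nearp_dom p) => q hq r r0.
have [cu cv] := cont_chart hq.
apply: nearp_imp (nearp_and (nearp_chart_dom hq) (nearp_and (cu _ r0) (cv _ r0))).
move=> z [hz [k1 k2]]; rewrite !local_coordE // /curve_coord.
by case: ifP => // _; rewrite opprB addrA subrK.
Qed.

Lemma nearp_neq p q : p != q -> nearp p (fun z => z != q).
Proof.
move=> pq; have [hq|hq] := boolP (chart_dom p q); last first.
  by apply: nearp_imp (nearp_dom p) => z; apply: contraTneq => ->.
have [huq|huq] := eqVneq (chart_u p q) (chart_u p p); last first.
  rewrite -subr_eq0 -normc_gt0 in huq.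
  by exists (normc (chart_u p q - chart_u p p)) => // z _ h _; apply: contraTneq h => ->; rewrite ltxx.
have hvq : chart_v p q != chart_v p p.
  apply: contra_neq pq => h; apply: (chart_inj (chart_domxx p) hq) => //; exact: esym.
rewrite -subr_eq0 -normc_gt0 in hvq.
by exists (normc (chart_v p q - chart_v p p)) => // z _ _ h; apply: contraTneq h => ->; rewrite ltxx.
Qed.

Lemma mk_affine (x y : C) : y ^+ 2 = (defining_poly e).[x] -> {q : X | val q = inl (x, y)}.
Proof.
move=> h; have hq : on_surface g e (inl (x, y)) by apply/eqP.
by exists (exist (on_surface g e) _ hq).
Qed.

Lemma mk_infinite (c : C) : c ^+ 2 = (defining_poly e)`_(g.*2.+2) ->
  {q : X | val q = inr c}.
Proof.
move=> h; have hq : on_surface g e (inr c) by apply/eqP.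
by exists (exist (on_surface g e) _ hq).
Qed.

Definition over (A : set C) q : Prop := if val q is inl (x, _) then A x else False.

(** Properness of the projection: neighborhoods of the two points over [a], which coincide over a
    branch point, contain the whole preimage of a disc. Compactness and connectedness of the surface
    are thereby reduced to statements about the plane. *)
Lemma affine_fibre (a : C) : exists p p', [/\ exists y, val p = inl (a, y),
   exists y, val p' = inl (a, y) &
   forall A : X -> Prop, nearp p A -> nearp p' A -> exists2 d : R, 0 < d &
     forall q, over [set x | normc (x - a) < d] q -> A q].
Proof.
have [b hb] := @closed_root R (defining_poly e).[a] 2 isT.
have hb' : (- b) ^+ 2 = (defining_poly e).[a] by rewrite sqrrN.
have [p hp] := mk_affine hb; have [p' hp'] := mk_affine hb'.
exists p, p'; split; [by exists b|by exists (- b)|move=> A [r r0 h] [r' r0' h']].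
have m0 : 0 < Num.min r r' by rewrite lt_min r0.
have [d d0 hd] := curve_fibre hb m0.
exists (Num.min d (Num.min r r')); first by rewrite lt_min d0.
move=> q; rewrite /over; case hq : (val q) => [[x y]|//] /=.
rewrite !lt_min => /and3P[xd xr xr'].
have hy : y ^+ 2 = (defining_poly e).[x] by apply/eqP; have := valP q; rewrite hq.
have [] := hd x y xd hy; rewrite lt_min => /andP[yr yr'].
  by apply: h; rewrite /chart_dom /chart_u /chart_v hp hq.
by apply: h'; rewrite /chart_dom /chart_u /chart_v hp' hq // opprK.
Qed.

(** Properness over infinity: the neighborhoods contain every point at infinity and all points with
    x large. *)
Lemma infinite_fibre : exists p p', [/\ exists c, val p = inr c,
   exists c, val p' = inr c &
   forall A : X -> Prop, nearp p A -> nearp p' A -> exists2 M : R, 0 < M &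
     forall q, ~ over [set x | normc x <= M] q -> A q].
Proof.
have [c hc] := @closed_root R ((defining_poly e)`_(g.*2.+2)) 2 isT.
have hc' : (- c) ^+ 2 = (defining_poly e)`_(g.*2.+2) by rewrite sqrrN.
have [p hp] := mk_infinite hc; have [p' hp'] := mk_infinite hc'.
exists p, p'; split; [by exists c|by exists (- c)|move=> A [r r0 h] [r' r0' h']].
have m0 : 0 < Num.min r r' by rewrite lt_min r0.
have hc2 : c ^+ 2 = (inf_poly g e).[0] by rewrite inf_poly0.
have [d d0 hd] := curve_fibre hc2 m0.
pose s := Num.min d (Num.min r r').
have s0 : 0 < s by rewrite lt_min d0.
exists s^-1; first by rewrite invr_gt0.
move=> q hq; have hdom : chart_dom p q.
  move: hq; rewrite /over /chart_dom hp; case: (val q) => [[x y]|//] /= hx.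
  apply/negP => /eqP x0; apply: hx; rewrite x0 normc0 invr_ge0; exact: ltW.
have hu : normc (chart_u p q - chart_u p p) < s.
  move: hq hdom; rewrite /over /chart_dom /chart_u hp.
  case: (val q) => [[x y]|v] /=; last by rewrite !subr0 expr0n addr0 sqrtr0.
  move=> /negP; rewrite -ltNge => hx x0; rewrite subr0 normcV.
  by rewrite -[s]invrK ltf_pV2 // posrE ?normc_gt0 // invr_gt0.
have hv : chart_v p q ^+ 2 = (chart_poly p).[chart_u p q] .
  exact: chart_curve.
move: hu; rewrite /s !lt_min => /and3P[ud ur ur'].
have e0 : chart_u p p = 0 by rewrite /chart_u hp.
have e1 : chart_poly p = inf_poly g e by rewrite /chart_poly hp.
rewrite e0 in ud; rewrite e1 in hv.
have ep z : chart_dom p' z = chart_dom p z by rewrite /chart_dom hp hp'.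
have eu z : chart_u p' z = chart_u p z by rewrite /chart_u hp hp'.
have ev z : chart_v p' z = chart_v p z by rewrite /chart_v hp hp'.
have epp : chart_u p' p' = 0 by rewrite /chart_u hp'.
have vp : chart_v p p = c by rewrite /chart_v hp.
have vp' : chart_v p' p' = - c by rewrite /chart_v hp'.
have [] := hd _ _ ud hv; rewrite lt_min => /andP[vr vr'].
  by apply: h; rewrite ?vp.
apply: h'; first by rewrite ep.
  by rewrite eu epp -e0.
by rewrite ev vp' opprK.
Qed.

(* Compactness, as an induction principle on subsets. *)
Lemma surface_cover (P : set X -> Prop) :
  (forall A B, A `<=` B -> P B -> P A) ->
  (forall A B, P A -> P B -> P (A `|` B)) ->
  (forall p, exists2 A, P A & nearp p A) -> P setT.
Proof.
move=> hsub hU hloc.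
have [p [p' [_ _ hM]]] := infinite_fibre.
have [A PA pA] := hloc p; have [A' PA' pA'] := hloc p'.
have [M M0 hM'] := hM (A `|` A') (nearp_imp (fun _ h => or_introl h) pA)
  (nearp_imp (fun _ h => or_intror h) pA').
suff h : P (over [set x | normc x <= M]).
  apply: hsub (hU _ _ (hU _ _ PA PA') h) => q _.
  have [hq|hq] := pselect (over [set x | normc x <= M] q); first by right.
  by left; apply: hM'.
apply: (@disc_cover R (fun B => P (over B))).
- by move=> B B' BB'; apply: hsub => q; rewrite /over; case: (val q) => [[x y]|//]; exact: BB'.
- move=> B B' h h'; apply: hsub (hU _ _ h h') => q; rewrite /over /setU /=.
  by case: (val q) => [[x y]|v].
move=> a; have [q [q' [_ _ hd]]] := affine_fibre a.
have [B PB qB] := hloc q; have [B' PB' qB'] := hloc q'.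
have [d d0 hd'] := hd (B `|` B') (nearp_imp (fun _ h => or_introl h) qB)
  (nearp_imp (fun _ h => or_intror h) qB').
by exists d => //; apply: hsub (hU _ _ PB PB').
Qed.

Definition iota_val (q : (C * C) + C) : (C * C) + C :=
  match q with inl (x, y) => inl (x, - y) | inr v => inr (- v) end.

Lemma iota_subproof q : on_surface g e (iota_val (val q)).
Proof. by case: q => [[[x y]|v] h] /=; rewrite sqrrN. Qed.

Definition iota q : X := exist (on_surface g e) _ (iota_subproof q).

Lemma iotaK : involutive iota.
Proof. by move=> q; apply: val_inj => /=; case: (val q) => [[x y]|v] /=; rewrite opprK. Qed.

Lemma iota_dom p q : chart_dom (iota p) (iota q) = chart_dom p q.
Proof. by rewrite /chart_dom /=; case: (val p) => [[a b]|c]; case: (val q) => [[x y]|v]. Qed.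

Lemma iota_u p q : chart_u (iota p) (iota q) = chart_u p q.
Proof. by rewrite /chart_u /=; case: (val p) => [[a b]|c]; case: (val q) => [[x y]|v]. Qed.

Lemma iota_v p q : chart_v (iota p) (iota q) = - chart_v p q.
Proof.
rewrite /chart_v /=; case: (val p) => [[a b]|c]; case: (val q) => [[x y]|v] //=.
  by rewrite oppr0.
by rewrite mulNr.
Qed.

Lemma nearp_iota p (A : X -> Prop) : nearp p A -> nearp (iota p) (fun q => A (iota q)).
Proof.
move=> [r r0 h]; exists r => // q; rewrite -[q]iotaK iota_dom !iota_u !iota_v.
by move=> h1 h2; rewrite -opprD normcN iotaK => h3; apply: h.
Qed.

Lemma branch_point_exists : exists b, iota b = b.
Proof.
have [a ae] : exists a, a \in e.
  by case: e hyp => [[_ []]//|a s] _; exists a; rewrite mem_head.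
have h : (0 : C) ^+ 2 = (defining_poly e).[a].
  by rewrite expr0n; apply/esym/rootP; rewrite root_prod_XsubC.
have [b hb] := mk_affine h; exists b; apply: val_inj.
by rewrite /= hb /= oppr0.
Qed.

Lemma iota_same_x p q (x y y' : C) : val p = inl (x, y) -> val q = inl (x, y') ->
  q = p \/ q = iota p.
Proof.
move=> hp hq; have := valP p; have := valP q; rewrite hp hq /= => /eqP <-.
rewrite eqf_sqr => /orP[/eqP h|/eqP h]; [left|right]; apply: val_inj.
  by rewrite hp hq h.
by rewrite /= hp hq /= h opprK.
Qed.

Lemma iota_same_inf p q (c c' : C) : val p = inr c -> val q = inr c' ->
  q = p \/ q = iota p.
Proof.
move=> hp hq; have := valP p; have := valP q; rewrite hp hq /= => /eqP <-.
rewrite eqf_sqr => /orP[/eqP h|/eqP h]; [left|right]; apply: val_inj.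
  by rewrite hp hq h.
by rewrite /= hp hq /= h opprK.
Qed.

(** The fibres of the projection are orbits of [iota], so an invariant predicate descends to the
    plane of x; a point at infinity is compared with an affine point close to it. *)
Lemma connected_invariant (Q : X -> Prop) : (forall q, Q (iota q) <-> Q q) ->
  (forall p, nearp p (fun q => Q q <-> Q p)) -> forall p q, Q p -> Q q.
Proof.
move=> hi hQ.
have aff p (x y : C) : val p = inl (x, y) ->
    forall q (x' y' : C), val q = inl (x', y') -> Q p -> Q q.
  move=> hp q x' y' hq Qp.
  pose Q' z := forall q, over [set z] q -> Q q.
  suff : Q' x' by apply; rewrite /over hq.
  apply: (@locally_constant_plane R Q' _ x).
    move=> z; have [s [s' [[ys hs] [ys' hs'] hd]]] := affine_fibre z.
    have ss' : Q s' <-> Q s by case: (iota_same_x hs hs') => ->; rewrite ?hi.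
    have [d d0 hd'] := hd (fun q => Q q <-> Q s) (hQ s)
       (nearp_imp (fun q h => iff_trans h ss') (hQ s')).
    exists d => // w w' hw hw' Qw t ht.
    have [y0 hy0] := @closed_root R (defining_poly e).[w] 2 isT.
    have [t0 ht0] := mk_affine hy0.
    have h0 : over [set w] t0 by rewrite /over ht0.
    have h1 : Q t0 <-> Q s by apply: hd'; rewrite /over ht0.
    have h2 : Q t <-> Q s.
      by apply: hd'; move: ht; rewrite /over; case: (val t) => [[a b]|//] /= ->.
    by apply/h2/h1/Qw.
  move=> t; rewrite /over; case ht : (val t) => [[a b]|//] /= ax.
  rewrite ax in ht.
  by case: (iota_same_x hp ht) => ->; rewrite ?hi.
have inf p : exists q, (exists x y, val q = inl (x, y)) /\ (Q p <-> Q q).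
  case hp : (val p) => [[x y]|c]; first by exists p; split=> //; exists x, y.
  have [r r0 hr] := hQ p.
  have [d d0 hd] := curve_lift (chart_curve (chart_domxx p)) r0.
  have u0 : chart_u p p = 0 by rewrite /chart_u hp.
  pose z := (Num.min d r / 2)%:C%C : C.
  have m0 : 0 < Num.min d r / 2 by rewrite divr_gt0 // lt_min d0.
  have nz : normc z = Num.min d r / 2 by rewrite normcR gtr0_norm.
  have z0 : z != 0 by rewrite -normc_gt0 nz.
  have zd : normc z < d.
    have : Num.min d r <= d by rewrite ge_min lexx.
    by rewrite nz; lra.
  have zr : normc z < r.
    have : Num.min d r <= r by rewrite ge_min lexx orbT.
    by rewrite nz; lra.
  have [|v hv vr] := hd z; first by rewrite u0 subr0.
  have [q [hq hqu hqv]] := chart_surj hv; exists q; split; last first.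
    apply: iff_sym; apply: hr => //; first by rewrite hqu u0 subr0.
    by rewrite hqv.
  move: hqu; rewrite /chart_u hp; case: (val q) => [[x y] _|w h0]; first by exists x, y.
  by move: z0; rewrite -h0 eqxx.
move=> p q; have [p' [[x [y hp']] ->]] := inf p; have [q' [[x' [y' hq']] ->]] := inf q.
exact: aff hp' _ _ _ hq'.
Qed.

(* [Q /\ Q \o iota] and [Q \/ Q \o iota] descend to the sphere, hence are
   constant, and they agree at a branch point. *)
Lemma surface_connected (Q : X -> Prop) :
  (forall p, nearp p (fun q => Q q <-> Q p)) -> forall p q, Q p -> Q q.
Proof.
move=> hQ p q Qp; have [b hb] := branch_point_exists.
have h2 p0 : nearp p0 (fun q => (Q q <-> Q p0) /\ (Q (iota q) <-> Q (iota p0))).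
  apply: nearp_and (hQ p0) _.
  by have := nearp_iota (hQ (iota p0)); rewrite iotaK.
have : Q b \/ Q (iota b).
  apply: (@connected_invariant (fun q => Q q \/ Q (iota q)) _ _ p); last by left.
  - by move=> z; rewrite iotaK; split=> -[]; [right|left|right|left].
  - by move=> z; apply: nearp_imp (h2 z) => w [-> ->].
rewrite hb => -[] Qb;
  suff [] : Q q /\ Q (iota q) by [].
  apply: (@connected_invariant (fun q => Q q /\ Q (iota q)) _ _ b); last by rewrite hb.
  - by move=> z; rewrite iotaK; split=> -[].
  - by move=> z; apply: nearp_imp (h2 z) => w [-> ->].
apply: (@connected_invariant (fun q => Q q /\ Q (iota q)) _ _ b); last by rewrite hb.
- by move=> z; rewrite iotaK; split=> -[].
- by move=> z; apply: nearp_imp (h2 z) => w [-> ->].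
Qed.

End Topology.

(** * Laurent expansions, orders and the identity theorem *)

Section LaurentExpansions.
Variables (R : realType) (g : nat) (e : seq R[i]).
Context {hyp : hyperelliptic g e}.
Notation C := R[i].
Notation X := (surface g e).
Implicit Types (p q : X) (F G : X -> C) (a b : nat -> C) (n m : int).

Definition expands p F a := nearp p (fun q => q != p ->
  pseries_sum a (local_coord p q) (F q)).

Lemma laurentE p F n a :
  laurent p F n a <-> expands p (fun q => F q / local_coord p q ^ n) a.
Proof. exact: nearpP. Qed.

Lemma expands_eq p F G a : nearp p (fun q => q != p -> F q = G q) ->
  expands p F a -> expands p G a.
Proof.
move=> h h'; apply: nearp_imp (nearp_and h h') => q [h1 h2] qp.
by rewrite -h1 //; apply: h2.
Qed.

Lemma expands_regular p F a : expands p F a -> regular a.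
Proof.
move=> h; have [q [_ h1 h2]] := nearp_nontrivial2 h (local_coord_neq0 p).
exact: pseries_regular h2 h1.
Qed.

Lemma expands_add p F G a b : expands p F a -> expands p G b ->
  expands p (fun q => F q + G q) (fun j => a j + b j).
Proof.
move=> h h'; apply: nearp_imp (nearp_and h h') => q [h1 h2] qp.
exact: pseries_add (h1 qp) (h2 qp).
Qed.

Lemma expands_scale p F a (c : C) : expands p F a ->
  expands p (fun q => c * F q) (fun j => c * a j).
Proof. by apply: nearp_imp => q h qp; apply: pseries_scale (h qp). Qed.

Lemma expands_mul p F G a b : expands p F a -> expands p G b ->
  expands p (fun q => F q * G q) (cauchy_prod a b).
Proof.
move=> h h'.
have [r [M [M' [r0 ha hb]]]] := regular_common (expands_regular h) (expands_regular h').
have r4 : 0 < r / 4 by rewrite divr_gt0.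
apply: nearp_imp (nearp_and (nearp_and h h') (local_coord_small p r4)).
move=> q [[h1 h2] h3] qp.
exact: pseries_prod r0 ha hb (ltW h3) (h1 qp) (h2 qp).
Qed.

Lemma expands_inv p F a : a 0%N != 0 -> expands p F a ->
  expands p (fun q => (F q)^-1) (series_inv a).
Proof.
move=> a0 h; have [d [d0 hd]] := pseries_inv (expands_regular h) a0.
apply: nearp_imp (nearp_and h (local_coord_small p d0)) => q [h1 h2] qp.
exact: hd h2 (h1 qp).
Qed.

Lemma expands_neq0 p F a : (exists j, a j != 0) -> expands p F a ->
  nearp p (fun q => q != p -> F q != 0).
Proof.
move=> a0 h; have [d [d0 hd]] := pseries_isolated_zero (expands_regular h) a0.
apply: nearp_imp (nearp_and (nearp_and h (local_coord_small p d0)) (local_coord_neq0 p)).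
move=> q [[h1 h2] h3] qp; exact: hd (h3 qp) h2 (h1 qp).
Qed.

Lemma expands_near p F a : expands p F a -> forall r : R, 0 < r ->
  nearp p (fun q => q != p -> normc (F q - a 0%N) < r).
Proof.
move=> h r r0; have [s [M [s0 hs]]] := expands_regular h.
have s4 : 0 < s / 4 by rewrite divr_gt0.
have M0 := bounded_at_ge0 hs.
pose K := 8 * M / s + 1.
have K0 : 0 < K by rewrite ltr_wpDl // divr_ge0 ?mulr_ge0 // ltW.
have rK : 0 < r / K by rewrite divr_gt0.
apply: nearp_imp (nearp_and h (nearp_and (local_coord_small p s4) (local_coord_small p rK))).
move=> q [h1 [h2 h3]] qp.
apply: le_lt_trans (pseries_near0 s0 hs (ltW h2) (h1 qp)) _.
rewrite ltr_pdivlMr // in h3; apply: le_lt_trans h3.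
by rewrite mulrC ler_wpM2l ?normc_ge0 // /K lerDl.
Qed.

Lemma expands_zero p F a : nearp p (fun q => q != p -> F q = 0) ->
  expands p F a -> forall j, a j = 0.
Proof.
move=> h h' j; apply/eqP/negPn/negP => aj.
have [q [_ h1 h2]] := nearp_nontrivial2 h (expands_neq0 (ex_intro _ j aj) h').
by rewrite h1 eqxx in h2.
Qed.

Lemma expands_unique p F a b : expands p F a -> expands p F b -> a = b.
Proof.
move=> h h'; apply/funext => j.
have := expands_add h (expands_scale (-1) h') => h1.
have := expands_zero _ h1; rewrite /= => h2.
apply/eqP; rewrite -subr_eq0 -mulN1r; apply/eqP/h2.
by apply: nearp_all => q _; rewrite mulN1r subrr.
Qed.

Lemma expands_cst p (c : C) : expands p (fun _ => c) (fun j => (c%:P)`_j).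
Proof.
by apply: nearp_all => q _; have := pseries_poly c%:P (local_coord p q); rewrite hornerC.
Qed.

(** The coefficients of z ^ d times the series. *)
Definition delay d a j : C := if (j < d)%N then 0 else a (j - d)%N.

Lemma expands_delay p F a d : expands p F a ->
  expands p (fun q => F q * local_coord p q ^+ d) (delay d a).
Proof.
elim: d => [|d IH] h.
  have -> : delay 0 a = a by apply/funext => j; rewrite /delay subn0.
  by apply: expands_eq h; apply: nearp_all => q _; rewrite mulr1.
apply: nearp_imp (nearp_and (IH h) (local_coord_neq0 p)) => q [h1 h2] qp.
apply/(pseries_tail _ _ (h2 qp)).
have -> : (fun j => delay d.+1 a j.+1) = delay d a.
  by apply/funext => j; rewrite /delay ltnS subSS.
have -> : (F q * local_coord p q ^+ d.+1 - delay d.+1 a 0) / local_coord p q =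
    F q * local_coord p q ^+ d.
  by rewrite /delay /= subr0 exprSr mulrA mulfK // h2.
exact: h1.
Qed.

Lemma expands_drop p F a d : (forall j, (j < d)%N -> a j = 0) -> expands p F a ->
  expands p (fun q => F q / local_coord p q ^+ d) (fun j => a (d + j)%N).
Proof.
elim: d => [|d IH] ha h.
  by apply: expands_eq h; apply: nearp_all => q _; rewrite expr0 divr1.
have {}IH := IH (fun j hj => ha j (leqW hj)) h.
apply: nearp_imp (nearp_and IH (local_coord_neq0 p)) => q [h1 h2] qp.
have := proj1 (pseries_tail _ _ (h2 qp)) (h1 qp).
have -> : (F q / local_coord p q ^+ d - a (d + 0)%N) / local_coord p q =
    F q / local_coord p q ^+ d.+1.
  by rewrite addn0 ha // subr0 exprS invfM mulrA mulrAC.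
have -> : (fun j => a (d + j.+1)%N) = (fun j => a (d.+1 + j)%N).
  by apply/funext => j; rewrite addSnnS.
exact.
Qed.

Definition mero p F := exists n a, laurent p F n a.

Lemma nearp_coord p (Q : X -> Prop) :
  (forall q, q != p -> local_coord p q != 0 -> Q q) -> nearp p (fun q => q != p -> Q q).
Proof.
by move=> h; apply: nearp_imp (local_coord_neq0 p) => q h' qp; apply: h (h' qp).
Qed.

Lemma laurent_delay p F n a (d : nat) : laurent p F n a ->
  laurent p F (n - d%:Z) (delay d a).
Proof.
move=> /laurentE /(expands_delay d) h; apply/laurentE; apply: expands_eq h.
by apply: nearp_coord => q qp z0; rewrite expfzDr // -invr_expz invfM invrK mulrA.
Qed.

Lemma laurent_drop p F n a (d : nat) : (forall j, (j < d)%N -> a j = 0) ->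
  laurent p F n a -> laurent p F (n + d%:Z) (fun j => a (d + j)%N).
Proof.
move=> ha /laurentE /(expands_drop ha) h; apply/laurentE; apply: expands_eq h.
by apply: nearp_coord => q qp z0; rewrite expfzDr // invfM mulrA.
Qed.

Lemma laurent_eq p F G n a : nearp p (fun q => q != p -> F q = G q) ->
  laurent p F n a -> laurent p G n a.
Proof.
move=> h /laurentE h'; apply/laurentE; apply: expands_eq h'.
by apply: nearp_imp h => q h qp; rewrite h.
Qed.

Lemma laurent_add p F G n a b : laurent p F n a -> laurent p G n b ->
  laurent p (fun q => F q + G q) n (fun j => a j + b j).
Proof.
move=> /laurentE h /laurentE h'; apply/laurentE; apply: expands_eq (expands_add h h').
by apply: nearp_all => q _; rewrite mulrDl.
Qed.

Lemma laurent_mul p F G n m a b : laurent p F n a -> laurent p G m b ->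
  laurent p (fun q => F q * G q) (n + m) (cauchy_prod a b).
Proof.
move=> /laurentE h /laurentE h'; apply/laurentE; apply: expands_eq (expands_mul h h').
by apply: nearp_coord => q qp z0; rewrite expfzDr // invfM mulrACA.
Qed.

Lemma laurent_unique p F n a b : laurent p F n a -> laurent p F n b -> a = b.
Proof. by move=> /laurentE h /laurentE; apply: expands_unique. Qed.

Lemma laurent_cst p (c : C) : laurent p (fun _ => c) 0 (fun j => (c%:P)`_j).
Proof.
apply/laurentE; apply: expands_eq (expands_cst p c).
by apply: nearp_all => q _; rewrite expr0z divr1.
Qed.

Lemma laurent0 p F a : laurent p F 0 a <-> expands p F a.
Proof.
split=> [/laurentE|] h; [|apply/laurentE]; apply: expands_eq h;
  by apply: nearp_all => q _; rewrite expr0z divr1.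
Qed.

Lemma mero_cst p (c : C) : mero p (fun _ => c).
Proof. by exists 0, (fun j => (c%:P)`_j); apply: laurent_cst. Qed.

Lemma mero_add p F G : mero p F -> mero p G -> mero p (fun q => F q + G q).
Proof.
move=> [n [a ha]] [m [b hb]]; wlog nm : n m F G a b ha hb / n <= m.
  move=> h; case: (leP n m) => [nm|/ltW mn]; first exact: h ha hb nm.
  have [k [c hc]] := h _ _ _ _ _ _ hb ha mn; exists k, c.
  by apply: laurent_eq hc; apply: nearp_all => q _; rewrite addrC.
have [d hd] : exists d : nat, n = m - d%:Z.
  exists `|m - n|%N; rewrite gez0_abs ?subr_ge0 // opprB addrC subrK //.
exists n; exists (fun j => a j + delay d b j); apply: laurent_add ha _.
by rewrite hd; apply: laurent_delay hb.
Qed.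

Lemma has_order_mero p F n : has_order p F n -> mero p F.
Proof. by move=> [a _ h]; exists n, a. Qed.

Lemma has_order_eq p F G n : nearp p (fun q => q != p -> F q = G q) ->
  has_order p F n -> has_order p G n.
Proof. by move=> h [a a0 ha]; exists a; [exact: a0|exact: laurent_eq h ha]. Qed.

Lemma has_orderM p F G n m : has_order p F n -> has_order p G m ->
  has_order p (fun q => F q * G q) (n + m).
Proof.
move=> [a a0 ha] [b b0 hb]; exists (cauchy_prod a b); last exact: laurent_mul.
by rewrite /cauchy_prod big_ord1 subn0 mulf_neq0.
Qed.

Lemma has_orderV p F n : has_order p F n -> has_order p (fun q => (F q)^-1) (- n).
Proof.
move=> [a a0 /laurentE ha]; exists (series_inv a).
  by rewrite series_invE big_ord0 subr0 mulr1 invr_neq0.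
apply/laurentE; apply: expands_eq (expands_inv a0 ha).
by apply: nearp_coord => q qp z0; rewrite invfM -invr_expz.
Qed.

Lemma has_order_cst p (c : C) : c != 0 -> has_order p (fun _ => c) 0.
Proof.
by move=> c0; exists (fun j => (c%:P)`_j); [rewrite coefC|apply: laurent_cst].
Qed.

Lemma has_orderX p F n (k : nat) : has_order p F n ->
  has_order p (fun q => F q ^+ k) (n *+ k).
Proof.
move=> h; elim: k => [|k IH].
  exact: has_order_cst (oner_neq0 _).
rewrite mulrS; apply: has_order_eq (has_orderM h IH).
by apply: nearp_all => q _; rewrite exprS.
Qed.

Lemma has_order_unique p F n m : has_order p F n -> has_order p F m -> n = m.
Proof.
move=> [a a0 ha] [b b0 hb]; wlog nm : n m a b a0 b0 ha hb / n <= m.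
  move=> h; case: (leP n m) => [nm|/ltW mn]; first exact: h a0 b0 ha hb nm.
  by apply: esym; apply: h b0 a0 hb ha mn.
have hd : n = m - `|m - n|%N%:Z.
  by rewrite gez0_abs ?subr_ge0 // opprB addrC subrK.
have := laurent_delay `|m - n|%N hb; rewrite -hd => /(laurent_unique ha) h.
move: a0; rewrite h /delay; case: ltnP => [_|]; first by rewrite eqxx.
by rewrite leqn0 absz_eq0 subr_eq0 => /eqP ->.
Qed.

Lemma has_order_neq0 p F n : has_order p F n -> nearp p (fun q => q != p -> F q != 0).
Proof.
move=> [a a0 /laurentE ha].
apply: nearp_imp (expands_neq0 (ex_intro _ 0%N a0) ha) => q h qp.
by apply: contra (h qp) => /eqP ->; rewrite mul0r.
Qed.

Lemma laurent_order p F n a : laurent p F n a ->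
  (exists (d : nat), has_order p F (n + d%:Z)) \/ nearp p (fun q => q != p -> F q = 0).
Proof.
move=> h; have [[j aj]|h0] := pselect (exists j, a j != 0).
  have [|d [_ ad hd]] := @first_nonzero R a 0; first by exists j.
  left; exists d, (fun j => a (d + j)%N); first by rewrite addn0.
  by apply: laurent_drop h => i hi; apply: hd.
right; have a0 : a = (fun j => (0%:P : {poly C})`_j).
  apply/funext => j; rewrite coefC if_same; apply/eqP/negPn/negP => aj.
  by apply: h0; exists j.
move: h => /laurentE; rewrite a0 => h.
apply: nearp_imp (nearp_and h (local_coord_neq0 p)) => q [h1 h2] qp.
have := pseries_unique (h1 qp) (pseries_poly 0 (local_coord p q)).
rewrite horner0 => /eqP; rewrite mulf_eq0 invr_eq0 expfz_eq0.
by rewrite (negbTE (h2 qp)) andbF orbF => /eqP.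
Qed.

Lemma mero_order p F : mero p F ->
  (exists n, has_order p F n) \/ nearp p (fun q => q != p -> F q = 0).
Proof.
by move=> [n [a /laurent_order[[d h]|h]]]; [left; exists (n + d%:Z)|right].
Qed.

Lemma nearp_punctured p (A : X -> Prop) : nearp p (fun q => q != p -> A q) ->
  nearp p (fun q => nearp q (fun z => z != q -> A z)).
Proof.
move=> h; apply: nearp_imp (nearp_nearp h) => q hq.
have [->//|qp] := eqVneq q p.
by apply: nearp_imp (nearp_and hq (nearp_neq qp)) => z [h1 h2] _; apply: h1.
Qed.

Lemma nearp_punctured_full p (A : X -> Prop) : nearp p (fun q => q != p -> A q) ->
  nearp p (fun q => q != p -> nearp q A).
Proof.
move=> h; apply: nearp_imp (nearp_nearp h) => q hq qp.
by apply: nearp_imp (nearp_and hq (nearp_neq qp)) => z [h1 h2]; apply: h1.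
Qed.

(** Zeros of a nonzero Laurent expansion are isolated, so vanishing identically near a point is a
    locally constant property, and connectedness decides. *)
Lemma identity_theorem F : (forall p, mero p F) ->
  (forall p, exists n, has_order p F n) \/
  (forall p, nearp p (fun q => q != p -> F q = 0)).
Proof.
move=> hF; pose Q p := nearp p (fun q => q != p -> F q = 0).
have dec p : ~ Q p -> nearp p (fun q => q != p -> F q != 0).
  by case: (mero_order (hF p)) => // -[n /has_order_neq0].
have hQ p : nearp p (fun q => Q q <-> Q p).
  have [Qp|nQp] := pselect (Q p).
    by apply: nearp_imp (nearp_punctured Qp) => q h; split.
  apply: nearp_imp (nearp_punctured (dec p nQp)) => q h; split=> // Qq.
  have [z [_ h1 h2]] := nearp_nontrivial2 Qq h.
  by rewrite h1 eqxx in h2.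
have [[p Qp]|hn] := pselect (exists p, Q p).
  by right=> q; apply: surface_connected hQ p q Qp.
left=> p; case: (mero_order (hF p)) => // Qp.
by case: hn; exists p.
Qed.

End LaurentExpansions.

(** * Functions without poles; divisors of meromorphic functions *)

Section GlobalFunctions.
Variables (R : realType) (g : nat) (e : seq R[i]).
Context {hyp : hyperelliptic g e}.
Notation C := R[i].
Notation X := (surface g e).
Implicit Types (p q : X) (F G : X -> C) (a b : nat -> C) (n m : int).

(** The value at [p] itself is arbitrary, so continuity can be asserted only at the other points of
    a neighborhood; there it comes from the Lipschitz estimate in the coordinate at [p]. *)
Lemma expands_cont p F a : expands p F a -> nearp p (fun q => q != p -> cont q F).
Proof.
move=> h; have [s [M [s0 hs]]] := expands_regular h.
have s4 : 0 < s / 4 by rewrite divr_gt0.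
have M0 := bounded_at_ge0 hs.
pose K := 8 * M / s + 1.
have K0 : 0 < K by rewrite ltr_wpDl // divr_ge0 ?mulr_ge0 // ltW.
pose A q := normc (local_coord p q) < s / 4 /\ pseries_sum a (local_coord p q) (F q).
have hA : nearp p (fun q => q != p -> A q).
  apply: nearp_imp (nearp_and h (local_coord_small p s4)) => q [h1 h2] qp.
  by split; [exact: h2|exact: h1].
apply: nearp_imp (nearp_and (nearp_punctured_full hA) (cont_local_coord p)).
move=> q [h1 h2] qp r r0.
have rK : 0 < r / K by rewrite divr_gt0.
have {}h1 := h1 qp; have [k1 k2] := nearp_self h1.
apply: nearp_imp (nearp_and h1 (h2 _ rK)) => z [[h3 h4] h5].
apply: le_lt_trans (pseries_lipschitz s0 hs (ltW h3) (ltW k1) h4 k2) _.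
rewrite ltr_pdivlMr // in h5; apply: le_lt_trans h5.
by rewrite mulrC ler_wpM2l ?normc_ge0 // /K lerDl.
Qed.

Lemma expands_value p F a : expands p F a -> cont p F -> F p = a 0%N.
Proof.
move=> h hc; apply/eqP; rewrite -subr_eq0 -normc_eq0 eq_le normc_ge0 andbT.
apply/ler_addgt0Pl => r r0; rewrite addr0.
have r2 : 0 < r / 2 by rewrite divr_gt0.
have hc' : nearp p (fun q => q != p -> normc (F q - F p) < r / 2).
  by apply: nearp_imp (hc _ r2) => q hq _.
have [q [_ h1 h2]] := nearp_nontrivial2 (expands_near h r2) hc'.
have := normc_triangle (F p) (a 0%N) (F q); rewrite normcB in h2; lra.
Qed.

(** By compactness a locally bounded function is bounded. If the supremum M of [f] were not
    attained, 1 / (M - f) would be bounded too, contradicting the choice of M. *)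
Lemma bounded_attained (f : X -> R) :
  (forall p r, 0 < r -> nearp p (fun q => `|f q - f p| < r)) ->
  exists p, forall q, f q <= f p.
Proof.
move=> hf; have bnd (h : X -> R) :
    (forall p, exists r, nearp p (fun q => h q <= r)) -> exists B, forall q, h q <= B.
  move=> hh; suff [B hB] : exists B, forall q, setT q -> h q <= B.
    by exists B => q; apply: hB.
  apply: (@surface_cover R g e _ (fun A => exists B, forall q, A q -> h q <= B)).
  - by move=> A A' AA' [B hB]; exists B => q /AA'; apply: hB.
  - move=> A A' [B hB] [B' hB']; exists (Num.max B B') => q.
    by rewrite le_max => -[/hB ->|/hB' ->]; rewrite ?orbT.
  by move=> p; have [r hr] := hh p; exists (fun q => h q <= r) => //; exists r.
have [b0 _] := @branch_point_exists R g e hyp.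
have hS : has_sup (range f).
  split; first by exists (f b0), b0.
  have [|B hB] := bnd f.
    move=> p; exists (f p + 1); apply: nearp_imp (hf p 1 ltr01) => q.
    by rewrite ltr_norml => /andP[_]; lra.
  by exists B => _ [q _ <-].
pose M := sup (range f).
have fM q : f q <= M by apply: sup_upper_bound => //; exists q.
have [[p hp]|hn] := pselect (exists p, f p = M); first by exists p => q; rewrite hp.
have flt q : f q < M.
  by rewrite lt_neqAle fM andbT; apply/eqP => hq; apply: hn; exists q.
have [|B hB] := bnd (fun q => (M - f q)^-1).
  move=> p; have d0 : 0 < (M - f p) / 2 by rewrite divr_gt0 // subr_gt0.
  exists (((M - f p) / 2)^-1); apply: nearp_imp (hf p _ d0) => q.
  rewrite ltr_norml => /andP[_ h]; rewrite lef_pV2 ?posrE ?subr_gt0 //; lra.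
have B0 : 0 < B by apply: lt_le_trans (hB b0); rewrite invr_gt0 subr_gt0.
have Bi : 0 < B^-1 by rewrite invr_gt0.
have [_ [q _ <-] hq] := sup_adherent Bi hS.
have := hB q; rewrite -/M in hq => h.
have : B^-1 <= M - f q.
  by rewrite -[M - f q]invrK lef_pV2 ?posrE // invr_gt0 subr_gt0.
lra.
Qed.

(* The points where the modulus is maximal form an open and closed set. *)
Theorem liouville F : (forall p, exists a, expands p F a) ->
  exists c : C, forall p, nearp p (fun q => q != p -> F q = c).
Proof.
move=> hF; have [A hA] := boolp.choice hF.
(* [H] removes the singularities: it is continuous and agrees with [F] on punctured
   neighborhoods. *)
pose H p := A p 0%N.
have HF p : nearp p (fun q => q != p -> H q = F q).
  apply: nearp_imp (expands_cont (hA p)) => q h qp.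
  by rewrite (expands_value (hA q) (h qp)).
have hH p : cont p H.
  move=> r r0; apply: nearp_imp (nearp_and (HF p) (expands_near (hA p) r0)).
  move=> q [h1 h2]; have [->|qp] := eqVneq q p; first by rewrite subrr normc0.
  by rewrite h1 //; apply: h2.
have [p0 hp0] : exists p, forall q, normc (H q) <= normc (H p).
  apply: bounded_attained => p r r0; apply: nearp_imp (hH p r r0) => q.
  apply: le_lt_trans; rewrite ler_norml; apply/andP; split.
    have := normc_triangle (H p) 0 (H q); rewrite !subr0 normcB; lra.
  have := normc_triangle (H q) 0 (H p); rewrite !subr0; lra.
have loc p : (forall q, normc (H q) <= normc (H p)) -> nearp p (fun q => H q = H p).
  (* Any other nonzero coefficient would produce points near [p] where the modulus is larger. *)
  move=> hp; have a0 j : A p j.+1 = 0.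
    apply/eqP/negPn/negP => aj.
    have [d d0 hd] := nearp_lift (nearp_and (HF p) (hA p)).
    have [|z [z0 zd hz]] := pseries_local_max (expands_regular (hA p)) _ d0.
      by exists j.+1.
    have [q [[h1 h2] qp qz]] := hd z z0 zd.
    have := hz (H q); rewrite h1 // -qz => /(_ (h2 qp)).
    by rewrite -h1 // ltNge hp.
  have hA' : A p = fun j => ((H p)%:P)`_j.
    by apply/funext => -[|j]; rewrite coefC //= a0.
  apply: nearp_imp (nearp_and (HF p) (hA p)) => q [h1 h2].
  have [->//|qp] := eqVneq q p; rewrite h1 //.
  move: (h2 qp); rewrite hA' => h3.
  by rewrite (pseries_unique h3 (pseries_poly _ _)) hornerC.
have hcst q : H q = H p0.
  apply: (@surface_connected R g e _ (fun q => H q = H p0) _ p0) => // p.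
  have [hp|hp] := eqVneq (H p) (H p0).
    have : nearp p (fun q => H q = H p) by apply: loc => z; rewrite hp.
    by apply: nearp_imp => z ->.
  have d0 : 0 < normc (H p - H p0) by rewrite normc_gt0 subr_eq0.
  apply: nearp_imp (hH p _ d0) => z hz; split=> [zp|/eqP]; last by rewrite (negbTE hp).
  by move: hz; rewrite zp normcB ltxx.
exists (H p0) => p; apply: nearp_imp (HF p) => q h qp.
by rewrite -h // hcst.
Qed.

(** A positive order contradicts the lower bound; a negative one is the same case for the inverse of
    [F]. *)
Lemma order_of_bounded p F n (c c' : R) : 0 < c -> has_order p F n ->
  nearp p (fun q => q != p -> c <= normc (F q) <= c') -> n = 0.
Proof.
move=> c0 hF hb.
have key G (k : nat) (b : R) : has_order p G k.+1%:Z -> 0 < b ->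
    ~ nearp p (fun q => q != p -> b <= normc (G q)).
  move=> [a _ /(laurent_delay k.+1)]; rewrite subrr => /laurent0 ha b0 hb'.
  have [q [_ h1 h2]] := nearp_nontrivial2 hb' (expands_near ha b0).
  by move: h2; rewrite /delay /= subr0 ltNge h1.
case: n hF => [[//|k]|k] hF.
  exfalso; apply: key hF c0 _; apply: nearp_imp hb => q h qp.
  by have /andP[] := h qp.
have c0' : 0 < c'.
  have [q _ /andP[h1 h2]] := nearp_nontrivial hb.
  exact: lt_le_trans c0 (le_trans h1 h2).
have ci : 0 < c'^-1 by rewrite invr_gt0.
have hV : has_order p (fun q => (F q)^-1) k.+1%:Z.
  have <- : - Negz k = k.+1%:Z by rewrite NegzE opprK.
  exact: has_orderV hF.
exfalso; apply: key hV ci _; apply: nearp_imp hb => q h qp.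
have /andP[h1 h2] := h qp.
by rewrite normcV lef_pV2 ?posrE // (lt_le_trans c0).
Qed.

(** The expansion at [p] is not re-expanded at [q]. Near [q] the function is close enough to a_0 z ^
    n to be pinched between positive constants, and an order at [q], known to exist, must then be
    0. *)
Lemma has_order_near p F n : has_order p F n ->
  (forall q, exists m, has_order q F m) -> nearp p (fun q => q != p -> has_order q F 0).
Proof.
move=> [a a0 /laurentE ha] hF.
have na0 : 0 < normc (a 0%N) by rewrite normc_gt0.
have d0 : 0 < normc (a 0%N) / 2 by rewrite divr_gt0.
have h1 := nearp_punctured_full (expands_near (hyp := hyp) ha d0).
apply: nearp_imp (nearp_and h1 (nearp_and (cont_local_coord p) (local_coord_neq0 p))).
move=> q [{}h1 [h2 h3]] qp.
set z := local_coord p q in h3; have z0 := h3 qp.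
have nz0 : 0 < normc z by rewrite normc_gt0.
have dz : 0 < normc z / 2 by rewrite divr_gt0.
have [m hm] := hF q; rewrite (_ : 0 = m) //; apply: esym.
have hz : cont q (fun w => local_coord p w ^ n).
  case: n ha h1 => k _ _; first exact: contX.
  by apply: contV; [rewrite expf_neq0|exact: contX].
have nzn : 0 < normc (z ^ n) by rewrite normc_gt0 expfz_neq0.
have dzn : 0 < normc (z ^ n) / 2 by rewrite divr_gt0.
have hB := nearp_and (h1 qp) (hz _ dzn).
pose c := normc (a 0%N) / 2 * (normc (z ^ n) / 2).
apply: (@order_of_bounded q F m c (2 * normc (a 0%N) * (2 * normc (z ^ n)))) => //.
  by rewrite /c !mulr_gt0.
apply: nearp_imp hB => w [k1 k2] _.
have hzw : normc (z ^ n) / 2 <= normc (local_coord p w ^ n) <= 2 * normc (z ^ n).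
  have := normc_triangle (z ^ n) 0 (local_coord p w ^ n).
  have := normc_triangle (local_coord p w ^ n) 0 (z ^ n).
  move: k2; rewrite -/z !subr0 [normc (z ^ n - _)]normcB => k2 k3 k4.
  by apply/andP; split; lra.
have /andP[hz1 hz2] := hzw.
have zw0 : local_coord p w ^ n != 0 by rewrite -normc_gt0; lra.
have hfw : normc (a 0%N) / 2 <= normc (F w / local_coord p w ^ n) <= 2 * normc (a 0%N).
  set f := F w / _ in k1 *.
  have := normc_triangle (a 0%N) 0 f; have := normc_triangle f 0 (a 0%N).
  move: k1; rewrite !subr0 [normc (a 0%N - _)]normcB => k1 k3 k4.
  by apply/andP; split; lra.
have /andP[hf1 hf2] := hfw.
have -> : F w = F w / local_coord p w ^ n * local_coord p w ^ n by rewrite divfK.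
rewrite [normc (_ * _)]normcM; apply/andP; split; apply: ler_pM => //;
  by rewrite ?normc_ge0 // ltW.
Qed.

(** Points of nonzero order are isolated, hence finite in number by compactness. *)
Lemma divisor_of_function F (m : X -> int) : (forall p, has_order p F (m p)) ->
  exists D : divisor g e, forall p, coeff p D = m p.
Proof.
move=> hm; have hF q : exists k, has_order q F k by exists (m q).
suff [s hs] : exists s : seq X, forall q, setT q -> m q != 0 -> q \in s.
  exists (\sum_(q <- undup s) << m q *g q >>) => p; rewrite raddf_sum /=.
  under eq_bigr do rewrite coeffU.
  have [ps|ps] := boolP (p \in undup s).
    rewrite (bigD1_seq p) ?undup_uniq //= eqxx mulr1 big1 ?addr0 // => q qp.
    by rewrite (negbTE qp) mulr0.
  rewrite big1_seq => [|q /andP[_ qs]].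
    by apply/esym/eqP; apply: contraNT ps => /hs; rewrite mem_undup => ->.
  by case: eqP qs ps => [->->//|_ _ _]; rewrite mulr0.
apply: (@surface_cover R g e _ (fun A => exists s : seq X, forall q, A q -> m q != 0 -> q \in s)).
- by move=> A B AB [s hs]; exists s => q /AB; apply: hs.
- move=> A B [s hs] [s' hs']; exists (s ++ s') => q [/hs h|/hs' h] /h;
    by rewrite mem_cat => ->; rewrite ?orbT.
move=> p; exists (fun q => q != p -> has_order q F 0); last exact: has_order_near (hm p) hF.
exists [:: p] => q hq; rewrite inE; apply: contraNT => qp.
by apply/eqP/(has_order_unique (hm q))/hq.
Qed.

End GlobalFunctions.

(** * The orders of x, y and dx *)

Section CoordinateFunctions.
Variables (R : realType) (g : nat) (e : seq R[i]).
Context {hyp : hyperelliptic g e}.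
Notation C := R[i].
Notation X := (surface g e).
Implicit Types (p q : X) (F G : X -> C) (a b : nat -> C) (n m : int).

(** The ramification index of the projection at [p]. *)
Definition ram p : nat := if iota p == p then 2 else 1.

Lemma iota_fixedE p : (iota p == p) = (chart_v p p == 0).
Proof.
have h (y : C) : (- y == y) = (y == 0).
  by rewrite eq_sym -subr_eq0 opprK -mulr2n mulrn_eq0.
rewrite -val_eqE /chart_v; case: p => [[[x y]|v] hp] /=.
  by rewrite -h; apply/eqP/eqP => [[]|->].
by rewrite -h; apply/eqP/eqP => [[]|->].
Qed.

Lemma has_order_coord p : has_order p (local_coord p) 1.
Proof.
exists (fun j => ((1 : C)%:P)`_j); first by rewrite coefC oner_neq0.
apply/laurentE; apply: expands_eq (expands_cst p 1).
by apply: nearp_coord => q qp z0; rewrite expr1z divff.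
Qed.

Lemma chart_expansion p : (exists a, expands p (chart_u p) a) /\
  (exists a, expands p (chart_v p) a).
Proof.
have [a [b [d [d0 hd]]]] := curve_expansion (chart_curve (chart_domxx p)) (@chart_simple _ _ _ hyp p).
have h : nearp p (fun q => pseries_sum a (local_coord p q) (chart_u p q) /\
   pseries_sum b (local_coord p q) (chart_v p q)).
  exists d => // q hq h1 h2; rewrite local_coordE //.
  exact: hd h1 h2 (chart_curve hq).
by split; [exists a|exists b]; apply: nearp_imp h => q [h1 h2] _.
Qed.

Lemma expands_poly p F (Q : {poly C}) : (exists a, expands p F a) ->
  exists a, expands p (fun q => Q.[F q]) a.
Proof.
move=> [a ha]; elim/poly_ind: Q => [|Q c [b hb]].
  exists (fun j => ((0 : C)%:P)`_j); apply: expands_eq (expands_cst p 0).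
  by apply: nearp_all => q _; rewrite horner0.
exists (fun j => cauchy_prod b a j + (c%:P)`_j).
apply: expands_eq (expands_add (expands_mul hb ha) (expands_cst p c)).
by apply: nearp_all => q _; rewrite hornerMXaddC.
Qed.

Lemma expands_order0 p F a : expands p F a -> cont p F -> F p != 0 -> has_order p F 0.
Proof.
move=> h hc Fp; exists a; last exact/laurent0.
by rewrite -(expands_value h hc).
Qed.

Lemma cont_u p : cont p (chart_u p).
Proof. exact: (proj1 (cont_chart (chart_domxx p))). Qed.

Lemma cont_v p : cont p (chart_v p).
Proof. exact: (proj2 (cont_chart (chart_domxx p))). Qed.

Lemma poly_order0 p (Q : {poly C}) : Q.[chart_u p p] != 0 ->
  has_order p (fun q => Q.[chart_u p q]) 0.
Proof.
move=> h; have [a ha] := expands_poly Q (proj1 (chart_expansion p)).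
apply: expands_order0 ha _ h => r r0.
by have [d d0 hd] := horner_cont Q (chart_u p p) r0; apply: nearp_imp (@cont_u p d d0) => q; exact: hd.
Qed.

Lemma has_order_v p : has_order p (chart_v p) ((ram p)%:Z - 1).
Proof.
rewrite /ram iota_fixedE; have [v0|v0] := eqVneq (chart_v p p) 0; last first.
  have [a ha] := proj2 (chart_expansion p).
  exact: expands_order0 ha (@cont_v p) v0.
apply: has_order_eq (has_order_coord p).
by apply: nearp_imp (nearp_dom p) => q hq _; rewrite local_coordE // /curve_coord v0 eqxx.
Qed.

(** At a branch point v ^ 2 = (u - u0) Q(u) with Q(u0) nonzero, so u - u0 has twice the order of
    v. *)
Lemma has_order_u p : has_order p (fun q => chart_u p q - chart_u p p) (ram p)%:Z.
Proof.
have [v0|v0] := eqVneq (chart_v p p) 0; last first.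
  rewrite /ram iota_fixedE (negbTE v0); apply: has_order_eq (has_order_coord p).
  by apply: nearp_imp (nearp_dom p) => q hq _; rewrite local_coordE // /curve_coord v0.
have [Q hQ] := poly_factor_sub (chart_poly p) (chart_u p p).
have P0 : (chart_poly p).[chart_u p p] = 0.
  by rewrite -chart_curve ?chart_domxx // v0 expr0n.
rewrite P0 addr0 in hQ.
have Q0 : Q.[chart_u p p] != 0.
  have := @chart_simple _ _ _ hyp p v0.
  by rewrite {1}hQ derivM derivXsubC mul1r hornerD hornerM hornerXsubC subrr mul0r addr0.
have hQ0 := poly_order0 Q0.
pose proof (has_orderM (has_orderM (has_order_v p) (has_order_v p)) (has_orderV hQ0)) as h.
move: h; rewrite /ram iota_fixedE v0 eqxx oppr0 addr0 => h.
apply: has_order_eq h.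
apply: nearp_imp (nearp_and (nearp_dom p) (has_order_neq0 hQ0)) => q [h1 h2] qp.
rewrite -expr2 chart_curve // hQ hornerM hornerXsubC mulfK //; exact: h2.
Qed.

Definition yfun q : C := if val q is inl (_, y) then y else 0.

Lemma order_xsub p (c : C) : has_order p (fun q => xfun q - c)
  (match val p with inl (x, _) => if x == c then (ram p)%:Z else 0
   | inr _ => - (ram p)%:Z end).
Proof.
case hp : (val p) => [[x y]|v].
  have hx q : chart_dom p q -> xfun q = chart_u p q.
    by rewrite /chart_dom /xfun /chart_u hp; case: (val q) => [[]|].
  have hu : chart_u p p = x by rewrite /chart_u hp.
  case: eqP => [xc|/eqP xc].
    apply: has_order_eq (has_order_u p).
    by apply: nearp_imp (nearp_dom p) => q hq _; rewrite hx // hu xc.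
  have h := @poly_order0 p ('X - c%:P).
  rewrite hornerXsubC hu subr_eq0 in h; apply: has_order_eq (h xc).
  by apply: nearp_imp (nearp_dom p) => q hq _; rewrite hx // hornerXsubC.
have hu : chart_u p p = 0 by rewrite /chart_u hp.
have hu' : has_order p (chart_u p) (ram p)%:Z.
  by apply: has_order_eq (has_order_u p); apply: nearp_all => q _; rewrite hu subr0.
have h1 : has_order p (fun q => (1 - c *: 'X).[chart_u p q]) 0.
  by apply: poly_order0; rewrite hu hornerD hornerN hornerZ hornerX mulr0 subr0 hornerC oner_neq0.
pose proof (has_orderM h1 (has_orderV hu')) as h2.
move: h2; rewrite add0r; apply: has_order_eq.
apply: nearp_imp (nearp_and (nearp_dom p) (has_order_neq0 hu')) => q [h2 h3] qp.
have {}h3 := h3 qp.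
rewrite hornerD hornerN hornerZ hornerX hornerC mulrBl mul1r mulfK //.
move: h2 h3; rewrite /chart_dom /xfun /chart_u hp.
by case: (val q) => [[x' y']|w]; rewrite ?invrK // eqxx.
Qed.

(** At infinity y = v / w ^ (g+1), where v has order [ram p - 1] and w has order [ram p]. *)
Lemma order_y p : has_order p yfun
  (match val p with inl _ => (ram p)%:Z - 1
   | inr _ => (ram p)%:Z - 1 - (ram p)%:Z *+ g.+1 end).
Proof.
case hp : (val p) => [[x y]|v].
  apply: has_order_eq (has_order_v p).
  apply: nearp_imp (nearp_dom p) => q.
  by rewrite /chart_dom /yfun /chart_v hp; case: (val q) => [[]|].
have hu : chart_u p p = 0 by rewrite /chart_u hp.
have hu' : has_order p (chart_u p) (ram p)%:Z.
  by apply: has_order_eq (has_order_u p); apply: nearp_all => q _; rewrite hu subr0.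
apply: has_order_eq (has_orderM (has_order_v p) (has_orderV (has_orderX g.+1 hu'))).
apply: nearp_imp (nearp_and (nearp_dom p) (has_order_neq0 hu')) => q [h2 h3] qp.
have {h3} := h3 qp; move: h2.
rewrite /chart_dom /yfun /chart_u /chart_v hp; case: (val q) => [[x' y']|w] /=.
  by move=> x0 _; rewrite exprVn invrK divfK // expf_neq0.
by rewrite eqxx.
Qed.

(** Differentiation kills the constant c, and m a_0 is nonzero because the characteristic is 0. *)
Lemma has_order_d_pos p F (c : C) (m : nat) : (0 < m)%N ->
  has_order p (fun q => F q - c) m%:Z -> has_order_d p F (m%:Z - 1).
Proof.
move=> m0 [a a0 /(laurent_delay m)]; rewrite subrr => ha.
have := laurent_add ha (laurent_cst p c) => h.
exists 0, (fun j => delay m a j + (c%:P)`_j), m; split.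
- by apply: laurent_eq h; apply: nearp_all => q _; rewrite subrK.
- by rewrite add0r.
- rewrite add0r coefC gtn_eqF // addr0 /delay ltnn subnn mulf_neq0 //.
  by rewrite pnatr_eq0 -lt0n.
- move=> [|i] im; first by rewrite add0r mul0r.
  by rewrite coefC addr0 /delay im mulr0.
Qed.

Lemma has_order_d_neg p F n : n < 0 -> has_order p F n -> has_order_d p F (n - 1).
Proof.
move=> n0 [a a0 ha]; exists n, a, 0%N; split=> //; rewrite addr0 //.
by rewrite mulf_neq0 // intr_eq0 lt_eqF.
Qed.

(** Two expansions of the same function differ by a shift of the indices, and the coefficients of
    the derivative are shifted with them. *)
Lemma has_order_d_unique p F m m' : has_order_d p F m -> has_order_d p F m' -> m = m'.
Proof.
move=> [n [a [j [ha -> aj hj]]]] [n' [a' [j' [ha' -> aj' hj']]]].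
wlog nn : n a j ha aj hj n' a' j' ha' aj' hj' / n <= n'.
  move=> h; case: (leP n n') => [nm|/ltW mn]; first exact: h ha aj hj _ _ _ ha' aj' hj' nm.
  by apply: esym; apply: h ha' aj' hj' _ _ _ ha aj hj mn.
pose d := `|n' - n|%N.
have hd : n = n' - d%:Z by rewrite gez0_abs ?subr_ge0 // opprB addrC subrK.
pose proof (laurent_delay d ha') as haa; rewrite -hd in haa.
have {}haa := laurent_unique (hyp := hyp) ha haa.
have dj : (d <= j)%N.
  by rewrite leqNgt; apply/negP => jd; move: aj; rewrite haa /delay jd mulr0 eqxx.
suff jj : (j = d + j')%N by rewrite hd jj PoszD; ring.
have hi (i : nat) : (n + (d + i)%N%:Z)%:~R * a (d + i)%N = (n' + i%:Z)%:~R * a' i.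
  by rewrite haa /delay ltnNge leq_addr addKn hd PoszD addrA subrK.
apply/eqP; rewrite eqn_leq; apply/andP; split; rewrite leqNgt; apply/negP => h.
  by move: aj'; rewrite -hi hj ?eqxx.
move: aj; rewrite -(subnKC dj) hi hj' ?eqxx //.
by rewrite -(ltn_add2l d) subnKC.
Qed.

Lemma order_dx p : has_order_d p (@xfun R g e)
  (match val p with inl _ => (ram p)%:Z - 1 | inr _ => - (ram p)%:Z - 1 end).
Proof.
have r0 : (0 < ram p)%N by rewrite /ram; case: ifP.
case hp : (val p) => [[x y]|v].
  have := order_xsub p x; rewrite hp eqxx; exact: has_order_d_pos.
have := order_xsub p 0; rewrite hp => h.
apply: has_order_d_neg; first by rewrite oppr_lt0 ltz_nat.
by apply: has_order_eq h; apply: nearp_all => q _; rewrite subr0.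
Qed.

End CoordinateFunctions.

(** * Linear equivalence, fibres and canonical divisors *)

Section Divisors.
Variables (R : realType) (g : nat) (e : seq R[i]).
Context {hyp : hyperelliptic g e}.
Notation C := R[i].
Notation X := (surface g e).
Implicit Types (p q r : X) (F G : X -> C) (n m : int) (D E : divisor g e).

Lemma divisor_eq D E : (forall p, coeff p D = coeff p E) -> D = E.
Proof. by move=> h; apply/eqP/freeg_eqP. Qed.

Lemma principal_coeff D E : (forall p, coeff p D = coeff p E) ->
  principal D -> principal E.
Proof. by move/divisor_eq ->. Qed.

Lemma principal0 : principal (0 : divisor g e).
Proof.
exists (fun _ => 1) => p; rewrite coeff0; exact: has_order_cst (oner_neq0 _).
Qed.

Lemma principalD D E : principal D -> principal E -> principal (D + E).
Proof.
move=> [F hF] [G hG]; exists (fun q => F q * G q) => p.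
rewrite coeffD; exact: has_orderM.
Qed.

Lemma principalN D : principal D -> principal (- D).
Proof. by move=> [F hF]; exists (fun q => (F q)^-1) => p; rewrite coeffN; exact: has_orderV. Qed.

Lemma principalB D E : principal D -> principal E -> principal (D - E).
Proof. by move=> h h'; apply/principalD/principalN. Qed.

Lemma principalMn D (k : nat) : principal D -> principal (D *+ k).
Proof.
move=> h; elim: k => [|k IH]; first exact: principal0.
by rewrite mulrS; apply: principalD.
Qed.

Lemma principalMz D n : principal D -> principal (D *~ n).
Proof. by move=> h; case: n => k; [|apply: principalN]; apply: principalMn. Qed.

Lemma principal_sum (I : Type) (s : seq I) (P : pred I) (f : I -> divisor g e) :
  (forall i, P i -> principal (f i)) -> principal (\sum_(i <- s | P i) f i).
Proof. exact: (big_ind (fun D => principal D) principal0 principalD). Qed.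

Lemma lin_equiv_refl D : lin_equiv D D.
Proof. by rewrite /lin_equiv subrr; exact: principal0. Qed.

Lemma lin_equiv_sym D E : lin_equiv D E -> lin_equiv E D.
Proof. by rewrite /lin_equiv -opprB => /principalN; rewrite opprK. Qed.

Lemma lin_equiv_trans D E E' : lin_equiv D E -> lin_equiv E E' -> lin_equiv D E'.
Proof.
by move=> h h'; have := principalD h h'; rewrite /lin_equiv addrA subrK.
Qed.

Lemma constant_of_order0 F : (forall p, has_order p F 0) ->
  exists2 c : C, c != 0 & forall p, nearp p (fun q => q != p -> F q = c).
Proof.
move=> h; have [c hc] : exists c : C, forall p, nearp p (fun q => q != p -> F q = c).
  by apply: liouville => p; have [a _ /laurent0 ha] := h p; exists a.
exists c => //; have [b _] := @branch_point_exists R g e hyp.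
have [q [_ h1 <-]] := nearp_nontrivial2 (has_order_neq0 (h b)) (hc b).
exact: h1.
Qed.

Lemma principal_effective D : (forall p, 0 <= coeff p D) -> principal D -> D = 0.
Proof.
move=> hD [F hF]; apply: divisor_eq => p; rewrite coeff0.
have [c hc] : exists c : C, forall p, nearp p (fun q => q != p -> F q = c).
  apply: liouville => q; have [a _] := hF q; have := hD q.
  case: (coeff q D) => // k _ /(laurent_delay k); rewrite subrr => /laurent0 ha.
  by exists (delay k a).
have c0 : c != 0.
  have [q [_ h1 <-]] := nearp_nontrivial2 (has_order_neq0 (hF p)) (hc p).
  exact: h1.
have h := has_order_cst p c0.
apply: has_order_unique (hF p) _; apply: has_order_eq h.
by apply: nearp_imp (hc p) => q h qp; rewrite h.
Qed.

(** The substitute for the degree: one of n r and - n r is effective, and an effective principal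
    divisor is zero. *)
Lemma principal_point r n : principal (<< n *g r >> : divisor g e) -> n = 0.
Proof.
wlog n0 : n / 0 <= n.
  move=> h hn; case: (leP 0 n) => [n0|/ltW n0]; first exact: h.
  apply/eqP; rewrite -oppr_eq0; apply/eqP/h; first by rewrite oppr_ge0.
  by rewrite -freegUN; apply: principalN.
move=> /principal_effective h; have : (<< n *g r >> : divisor g e) = 0.
  by apply: h => p; rewrite coeffU mulr_ge0.
by move=> /eqP; rewrite freegU_eq0 => /eqP.
Qed.

Lemma coeff_act_div (tau : X -> X) D p : involutive tau ->
  coeff p (act_div tau D) = coeff (tau p) D.
Proof.
move=> tauK; rewrite /act_div raddf_sum /=.
under eq_bigr do rewrite coeffU.
have [h|h] := boolP (tau p \in dom D).
  rewrite (bigD1_seq (tau p)) ?uniq_dom //= tauK eqxx mulr1 big1 ?addr0 // => q.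
  by rewrite -(inj_eq (inv_inj tauK)) tauK => /negbTE ->; rewrite mulr0.
rewrite (coeff_outdom h) big1_seq // => q /andP[_ qD].
by case: eqP => [hq|_]; rewrite ?mulr0 //; move: h; rewrite -hq tauK qD.
Qed.

Lemma act_divD (tau : X -> X) D E : involutive tau ->
  act_div tau (D + E) = act_div tau D + act_div tau E.
Proof. by move=> tauK; apply: divisor_eq => p; rewrite !(coeffD, coeff_act_div). Qed.

Lemma act_divN (tau : X -> X) D : involutive tau -> act_div tau (- D) = - act_div tau D.
Proof. by move=> tauK; apply: divisor_eq => p; rewrite !(coeffN, coeff_act_div). Qed.

Lemma act_divK (tau : X -> X) D : involutive tau -> act_div tau (act_div tau D) = D.
Proof. by move=> tauK; apply: divisor_eq => p; rewrite !coeff_act_div // tauK. Qed.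

Lemma pseries_conj (k : {rmorphism C -> C}) (a : nat -> C) (z s : C) :
  (forall w, normc (k w) = normc w) ->
  pseries_sum a z s -> pseries_sum (fun j => k (a j)) (k z) (k s).
Proof.
move=> hk; rewrite !pseries_sumE => /cvgcP h; apply/cvgcP => r /h[n0 hn].
exists n0 => n /hn; rewrite -(hk (_ - _)) rmorphB rmorph_sum /=.
by under eq_bigr do rewrite rmorphM rmorphXn.
Qed.

(* [k] is the identity for the hyperelliptic involution, and complex conjugation
   for the symmetry. *)
Lemma laurent_pull (k : {rmorphism C -> C}) (phi : X -> X) p p' (s : C) F n a :
  (forall w, normc (k w) = normc w) -> s != 0 ->
  (forall A, nearp p A -> nearp p' (fun q => A (phi q))) ->
  (forall q, q != p' -> phi q != p) ->
  nearp p' (fun q => k (local_coord p (phi q)) = s * local_coord p' q) ->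
  laurent p F n a ->
  laurent p' (fun q => k (F (phi q))) n (fun j => s ^ n * (k (a j) * s ^+ j)).
Proof.
move=> hk s0 hphi hp hz /laurentE ha; apply/laurentE.
apply: nearp_imp (nearp_and (nearp_and (hphi _ ha) hz) (local_coord_neq0 p')).
move=> q [[h1 h2] h3] qp; have := pseries_conj hk (h1 (hp q qp)).
rewrite h2 fmorph_div /= => h4.
have e1 : k (local_coord p (phi q) ^ n) = s ^ n * local_coord p' q ^ n.
  by rewrite -exprzMl ?unitfE ?h3 // -h2; case: (n) => i; rewrite ?fmorphV rmorphXn.
have h5 : pseries_sum (fun j => k (a j) * s ^+ j) (local_coord p' q)
    (k (F (phi q)) / k (local_coord p (phi q) ^ n)).
  move: h4; rewrite !pseries_sumE; apply: (tends_eventually (n0 := 0)) => i _.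
  by apply: eq_bigr => j _; rewrite exprMn mulrA.
have := @pseries_scale _ (s ^ n) _ _ _ h5; rewrite e1.
have sn : s ^ n != 0 by rewrite expfz_neq0.
have -> : s ^ n * (k (F (phi q)) / (s ^ n * local_coord p' q ^ n)) =
   k (F (phi q)) / local_coord p' q ^ n.
  by rewrite invfM mulrCA mulVKf // mulrC.
by move=> h6; exact: h6.
Qed.

Lemma has_order_pull (k : {rmorphism C -> C}) (phi : X -> X) p p' (s : C) F n :
  (forall w, normc (k w) = normc w) -> s != 0 ->
  (forall A, nearp p A -> nearp p' (fun q => A (phi q))) ->
  (forall q, q != p' -> phi q != p) ->
  nearp p' (fun q => k (local_coord p (phi q)) = s * local_coord p' q) ->
  has_order p F n -> has_order p' (fun q => k (F (phi q))) n.
Proof.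
move=> hk s0 hphi hp hz [a a0 ha].
exists (fun j => s ^ n * (k (a j) * s ^+ j)); last exact: laurent_pull hk s0 hphi hp hz ha.
by rewrite expr0 mulr1 mulf_neq0 ?expfz_neq0 // fmorph_eq0.
Qed.

(** In local coordinates [iota] is z -> - z at a branch point; elsewhere it carries the coordinate
    at [p] to the one at [iota p]. *)
Definition iota_sign p : C := if iota p == p then -1 else 1.

Lemma iota_sign_neq0 p : iota_sign p != 0.
Proof. by rewrite /iota_sign; case: ifP; rewrite ?oppr_eq0 oner_neq0. Qed.

Lemma local_coord_iota p : nearp p (fun q =>
  local_coord (iota p) (iota q) = iota_sign p * local_coord p q).
Proof.
apply: nearp_imp (nearp_dom p) => q hq.
rewrite !local_coordE ?iota_dom // /curve_coord !iota_u !iota_v oppr_eq0.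
by rewrite /iota_sign iota_fixedE; case: eqP; rewrite ?mulN1r ?mul1r.
Qed.

Lemma nearp_iota_preimage p (A : X -> Prop) : nearp (iota p) A -> nearp p (fun q => A (iota q)).
Proof. by move/nearp_iota; rewrite iotaK. Qed.

Lemma laurent_iota p F n a : laurent (iota p) F n a ->
  laurent p (fun q => F (iota q)) n (fun j => iota_sign p ^ n * (a j * iota_sign p ^+ j)).
Proof.
apply: (@laurent_pull idfun (@iota R g e)) => //.
- exact: iota_sign_neq0.
- exact: nearp_iota_preimage.
- by move=> q; rewrite (inj_eq (inv_inj (@iotaK R g e))).
- exact: local_coord_iota.
Qed.

Lemma has_order_iota p F n : has_order (iota p) F n ->
  has_order p (fun q => F (iota q)) n.
Proof.
move=> [a a0 ha]; exists (fun j => iota_sign p ^ n * (a j * iota_sign p ^+ j)); last exact: laurent_iota.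
by rewrite expr0 mulr1 mulf_neq0 ?expfz_neq0 ?iota_sign_neq0.
Qed.

Notation iotaD := (act_div (@iota R g e)).

Lemma coeff_iota p D : coeff p (iotaD D) = coeff (iota p) D.
Proof. exact/coeff_act_div/iotaK. Qed.

Lemma principal_iota D : principal D -> principal (iotaD D).
Proof.
move=> [F hF]; exists (fun q => F (iota q)) => p; rewrite coeff_iota.
exact: has_order_iota.
Qed.

(* If [div F = D] then [F \o iota = c * F] for a constant [c].  At a branch point,
   where [iota] is [z |-> -z], leading coefficients give [(-1) ^ n = c] with [n]
   the order of [F]. *)
Lemma invariant_principal_parity D : iotaD D = D -> principal D ->
  (forall p, iota p = p -> ~~ odd `|coeff p D|%N) \/
  (forall p, iota p = p -> odd `|coeff p D|%N).
Proof.
move=> hD [F hF].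
have hF' p : has_order p (fun q => F (iota q)) (coeff p D).
  by rewrite -{1}hD coeff_iota; exact: has_order_iota.
have [|c c0 hc] := @constant_of_order0 (fun q => F (iota q) * (F q)^-1).
  by move=> p; have := has_orderM (hF' p) (has_orderV (hF p)); rewrite subrr; apply.
have hFc p : nearp p (fun q => q != p -> F (iota q) = c * F q).
  apply: nearp_imp (nearp_and (hc p) (has_order_neq0 (hF p))) => q [h1 h2] qp.
  by rewrite -h1 // divfK // h2.
have key p : iota p = p -> (-1) ^ (coeff p D) = c.
  move=> hp; have [a a0 ha] := hF p.
  have hi : laurent p (fun q => F (iota q)) (coeff p D)
      (fun j => iota_sign p ^ (coeff p D) * (a j * iota_sign p ^+ j)).
    by apply: laurent_iota; rewrite hp.
  have hs : laurent p (fun q => F (iota q)) (coeff p D) (fun j => c * a j).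
    apply/laurentE; have /laurentE/(expands_scale c) := ha; apply: expands_eq.
    by apply: nearp_imp (hFc p) => q h qp; rewrite h // mulrA.
  pose proof (congr1 (fun f : nat -> C => f 0%N) (laurent_unique hi hs)) as h.
  move: h; rewrite /= expr0 mulr1 /iota_sign hp eqxx => /eqP.
  by rewrite -subr_eq0 -mulrBl mulf_eq0 (negbTE a0) orbF subr_eq0 => /eqP.
have sgn n : (-1 : C) ^ n = (-1) ^+ odd `|n|%N.
  case: n => k; first exact/esym/signr_odd.
  have -> : (-1 : C) ^ Negz k = ((-1) ^+ k.+1)^-1 by [].
  by rewrite invr_sign -signr_odd.
have [c1|c1] := eqVneq c 1; [left|right] => p /key; rewrite sgn.
  by case: odd => //; rewrite expr1 c1 => /eqP; rewrite eq_sym -subr_eq0 opprK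
    (_ : 1 + 1 = 2%:R) // pnatr_eq0.
by case: odd => //; rewrite expr0 => h; rewrite -h eqxx in c1.
Qed.

(** The fibre of the projection through [p], with multiplicities. *)
Definition Phi p : divisor g e := << p >> + << iota p >>.

Lemma coeff_Phi p q : coeff q (Phi p) = if Defs.proj q == Defs.proj p then (ram q)%:Z else 0.
Proof.
rewrite /Phi coeffD !coeffU !mul1r.
have [h|h] := eqVneq (Defs.proj q) (Defs.proj p); last first.
  have -> : (p == q) = false by apply: contraNF h => /eqP ->.
  have -> // : (iota p == q) = false.
  apply: contraNF h => /eqP <-; rewrite /Defs.proj /=.
  by case: (val p) => [[]|].
have : q = p \/ q = iota p.
  move: h; rewrite /Defs.proj; case hp : (val p) => [[x y]|v]; case hq : (val q) => [[x' y']|v'] //.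
    by case=> hx; rewrite hx in hq; exact: iota_same_x hp hq.
  by move=> _; exact: iota_same_inf hp hq.
rewrite /ram => -[] ->; rewrite ?iotaK eqxx ?[_ == iota _]eq_sym.
  by case: eqP.
by rewrite addrC; case: eqP.
Qed.

Lemma Phi_infinite : exists p0 : X, Defs.proj p0 = None.
Proof.
by have [p [_ [[c hc] _ _]]] := infinite_fibre (hyp := hyp); exists p; rewrite /Defs.proj hc.
Qed.

(** The function x - x(p) has the fibre through an affine [p] as its zeros and the fibre at infinity
    as its poles. *)
Lemma lin_equiv_Phi p q : lin_equiv (Phi p) (Phi q).
Proof.
have [p0 hp0] := Phi_infinite.
have key p1 : lin_equiv (Phi p1) (Phi p0).
  case hp : (val p1) => [[x y]|v]; last first.
    have -> : Phi p1 = Phi p0.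
      by apply: divisor_eq => z; rewrite !coeff_Phi hp0 /Defs.proj hp.
    exact: lin_equiv_refl.
  exists (fun z => xfun z - x) => z; rewrite coeffB !coeff_Phi hp0.
  pose proof (order_xsub z x) as hz.
  set m := match val z with inl _ => _ | inr _ => _ end in hz.
  suff <- : m = (if Defs.proj z == Defs.proj p1 then (ram z)%:Z else 0) -
     (if Defs.proj z == None then (ram z)%:Z else 0) by exact: hz.
  rewrite /m /Defs.proj hp; case: (val z) => [[x' y']|w] /=; last by rewrite sub0r.
  by rewrite (inj_eq (@Some_inj _)) subr0.
exact: lin_equiv_trans (key p) (lin_equiv_sym (key q)).
Qed.

(** [insub] keeps the point at infinity [inr 0] exactly when it lies on the surface, that is when N
    = 2g+1. *)
Definition branch_list : seq X :=
  pmap insub ([seq inl (a, 0) | a <- e] ++ [:: inr 0]).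

Lemma mem_branch_list p : (p \in branch_list) = (iota p == p).
Proof.
rewrite iota_fixedE mem_pmap_sub /= mem_cat inE.
case: p => [[[x y]|v] hp]; rewrite /chart_v /=.
  rewrite orbF; apply/mapP/eqP => [[a _ [_ ->]]//|y0].
  exists x; last by rewrite y0.
  by rewrite -root_prod_XsubC /root -(eqP hp) y0 expr0n.
rewrite (_ : inr v \in _ = false); last by apply/mapP => -[].
by apply/eqP/eqP => [[]|->].
Qed.

Lemma uniq_branch_list : uniq branch_list.
Proof.
rewrite pmap_sub_uniq // cat_uniq map_inj_uniq ?roots_uniq /= ?andbT //.
  by apply/orP => -[/mapP[]|].
by move=> a b [].
Qed.

Lemma coeff_branch q : coeff q (\sum_(r <- branch_list) << r >>) = (ram q)%:Z - 1.
Proof.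
rewrite raddf_sum /=; under eq_bigr do rewrite coeffU mul1r.
rewrite /ram -mem_branch_list; have [h|h] := boolP (q \in branch_list).
  rewrite (bigD1_seq q) ?uniq_branch_list //= eqxx big1 ?addr0 // => r rq.
  by rewrite (negbTE rq).
rewrite big1_seq ?subrr // => r /andP[_ hr].
by case: eqP => // hrq; move: h; rewrite -hrq hr.
Qed.

(** The divisor of y: its zeros are the finite branch points, and its order at infinity matches g+1
    fibres there, less the branch point at infinity if there is one. *)
Lemma branch_relation p : lin_equiv (\sum_(r <- branch_list) << r >>) (Phi p *+ g.+1).
Proof.
have [p0 hp0] := Phi_infinite.
suff h : lin_equiv (\sum_(r <- branch_list) << r >>) (Phi p0 *+ g.+1).
  apply: lin_equiv_trans h _.
  by have := principalMn g.+1 (lin_equiv_Phi p0 p); rewrite mulrnBl.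
exists (@yfun R g e) => q; rewrite coeffB coeffMn coeff_branch coeff_Phi hp0.
pose proof (order_y q) as hq.
set m := match val q with inl _ => _ | inr _ => _ end in hq.
suff <- : m = (ram q)%:Z - 1 - (if Defs.proj q == None then (ram q)%:Z else 0) *+ g.+1.
  exact: hq.
by rewrite /m /Defs.proj; case: (val q) => [[x y]|v] /=; rewrite ?mul0rn ?subr0.
Qed.

(** The multiple is an integer because g - 1 is negative for genus 0. The function [F] moves the
    fibre from infinity to [p], and division by y brings in the divisor of dx / y. *)
Lemma canonical_Phi p : Defs.canonical (Phi p *~ (g%:Z - 1)).
Proof.
have [p0 hp0] := Phi_infinite.
have [F hF] := principalMz (g%:Z - 1) (lin_equiv_Phi p p0).
exists (fun q => F q * (yfun q)^-1) => q.
pose m := match val q with inl _ => (ram q)%:Z - 1 | inr _ => - (ram q)%:Z - 1 end.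
pose n := match val q with inl _ => (ram q)%:Z - 1 | inr _ => (ram q)%:Z - 1 - (ram q)%:Z *+ g.+1 end.
exists (coeff q ((Phi p - Phi p0) *~ (g%:Z - 1)) - n), m; split.
- exact: has_orderM (hF q) (has_orderV (order_y q)).
- exact: order_dx.
have cz (A : divisor g e) k : coeff q (A *~ k) = coeff q A *~ k.
  exact: raddfMz.
rewrite !cz coeffB mulrzBl [coeff q (Phi p0)]coeff_Phi hp0 /n /m /Defs.proj.
case: (val q) => [[x y]|v] /=.
  by rewrite mul0rz subr0 -addrA [- _ + _]addrC subrr addr0.
rewrite -addrA -[LHS]addr0 -addrA; congr (_ + _).
rewrite -mulrzr -mulr_natr intz natz; ring.
Qed.

(** The order of dx is the same for both differentials and cancels, leaving the divisor of the
    quotient of their coefficients. *)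
Lemma canonical_equiv K p : Defs.canonical K -> lin_equiv K (Phi p *~ (g%:Z - 1)).
Proof.
move=> [F hF]; have [G hG] := canonical_Phi p.
exists (fun q => F q * (G q)^-1) => q; rewrite coeffB.
have [n [m [h1 h2 ->]]] := hF q; have [n' [m' [h1' h2' ->]]] := hG q.
rewrite (has_order_d_unique h2' h2) opprD addrACA subrr addr0.
exact: has_orderM h1 (has_orderV h1').
Qed.

End Divisors.

(** * Divisor classes of order two *)

Section TwoTorsion.
Variables (R : realType) (g : nat) (e : seq R[i]).
Context {hyp : hyperelliptic g e}.
Notation C := R[i].
Notation X := (surface g e).
Implicit Types (p q r : X) (F G : X -> C) (n m : int) (D E : divisor g e).
Notation iotaD := (act_div (@iota R g e)).

Variable r0 : X.
Hypothesis r0_fixed : iota r0 = r0.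

Lemma Phi_fixed r : iota r = r -> Phi r = << r >> *+ 2.
Proof. by move=> h; rewrite /Phi h mulr2n. Qed.

Lemma coeffMz p D n : coeff p (D *~ n) = coeff p D * n.
Proof. by rewrite raddfMz mulrzz. Qed.

Lemma Phi_mulz n : Phi r0 *~ n = << (n * 2) *g r0 >>.
Proof.
by apply: divisor_eq => p; rewrite coeffMz Phi_fixed // coeffMn !coeffU; ring.
Qed.

Lemma principal_Phi_mulz n : principal (Phi r0 *~ n) -> n = 0.
Proof.
by rewrite Phi_mulz => /principal_point/eqP; rewrite mulf_eq0 orbF => /eqP.
Qed.

(** The sum is a combination of fibres, which are all equivalent to the one through [r0]. *)
Lemma add_iota D : exists n, lin_equiv (D + iotaD D) (Phi r0 *~ n).
Proof.
exists (\sum_(z <- dom D) coeff z D).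
have -> : D + iotaD D = \sum_(z <- dom D) Phi z *~ coeff z D.
  rewrite -{1}[D]freeg_sumE /act_div -big_split /=; apply: eq_bigr => z _.
  by apply: divisor_eq => p; rewrite coeffMz !coeffD !coeffU; ring.
rewrite /lin_equiv mulrz_sumr -sumrB; apply: principal_sum => z _.
by rewrite -mulrzBl; apply/principalMz/lin_equiv_Phi.
Qed.

(* Hilbert 90 for the extension of function fields: [h * (h \o iota) = 1]
   gives [h = u / (u \o iota)] with [u = 1 + h], unless [h = -1]. *)
Lemma torsion_invariant E : principal (E *+ 2) ->
  exists2 E', iotaD E' = E' & lin_equiv E E'.
Proof.
move=> hE; have [n hn] := add_iota E.
(* Twice the left-hand side of [hn] is principal, so 2 n times a fibre is principal. *)
have n0 : n = 0.
  apply/eqP; rewrite -(mulrI_eq0 _ (lregP (isT : (2 : int) != 0))).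
  apply/eqP/principal_Phi_mulz.
  have h1 : principal (E *+ 2 + iotaD (E *+ 2)).
    exact: principalD hE (principal_iota hE).
  pose proof (principalB h1 (principalMn 2 hn)) as hpr; move: hpr; apply: principal_coeff => p.
  rewrite !(coeffB, coeffD, coeff_iota, coeffMn, coeffMz); ring.
move: hn; rewrite n0 /lin_equiv mulr0z subr0 => hn.
have [h0 hh0] : principal (E - iotaD E).
  pose proof (principalB hE hn) as hpr; move: hpr; apply: principal_coeff => p.
  by rewrite !(coeffB, coeffD, coeffMn); ring.
have hh0i p : has_order p (fun q => h0 (iota q)) (coeff (iota p) (E - iotaD E)).
  exact: has_order_iota.
have [|c c0 hc] := @constant_of_order0 R g e _ (fun q => h0 q * h0 (iota q)).
  move=> p; have := has_orderM (hh0 p) (hh0i p).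
  rewrite !coeffB !coeff_iota iotaK addrA subrK subrr; apply.
(* Division by a square root of [c] turns the constant product into 1. *)
have [s hs] := @closed_root R c 2 isT.
have s0 : s != 0 by apply: contraNneq c0 => s0; rewrite -hs s0 expr0n.
pose h q := s^-1 * h0 q.
have hh p : has_order p h (coeff p (E - iotaD E)).
  have := has_orderM (has_order_cst p (invr_neq0 s0)) (hh0 p); rewrite add0r; apply.
have h1 p : nearp p (fun q => q != p -> h q * h (iota q) = 1).
  apply: nearp_imp (hc p) => q hq qp; rewrite /h mulrACA hq // -hs.
  by rewrite -invfM -expr2 mulVf // expf_neq0.
have hu p : mero p (fun q => 1 + h q).
  by apply: mero_add; [exact: mero_cst|exact: has_order_mero (hh p)].
have [hord|hzero] := identity_theorem hu.
  have [m hm] := boolp.choice hord.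
  have [U hU] := divisor_of_function hm.
  (* Orders in the identity (1 + h o iota) h = 1 + h. *)
  have hmi p : m p = m (iota p) + coeff p (E - iotaD E).
    apply: has_order_unique (hm p) _.
    pose proof (has_orderM (has_order_iota (hm (iota p))) (hh p)) as h2.
    apply: has_order_eq h2.
    apply: nearp_imp (h1 p) => q hq qp.
    by rewrite mulrDl mul1r [h (iota q) * _]mulrC hq // addrC.
  exists (E - U).
    apply: divisor_eq => p; rewrite coeff_iota !coeffB !hU.
    have := hmi p; rewrite coeffB coeff_iota => ->; ring.
  exists (fun q => 1 + h q) => p.
  by rewrite opprB addrC subrK hU.
(* Here h = -1 has order 0 everywhere, so [E] is already invariant. *)
exists E; last exact: lin_equiv_refl.
apply: divisor_eq => p; apply/eqP; rewrite eq_sym -subr_eq0 -coeffB; apply/eqP.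
apply: has_order_unique (hh p) _.
have m1 : (-1 : C) != 0 by rewrite oppr_eq0 oner_neq0.
apply: has_order_eq (has_order_cst p m1).
apply: nearp_imp (hzero p) => q hq qp; have /eqP := hq qp.
by rewrite addrC addr_eq0 => /eqP.
Qed.

(* Selects one point in each orbit of [iota] with two elements. *)
Definition half p : bool :=
  (iota p != p) && (choose [pred q | (q == p) || (q == iota p)] p == p).

Lemma half_iota p : iota p != p -> half (iota p) = ~~ half p.
Proof.
move=> hp; rewrite /half iotaK hp eq_sym hp /=.
set P := [pred q | (q == p) || (q == iota p)].
have -> : choose [pred q | (q == iota p) || (q == p)] (iota p) = choose P p.
  rewrite (@choose_id _ P p (iota p)) ?inE ?eqxx ?orbT //.
  by apply: eq_choose => q; rewrite /= orbC.
have : P (choose P p) by apply: chooseP; rewrite /= eqxx.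
by rewrite /= => /orP[/eqP ->|/eqP ->]; rewrite ?eqxx ?(negbTE hp) // eq_sym (negbTE hp).
Qed.

(** Away from the branch points an invariant divisor is H + iota H, where H keeps one point of each
    orbit; this is equivalent to a multiple of a fibre. *)
Lemma invariant_decomposition E : iotaD E = E ->
  exists n, lin_equiv E (\sum_(r <- branch_list g e) << coeff r E *g r >> + Phi r0 *~ n).
Proof.
move=> hE; pose H := \sum_(p <- dom E | half p) << coeff p E *g p >>.
have hH q : coeff q H = if half q then coeff q E else 0.
  rewrite raddf_sum /=; under eq_bigr do rewrite coeffU.
  have [h|h] := boolP (q \in dom E).
    rewrite big_mkcond (bigD1_seq q) ?uniq_dom //= eqxx mulr1 big1 ?addr0 // => p pq.
    by rewrite (negbTE pq) mulr0 if_same.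
  rewrite (coeff_outdom h) if_same big1_seq // => p /andP[_ pE].
  by case: eqP => [pq|]; rewrite ?mulr0 //; rewrite -pq pE in h.
have hI q : coeff (iota q) E = coeff q E by rewrite -{2}hE coeff_iota.
have [n hn] := add_iota H; exists n.
move: hn; apply: principal_coeff => p.
rewrite [in RHS]coeffB [in LHS]coeffB [in RHS]coeffD opprD addrA; congr (_ - _).
rewrite coeffD coeff_iota !hH raddf_sum /=.
under [in RHS]eq_bigr do rewrite coeffU.
have [h|h] := boolP (p \in branch_list g e).
  rewrite (bigD1_seq p) ?uniq_branch_list //= eqxx mulr1 big1 ?addr0; last first.
    by move=> q qp; rewrite (negbTE qp) mulr0.
  move: h; rewrite mem_branch_list => /eqP hp.
  by rewrite hp /half hp eqxx /= addr0 subrr.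
rewrite big1_seq => [|q /andP[_ hq]]; last first.
  by case: eqP => [qp|]; rewrite ?mulr0 //; rewrite -qp hq in h.
rewrite mem_branch_list in h; rewrite half_iota // hI subr0.
by case: half; rewrite ?addr0 ?add0r.
Qed.

(** The classes of the r - r0 have order at most two, so only parities of coefficients matter and a
    predicate suffices to record them. *)
Definition delta (P : pred X) : divisor g e :=
  \sum_(r <- branch_list g e | P r) (<< r >> - << r0 >>).

Lemma branch_point_double r : r \in branch_list g e ->
  principal ((<< r >> - << r0 >>) *+ 2).
Proof.
rewrite mem_branch_list => /eqP hr.
by rewrite mulrnBl -!Phi_fixed //; exact: lin_equiv_Phi.
Qed.

Lemma delta_double P : principal (delta P *+ 2).
Proof.
rewrite /delta -sumrMnl big_seq_cond; apply: principal_sum => r /andP[hr _].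
exact: branch_point_double.
Qed.

Lemma torsion_delta E : principal (E *+ 2) -> exists P, lin_equiv E (delta P).
Proof.
move=> hE; have [E' hE' hEE'] := torsion_invariant hE.
have [n hn] := invariant_decomposition hE'.
(* Even parts of the coefficients are absorbed by the relations 2 (r - r0) ~ 0, at the cost of a
   multiple of r0. *)
pose P r := odd `|coeff r E'|%N; exists P.
have hpar (k : int) : exists k', k = (odd `|k|%N)%:Z + k' *+ 2.
  have e2 : `|k|%N%:Z = (odd `|k|%N)%:Z + (`|k|%N./2)%:Z *+ 2.
    by rewrite -{1}[`|k|%N]odd_double_half PoszD -mul2n PoszM; ring.
  have [k0|k0] := leP 0 k.
    by exists (`|k|%N./2)%:Z; rewrite -e2 gez0_abs.
  exists (- (odd `|k|%N)%:Z - (`|k|%N./2)%:Z).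
  have e3 : k = - `|k|%N%:Z by rewrite ltz0_abs // opprK.
  by rewrite {1}e3 e2; ring.
have [m hm] : exists m, principal (E' - delta P - << m *g r0 >>).
  suff [m hm] : exists m, principal (\sum_(r <- branch_list g e) << coeff r E' *g r >>
      - delta P - << m *g r0 >>).
    exists (m + n * 2); pose proof (principalD hn hm) as hpr; move: hpr; apply: principal_coeff => p.
    rewrite Phi_mulz !(coeffB, coeffD, coeffU); ring.
  have hr r : r \in branch_list g e -> exists m, principal (<< coeff r E' *g r >>
      - (if P r then << r >> - << r0 >> else 0) - << m *g r0 >>).
    move=> /branch_point_double hr; have [k' hk] := hpar (coeff r E').
    exists ((odd `|coeff r E'|%N)%:Z + k' *+ 2).
    pose proof (principalMz k' hr) as hpr; move: hpr; apply: principal_coeff => p.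
    rewrite /P {1}hk; case: odd; rewrite !(coeffMz, coeffMn, coeffB, coeffU, coeff0) /=; ring.
  rewrite /delta [X in _ - X]big_mkcond /=.
  elim: (branch_list g e) hr => [|r s IH] hr.
    by exists 0; rewrite !big_nil freegU0 !subr0; exact: principal0.
  have [m1 h1] := hr r (mem_head _ _).
  have [|m2 h2] := IH; first by move=> q qs; apply: hr; rewrite inE qs orbT.
  exists (m1 + m2); pose proof (principalD h1 h2) as hpr; move: hpr; apply: principal_coeff => p.
  by rewrite !big_cons !(coeffB, coeffD, coeffU); ring.
(* Doubling makes both E' and [delta] principal, which leaves 2 m r0. *)
have m0 : m = 0.
  have h2 : principal (E' *+ 2).
    pose proof (principalB hE (principalMn 2 hEE')) as hpr; move: hpr; apply: principal_coeff => p.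
    by rewrite !(coeffMn, coeffB); ring.
  pose proof (principalB (principalB h2 (delta_double P)) (principalMn 2 hm)) as h3.
  have /principal_point/eqP : principal << (m *+ 2) *g r0 >>.
    by move: h3; apply: principal_coeff => p; rewrite !(coeffMn, coeffB, coeffU); ring.
  by rewrite mulrn_eq0 => /eqP.
apply: lin_equiv_trans hEE' _; move: hm; rewrite m0 freegU0 subr0; apply.
Qed.

Lemma coeff_delta P q : q != r0 ->
  coeff q (delta P) = ((q \in branch_list g e) && P q)%:Z.
Proof.
move=> qr; rewrite /delta raddf_sum /=.
under eq_bigr do rewrite coeffB !coeffU !mul1r (eq_sym r0) (negbTE qr) subr0.
have [h|h] := boolP (q \in branch_list g e).
  rewrite big_mkcond (bigD1_seq q) ?uniq_branch_list //= eqxx big1 ?addr0.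
    by case: (P q).
  by move=> r rq; rewrite (negbTE rq) if_same.
rewrite big1_seq // => r /andP[_ hr].
by case: eqP => // rq; rewrite -rq hr in h.
Qed.

Lemma delta_eq P Q : (forall r, iota r = r -> r != r0 -> P r = Q r) -> delta P = delta Q.
Proof.
move=> h; rewrite /delta big_mkcond [RHS]big_mkcond /=.
apply: eq_big_seq => r; rewrite mem_branch_list => /eqP hr.
have [->|rr] := eqVneq r r0; first by rewrite subrr !if_same.
by rewrite h.
Qed.

(** The divisor of y gives this up to n r0, with n equal to 2g+2 less the number of branch points; n
    = 0 is obtained by doubling, not by counting. *)
Lemma delta_all : principal (delta xpredT).
Proof.
pose proof (branch_relation r0) as h.
pose n : int := g.+1%:Z * 2 - (size (branch_list g e))%:Z.
have h1 : principal (delta xpredT - << n *g r0 >>).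
  apply: principal_coeff h => p.
  have -> : delta xpredT = \sum_(r <- branch_list g e) << r >> -
      << (size (branch_list g e))%:Z *g r0 >>.
    rewrite /delta sumrB; congr (_ - _).
    by rewrite big_const_seq count_predT -Monoid.iteropE /= -[LHS]/(<< r0 >> *+ _) freeg_muln natz.
  rewrite Phi_fixed // !(coeffB, coeffMn, coeffU) /n; ring.
have n0 : n = 0.
  pose proof (principalB (delta_double xpredT) (principalMn 2 h1)) as h2.
  have /principal_point/eqP : principal << (n *+ 2) *g r0 >>.
    by move: h2; apply: principal_coeff => p; rewrite !(coeffMn, coeffB, coeffU); ring.
  by rewrite mulrn_eq0 => /eqP.
by move: h1; rewrite n0 freegU0 subr0; apply.
Qed.

Lemma delta_compl P : lin_equiv (delta P) (delta (predC P)).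
Proof.
pose proof (principalB (delta_double P) delta_all) as h.
apply: principal_coeff h => p.
have -> : delta xpredT = delta P + delta (predC P) by rewrite /delta [LHS](bigID P).
by rewrite !(coeffB, coeffD, coeffMn); ring.
Qed.

Lemma iota_delta P : iotaD (delta P) = delta P.
Proof.
apply: divisor_eq => q; rewrite coeff_iota.
have [->|qr] := eqVneq q r0; first by rewrite r0_fixed.
have qr' : iota q != r0 by rewrite -r0_fixed (inj_eq (inv_inj (@iotaK R g e))).
rewrite !coeff_delta // !mem_branch_list iotaK eq_sym.
by case: eqP => [->|].
Qed.

Variable r1 : X.
Hypothesis r1_fixed : iota r1 = r1.
Hypothesis r1_r0 : r1 != r0.

(** The difference is invariant and principal, so its coefficients at branch points have a common
    parity, which is even because of r1. Away from r0 these coefficients lie in {-1, 0, 1}, hence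
    vanish. *)
Lemma delta_inj P Q : P r1 = Q r1 -> lin_equiv (delta P) (delta Q) ->
  forall r, iota r = r -> r != r0 -> P r = Q r.
Proof.
move=> h1 /invariant_principal_parity[].
- by apply: divisor_eq => q; rewrite coeff_iota !coeffB -!coeff_iota !iota_delta.
- move=> h r hr rr; have := h r hr.
  rewrite coeffB !coeff_delta // mem_branch_list hr eqxx /=.
  by case: (P r); case: (Q r).
- move=> h; have := h r1 r1_fixed.
  by rewrite coeffB !coeff_delta // h1 subrr.
Qed.

Lemma torsion_delta_normal E : principal (E *+ 2) ->
  exists2 P : pred X, P r1 = false & lin_equiv E (delta P).
Proof.
move=> /torsion_delta[P hP]; have [h|h] := boolP (P r1); last first.
  by exists P; [exact: negbTE|exact: hP].
exists (predC P); first by rewrite /= h.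
exact: lin_equiv_trans hP (delta_compl P).
Qed.

End TwoTorsion.

(** * Action of the symmetry on divisor classes *)

Section Symmetry.
Variables (R : realType) (g : nat) (e : seq R[i]).
Context {hyp : hyperelliptic g e}.
Notation C := R[i].
Notation X := (surface g e).
Implicit Types (p q r : X) (F G : X -> C) (n m : int) (D E : divisor g e).

Variable tau : X -> X.
Hypothesis f_real : defining_poly e \is a polyOver Num.real.
Hypothesis tau_sym : symmetry tau.
Hypothesis tau_conj : induced_by_conj tau.

Lemma conjc_id (c : C) : c \is Num.real -> (c^*)%C = c.
Proof. by move=> /complex_realP[k ->]; rewrite conjc_real. Qed.

Lemma tauK : involutive tau. Proof. by case: tau_sym. Qed.

Lemma chart_poly_real p i : (chart_poly p)`_i \is Num.real.
Proof.
rewrite /chart_poly; case: (val p) => _; first exact/polyOverP.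
rewrite coef_poly; case: ifP => _; [exact/polyOverP|exact: real0].
Qed.

Lemma conj_chart_poly p (u : C) : ((chart_poly p).[u])^*%C = (chart_poly p).[(u^*)%C].
Proof.
rewrite -horner_map; congr (_.[_]); apply/polyP => i.
by rewrite coef_map; apply/conjc_id/chart_poly_real.
Qed.

Lemma tau_val q : match val q with
  | inl (x, _) => exists y, val (tau q) = inl (x^*%C, y)
  | inr _ => exists v, val (tau q) = inr v end.
Proof.
have := tau_conj q; rewrite /Defs.proj.
case: (val q) => [[x y]|v]; case: (val (tau q)) => [[x' y']|v'] //=.
  by move=> [->]; exists y'.
by exists v'.
Qed.

Lemma tau_chart_poly p : chart_poly (tau p) = chart_poly p.
Proof.
by have := tau_val p; rewrite /chart_poly; case: (val p) => [[x y]|v] [w ->].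
Qed.

Lemma tau_dom p q : chart_dom (tau p) (tau q) = chart_dom p q.
Proof.
have := tau_val p; have := tau_val q; rewrite /chart_dom.
case: (val p) => [[a b]|c]; case: (val q) => [[x y]|v] [s ->] [t ->] //.
by rewrite conjc_eq0.
Qed.

Lemma tau_u p q : chart_u (tau p) (tau q) = (chart_u p q)^*%C.
Proof.
have := tau_val p; have := tau_val q; rewrite /chart_u.
case: (val p) => [[a b]|c]; case: (val q) => [[x y]|v] [s ->] [t ->] //;
  by rewrite ?conjc_inv ?conjc0.
Qed.

(** The hypothesis on the projection determines v at [tau q] only up to sign, through the real
    equation of the curve. *)
Lemma tau_v2 p q : chart_dom p q ->
  chart_v (tau p) (tau q) ^+ 2 = ((chart_v p q)^*%C) ^+ 2.
Proof.
move=> h; rewrite chart_curve ?tau_dom // tau_chart_poly tau_u -conj_chart_poly.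
by rewrite -chart_curve // rmorphXn.
Qed.

Lemma tau_iota_fixed p : (iota (tau p) == tau p) = (iota p == p).
Proof.
have h (w : C) : (w == 0) = (w ^+ 2 == 0) by rewrite expf_eq0.
by rewrite !iota_fixedE [LHS]h tau_v2 ?chart_domxx // expf_eq0 conjc_eq0.
Qed.

Lemma tau_nearp p (A : X -> Prop) : nearp (tau p) A -> nearp p (fun q => A (tau q)).
Proof.
case: tau_sym => /(_ p)[hc _] _ /nearpP hA.
by apply/nearpP; apply: hc hA.
Qed.

(* Antiholomorphy makes the sign in [conj (z (tau q)) = +- z q] locally constant
   at a branch point. *)
Lemma tau_coord p : exists2 s : C, s != 0 &
  nearp p (fun q => (local_coord (tau p) (tau q))^*%C = s * local_coord p q).
Proof.
have cu q : (chart_u (tau p) (tau q))^*%C = chart_u p q by rewrite tau_u conjcK.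
have [v0|v0] := eqVneq (chart_v p p) 0; last first.
  exists 1; first exact: oner_neq0.
  apply: nearp_imp (nearp_dom p) => q hq.
  rewrite mul1r !local_coordE ?tau_dom // /curve_coord v0.
  have -> : chart_v (tau p) (tau p) != 0.
    by rewrite -iota_fixedE tau_iota_fixed iota_fixedE.
  by rewrite rmorphB /= !cu.
have v0' : chart_v (tau p) (tau p) = 0.
  by apply/eqP; rewrite -iota_fixedE tau_iota_fixed iota_fixedE v0.
pose G q := (local_coord (tau p) (tau q))^*%C.
have G2 q : chart_dom p q -> G q ^+ 2 = local_coord p q ^+ 2.
  move=> hq; rewrite /G !local_coordE ?tau_dom // /curve_coord v0 v0' eqxx /=.
  by rewrite -rmorphXn /= tau_v2 // rmorphXn /= conjcK.
have Gp : G p = 0 by rewrite /G local_coordxx conjc0.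
case: tau_sym => /(_ p)[_ [a /nearpP ha]] _.
have a0 : a 0%N = 0.
  have := nearp_self ha; rewrite local_coordxx -/(G p) Gp => h.
  exact: pseries_unique (@pseries0 _ a) h.
have hG : expands p G a by apply: nearp_imp ha => q h _.
have hG1 : expands p (fun q => G q / local_coord p q ^+ 1) (fun j => a (1 + j)%N).
  by apply: expands_drop hG => -[|j].
pose b := a (1 + 0)%N.
have hs : nearp p (fun q => q != p -> (G q / local_coord p q) ^+ 2 = 1).
  apply: nearp_imp (nearp_and (nearp_dom p) (local_coord_neq0 p)) => q [h1 h2] qp.
  by rewrite expr_div_n G2 // divff // expf_neq0 // h2.
pose proof (expands_near hG1 (ltr01 : (0 : R) < 1)) as hb.
have [q0 [q0p h1 h2]] := nearp_nontrivial2 hs hb.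
exists (G q0 / local_coord p q0).
  by apply: contra_eqN h1 => /eqP ->; rewrite expr0n eq_sym oner_eq0.
apply: nearp_imp (nearp_and (nearp_and hs hb) (local_coord_neq0 p)) => q [[h3 h4] h5].
rewrite -/(G q); have [->|qp] := eqVneq q p; first by rewrite Gp local_coordxx mulr0.
rewrite -[LHS](divfK (h5 qp)); congr (_ * _).
have := h3 qp; rewrite -h1 => /eqP; rewrite eqf_sqr => /orP[/eqP //|/eqP h6].
exfalso; have := h4 qp; move: h2; rewrite expr1 h6.
set t := G q0 / _; rewrite -/b => k1 k2.
(* Both [t] and [- t] lie within 1 of the limit [b] of the ratio, whereas two opposite numbers of
   modulus 1 are at distance 2. *)
have : normc (t - - t) < 2.
  have := normc_triangle t (- t) b; rewrite [normc (b - - t)]normcB; move: k1 k2; lra.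
rewrite opprK -mulr2n normcMn.
suff -> : normc t = 1 by rewrite ltxx.
have := congr1 (@normc R) h1; rewrite normcX normc1 => /eqP.
by rewrite sqrf_eq1 => /orP[/eqP //|/eqP h7]; exfalso; have := normc_ge0 t; move: h7; rewrite -/t; lra.
Qed.

Lemma has_order_tau p F n : has_order (tau p) F n ->
  has_order p (fun q => (F (tau q))^*%C) n.
Proof.
have [s s0 hs] := tau_coord p.
apply: (@has_order_pull _ _ _ _ (@conjc R) tau) s0 _ _ hs => //.
- exact: normc_conj.
- exact: tau_nearp.
- by move=> q; rewrite (inj_eq (inv_inj tauK)).
Qed.

Lemma principal_tau D : principal D -> principal (act_div tau D).
Proof.
move=> [F hF]; exists (fun q => (F (tau q))^*%C) => p.
rewrite coeff_act_div; last exact: tauK.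
exact: has_order_tau.
Qed.

Lemma lin_equiv_tau D E : lin_equiv D E -> lin_equiv (act_div tau D) (act_div tau E).
Proof.
move=> h; pose proof (principal_tau h) as h2; apply: principal_coeff h2 => p.
by rewrite act_divD ?act_divN //; exact: tauK.
Qed.

(** The image of a branch point is a branch point over the conjugate, and a branch point is alone in
    its fibre. The one at infinity is thus always fixed, in accordance with its counting as real. *)
Lemma tau_fixed_real r : iota r = r ->
  (tau r == r) = oapp (fun a => a \is Num.real) true (Defs.proj r).
Proof.
move=> /eqP hr; have := hr; rewrite -tau_iota_fixed iota_fixedE => /eqP hr'.
move: hr; rewrite iota_fixedE => /eqP hr.
have := tau_val r; rewrite -val_eqE /Defs.proj; move: hr hr'; rewrite /chart_v.
case hx: (val r) => [[x y]|v] /= h1 h2 [w hw]; move: h2; rewrite hw /= => ->; rewrite h1.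
  apply/eqP/idP => [[hx']|/conjc_id -> //].
  by apply/complex_realP; exists (complex.Re x); case: (x) hx' => a b [] /eqP;
    rewrite eq_sym -subr_eq0 opprK -mulr2n mulrn_eq0 => /eqP ->.
by rewrite eqxx.
Qed.

Lemma div_class_eqP D E : div_class D = div_class E <-> lin_equiv D E.
Proof.
split=> [h|h].
  have hE : div_class E E := lin_equiv_refl E.
  rewrite -h in hE; exact: hE.
apply/seteqP; split=> A hA; first exact: lin_equiv_trans (lin_equiv_sym h) hA.
exact: lin_equiv_trans h hA.
Qed.

Lemma fixes_classP D : fixes tau (div_class D) <-> lin_equiv (act_div tau D) D.
Proof.
split=> [h|h E hE]; first exact/h/lin_equiv_refl.
apply: lin_equiv_trans (lin_equiv_trans h hE).
exact/lin_equiv_tau/lin_equiv_sym.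
Qed.

Lemma klein_classP D : act_div tau @` div_class D = div_class D <->
  lin_equiv (act_div tau D) D.
Proof.
have hi E : (act_div tau @` div_class D) E <-> div_class (act_div tau D) E.
  split=> [[A hA <-]|hE]; first exact: lin_equiv_tau.
  exists (act_div tau E); last exact/act_divK/tauK.
  have := lin_equiv_tau hE; rewrite act_divK; last exact: tauK.
  exact.
have -> : act_div tau @` div_class D = div_class (act_div tau D).
  by apply/seteqP; split=> E /hi.
exact: div_class_eqP.
Qed.

End Symmetry.

(** * Cardinality of an injective image *)

Section CardinalOfImage.

Lemma card_image_seq (U : choiceType) (V : Type) (s : seq U) (f : U -> V) :
  uniq s -> {in s &, injective f} ->
  [set v | exists2 x, x \in s & v = f x] #= `I_(size s).
Proof.
case: s => [|x0 s0] us hf.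
  have -> : [set v | exists2 x, x \in [::] & v = f x] = set0.
    by apply/seteqP; split=> v //= -[].
  by rewrite II0; exact: card_eq00.
set s := x0 :: s0 in us hf *.
have -> : [set v | exists2 x, x \in s & v = f x] = (fun i => f (nth x0 s i)) @` `I_(size s).
  apply/seteqP; split=> v /= [].
    move=> x xs ->; exists (index x s); last by rewrite nth_index.
    by move: xs; rewrite -index_mem.
  by move=> i hi <-; exists (nth x0 s i) => //; exact: mem_nth.
apply: inj_card_eq => i j; rewrite !inE /= => hi hj /hf h.
have hi' : (i < size s)%N := hi; have hj' : (j < size s)%N := hj.
by apply/eqP; rewrite -(nth_uniq x0 hi' hj' us); apply/eqP/h; exact: mem_nth.
Qed.

End CardinalOfImage.

(** * Counting the invariant spin structures *)

Section SpinStructures.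
Variables (R : realType) (g : nat) (e : seq R[i]).
Context {hyp : hyperelliptic g e}.
Notation C := R[i].
Notation X := (surface g e).
Implicit Types (p q r : X) (n m : int) (D E : divisor g e).

(** At infinity, 0 lies on the surface iff the coefficient of x ^ (2g+2) vanishes, that is iff N is
    odd. This turns the count of real branch points into a count on the surface. *)
Lemma proj_branch_list : map (@Defs.proj R g e) (branch_list g e) = branch_points e.
Proof.
rewrite /branch_list /branch_points pmap_cat map_cat; congr (_ ++ _).
  have aux (s : seq C) : {subset s <= e} ->
      map (@Defs.proj R g e) (pmap insub [seq inl (a, 0) | a <- s]) = map Some s.
    elim: s => [|a s IH] //= hs.
    have ha : on_surface g e (inl (a, 0)).
      by rewrite /= expr0n eq_sym; apply/eqP/rootP; rewrite root_prod_XsubC hs ?mem_head.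
    by rewrite insubT /= IH // => x xs; apply: hs; rewrite inE xs orbT.
  exact: aux.
rewrite /=; have ho : on_surface g e (inr 0) = odd (size e).
  rewrite /= expr0n /=; have := monicP (monic_defining_poly e); rewrite lead_coefE size_defining_poly /=.
  case: (roots_size (hyperelliptic := hyp)) => hs.
    by rewrite hs => ->; rewrite eq_sym oner_eq0 /= odd_double.
  have -> : (defining_poly e)`_(g.*2.+2) = 0 by rewrite nth_default // size_defining_poly hs.
  by rewrite eqxx hs /= odd_double.
case: insubP => [u hu hv|/negbTE]; rewrite -ho; last by move=> ->.
by rewrite hu /= /Defs.proj hv.
Qed.

Lemma size_branch_list : size (branch_list g e) = g.*2.+2.
Proof.
rewrite -(size_map (@Defs.proj R g e)) proj_branch_list size_cat size_map.
by case: (roots_size (hyperelliptic := hyp)) => ->; rewrite /= odd_double /= ?addn0 ?addn1.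
Qed.

Variable r0 : X.
Hypothesis r0_fixed : iota r0 = r0.

(** The spin structure of (g-1) r0, twice which is g-1 fibres, translated by a class of order
    two. *)
Definition spin_divisor (P : pred X) : divisor g e :=
  delta r0 P + << (g%:Z - 1) *g r0 >>.

Lemma spinP D : (exists2 K, Defs.canonical K & lin_equiv (D *+ 2) K) <->
  principal ((D - << (g%:Z - 1) *g r0 >>) *+ 2).
Proof.
have e1 : (D - << (g%:Z - 1) *g r0 >>) *+ 2 = D *+ 2 - Phi r0 *~ (g%:Z - 1).
  apply: divisor_eq => q.
  by rewrite Phi_fixed // !(coeffMn, coeffB, coeffMz, coeffU); ring.
rewrite e1; split=> [[K hK hDK]|h].
  exact: lin_equiv_trans hDK (canonical_equiv r0 hK).
by exists (Phi r0 *~ (g%:Z - 1)); [exact: canonical_Phi|exact: h].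
Qed.

Variable r1 : X.
Hypothesis r1_fixed : iota r1 = r1.
Hypothesis r1_r0 : r1 != r0.

Lemma spin_classes S : spin_structures S <->
  exists2 P : pred X, P r1 = false & S = div_class (spin_divisor P).
Proof.
split=> [[D [-> /spinP /(torsion_delta_normal r0_fixed r1) [P P1 hP]]]|[P P1 ->]].
  exists P; first exact: P1.
  apply/div_class_eqP.
  by apply: principal_coeff hP => q; rewrite /spin_divisor !(coeffB, coeffD); ring.
exists (spin_divisor P); split=> //; apply/spinP.
rewrite /spin_divisor addrK; exact: delta_double.
Qed.

Lemma spin_divisor_inj P Q : P r1 = Q r1 ->
  lin_equiv (spin_divisor P) (spin_divisor Q) ->
  forall r, iota r = r -> r != r0 -> P r = Q r.
Proof.
move=> h1 h; apply: (delta_inj r0_fixed r1_fixed r1_r0 h1).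
by apply: principal_coeff h => q; rewrite /spin_divisor !(coeffB, coeffD); ring.
Qed.

Variable tau : X -> X.
Hypothesis f_real : defining_poly e \is a polyOver Num.real.
Hypothesis tau_sym : symmetry tau.
Hypothesis tau_conj : induced_by_conj tau.
Hypothesis tau_r0 : tau r0 = r0.
Hypothesis tau_r1 : tau r1 = r1.

Let tauI : involutive tau := tauK tau_sym.

Lemma act_div_point (r : X) n : act_div tau << n *g r >> = << n *g tau r >>.
Proof.
apply: divisor_eq => q; rewrite coeff_act_div // !coeffU.
by rewrite -(inj_eq (inv_inj tauI) r) tauI.
Qed.

Lemma perm_tau_branch : perm_eq (map tau (branch_list g e)) (branch_list g e).
Proof.
apply: uniq_perm; rewrite ?(map_inj_uniq (inv_inj tauI)) ?uniq_branch_list //.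
move=> q; rewrite -{1}[q]tauI (mem_map (inv_inj tauI)) !mem_branch_list.
exact: tau_iota_fixed.
Qed.

Lemma act_spin_divisor P :
  act_div tau (spin_divisor P) = spin_divisor (fun q => P (tau q)).
Proof.
have act0 : act_div tau 0 = 0 by rewrite /act_div dom0 big_nil.
rewrite /spin_divisor act_divD // act_div_point tau_r0; congr (_ + _).
rewrite /delta (big_morph _ (fun D E => act_divD D E tauI) act0).
rewrite -[RHS](perm_big _ perm_tau_branch) big_map.
under [RHS]eq_bigl do rewrite tauI.
apply: eq_bigr => r _.
by rewrite act_divD // act_divN // !act_div_point tau_r0.
Qed.

(** A normalized predicate is false at r1 and is considered off r0, so its restriction to [W]
    determines the class. *)
Let W : seq X := [seq r <- branch_list g e | (r != r0) && (r != r1)].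
Let T : finType := seq_sub W.

Lemma mem_W r : (r \in W) = [&& r != r0, r != r1 & iota r == r].
Proof. by rewrite mem_filter mem_branch_list andbA. Qed.

Lemma tau_W (x : T) : tau (val x) \in W.
Proof.
have := valP x; rewrite !mem_W => /and3P[h0 h1 h2].
rewrite tau_iota_fixed // h2 -{1}tau_r0 -{1}tau_r1 !(inj_eq (inv_inj tauI)).
by rewrite h0 h1.
Qed.

Let sigma (x : T) : T := SeqSub (tau_W x).

Lemma sigmaK : involutive sigma.
Proof. by move=> x; apply: val_inj; exact: tauI. Qed.

Definition set_pred (A : {set T}) : pred X := fun r => [exists x in A, val x == r].

Lemma set_predE A (x : T) : set_pred A (val x) = (x \in A).
Proof.
apply/existsP/idP => [[y /andP[yA /eqP /val_inj <-]]//|xA].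
by exists x; rewrite xA eqxx.
Qed.

Lemma set_pred_notin A r : r \notin W -> set_pred A r = false.
Proof.
move=> h; apply/existsP => -[y /andP[_ /eqP yr]].
by move: h; rewrite -yr (valP y).
Qed.

Lemma set_pred_r1 A : set_pred A r1 = false.
Proof. by apply: set_pred_notin; rewrite mem_W eqxx andbF. Qed.

Lemma set_pred_tau A : A \in invariant_sets sigma ->
  spin_divisor (fun q => set_pred A (tau q)) = spin_divisor (set_pred A).
Proof.
move=> /mem_invariant_sets hA; rewrite /spin_divisor; congr (_ + _).
apply: delta_eq => r hr rr0.
have [->|rr1] := eqVneq r r1; first by rewrite tau_r1.
have rW : r \in W by rewrite mem_W rr0 rr1 hr eqxx.
by rewrite -[r]/(val (SeqSub rW)) (set_predE A (SeqSub rW)) -hA -set_predE.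
Qed.

Lemma spin_fixed_classes :
  [set S | spin_structures S /\ fixes tau S] =
  [set S | exists2 A, A \in enum (invariant_sets sigma) &
     S = div_class (spin_divisor (set_pred A))].
Proof.
apply/seteqP; split=> S /=.
  move=> [/spin_classes[P P1 ->] /fixes_classP hfix].
  have {}hfix : lin_equiv (spin_divisor (fun q => P (tau q))) (spin_divisor P).
    by rewrite -act_spin_divisor; exact: hfix.
  have hP : forall r, iota r = r -> r != r0 -> P (tau r) = P r.
    by apply: spin_divisor_inj hfix; rewrite tau_r1.
  pose A : {set T} := finset (fun x => P (val x)).
  have AP (x : T) : (x \in A) = P (val x) by rewrite inE.
  exists A.
    rewrite mem_enum; apply/mem_invariant_sets => x; rewrite !AP /=.
    have := valP x; rewrite mem_W => /and3P[h0 _ /eqP h2]; exact: hP.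
  congr div_class; rewrite /spin_divisor; congr (_ + _); apply: delta_eq => r hr rr0.
  have [->|rr1] := eqVneq r r1; first by rewrite P1 set_pred_r1.
  have rW : r \in W by rewrite mem_W rr0 rr1 hr eqxx.
  by rewrite -[r]/(val (SeqSub rW)) set_predE AP.
move=> [A]; rewrite mem_enum => hA ->; split.
  by apply/spin_classes; exists (set_pred A); first exact: set_pred_r1.
apply/fixes_classP => //; rewrite act_spin_divisor set_pred_tau //.
exact: lin_equiv_refl.
Qed.

(** Stability of a class as a set and invariance of its members both amount to tau D ~ D for a
    single representative. *)
Lemma klein_spin_fixed :
  klein_spin_structures tau = [set S | spin_structures S /\ fixes tau S].
Proof.
apply/seteqP; split=> S [hS hk]; split=> //; move: hk;
  have [D [-> _]] := hS.
  by move/(klein_classP f_real tau_sym tau_conj) => h; apply/fixes_classP.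
by move/(fixes_classP f_real tau_sym tau_conj) => h; apply/klein_classP.
Qed.

Lemma card_spin_fixed (k : nat) : num_real_branch_points e = k.*2 ->
  [set S | spin_structures S /\ fixes tau S] #= `I_(2 ^ (g + k - 1)).
Proof.
move=> hk; rewrite spin_fixed_classes.
have uW : uniq W by rewrite filter_uniq // uniq_branch_list.
have hperm : perm_eq (branch_list g e) [:: r0, r1 & W].
  apply: uniq_perm; first exact: uniq_branch_list.
    by rewrite /= !inE eq_sym (negbTE r1_r0) uW !mem_W !eqxx /= andbF.
  move=> q; rewrite !inE mem_W mem_branch_list.
  have [->|q0] := eqVneq q r0; first by rewrite r0_fixed eqxx.
  by have [->|q1] := eqVneq q r1; first by rewrite r1_fixed eqxx.
have hT : perm_eq (map val (enum T)) W.
  apply: uniq_perm => //; first by rewrite map_inj_uniq ?enum_uniq //; exact: val_inj.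
  move=> q; apply/mapP/idP => [[x _ ->]|qW]; first exact: valP.
  by exists (SeqSub qW); rewrite ?mem_enum.
have cardT : (#|T| = g.*2)%N.
  have := perm_size hperm; rewrite size_branch_list /= => -[->].
  by rewrite -(perm_size hT) size_map -cardE.
have cardF : (#|[pred x | sigma x == x]| = k.*2 - 2)%N.
  have -> : #|[pred x | sigma x == x]| = count (fun q => tau q == q) W.
    rewrite -(permP hT) count_map cardE.
    have -> : enum [pred x | sigma x == x] = [seq x <- enum T | sigma x == x].
      by rewrite enumT.
    by rewrite size_filter; apply: eq_count => x; rewrite /= -val_eqE.
  rewrite -hk /num_real_branch_points -proj_branch_list count_map.
  have -> : count (preim (@Defs.proj R g e) (oapp (fun a => a \is Num.real) true))
       (branch_list g e) = count (fun q => tau q == q) (branch_list g e).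
    apply: eq_in_count => q; rewrite mem_branch_list => /eqP hq /=.
    by rewrite tau_fixed_real.
  by rewrite (permP hperm) /= tau_r0 tau_r1 !eqxx add1n add1n subn2.
(* Since r0 and r1 are among the 2k real branch points, the subtractions in [k.*2 - 2] and
   [g + k - 1] are not truncated. *)
have k0 : (0 < k)%N.
  have : (count (fun q => tau q == q) [:: r0, r1 & W] <= k.*2)%N.
    rewrite -hk /num_real_branch_points -proj_branch_list count_map -(permP hperm).
    rewrite leq_eqVlt; apply/orP; left; apply/eqP/eq_in_count => q.
    by rewrite mem_branch_list => /eqP hq /=; rewrite tau_fixed_real.
  by rewrite /= tau_r0 tau_r1 !eqxx; case: (k).
have <- : size (enum (invariant_sets sigma)) = (2 ^ (g + k - 1))%N.
  (* The exponent 2g + (2k - 2) is twice g + k - 1, so the square can be removed. *)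
  have := card_invariant_sets sigmaK; rewrite cardT cardF -cardE.
  have -> : (g.*2 + (k.*2 - 2) = (g + k - 1) * 2)%N by lia.
  by rewrite expnM => /eqP; rewrite eqn_exp2r // => /eqP.
apply: card_image_seq; first exact: enum_uniq.
move=> A B _ _ /div_class_eqP /spin_divisor_inj h.
apply/setP => x; rewrite -!set_predE; have := valP x.
rewrite mem_W => /and3P[h0 _ /eqP h2]; apply: h h2 h0.
by rewrite !set_pred_r1.
Qed.

End SpinStructures.

Theorem theorem16 (R : realType) (g k : nat) (e : seq R[i])
    (tau : surface g e -> surface g e) :
  uniq e ->
  size e = g.*2.+2 \/ size e = g.*2.+1 ->
  defining_poly e \is a polyOver Num.real ->
  (exists2 a, a \in e & a \isn't Num.real) ->
  symmetry tau ->
  induced_by_conj tau ->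
  num_real_branch_points e = k.*2 ->
  (0 < k)%N ->
  [set S | spin_structures S /\ fixes tau S] #= `I_(2 ^ (g + k - 1)) /\
  klein_spin_structures tau #= `I_(2 ^ (g + k - 1)).
Proof.
move=> ue se f_real _ tau_sym tau_conj hk k0.
have hyp : hyperelliptic g e by split.
(* The fixed branch points are those with real projection; there are 2k > 0 of them, hence at least
   two, which serve as r0 and r1. *)
pose s := [seq r <- branch_list g e | tau r == r].
have us : uniq s by rewrite filter_uniq // uniq_branch_list.
have ss : size s = k.*2.
  rewrite size_filter -hk /num_real_branch_points -proj_branch_list count_map.
  apply: eq_in_count => q; rewrite mem_branch_list => /eqP hq /=.
  by rewrite tau_fixed_real.
have mem_s r : r \in s -> iota r = r /\ tau r = r.
  by rewrite mem_filter mem_branch_list => /andP[/eqP ? /eqP].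
case: s us ss mem_s => [|r0 [|r1 s]] us ss mem_s.
- by rewrite -(ltn_double 0) -ss in k0.
- by move: ss => /(congr1 odd); rewrite odd_double.
have [i0 t0] := mem_s r0 (mem_head _ _).
have [i1 t1] : iota r1 = r1 /\ tau r1 = r1 by apply: mem_s; rewrite !inE eqxx orbT.
have r10 : r1 != r0 by move: us; rewrite /= inE eq_sym => /andP[/norP[]].
pose proof (card_spin_fixed i0 i1 r10 f_real tau_sym tau_conj t0 t1 hk) as h.
by split; [exact: h|rewrite klein_spin_fixed //; exact: h].
Qed.
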